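(* Let $k,n$ be positive integers, $m$ an integer with $0\le m\le n$, $a\in\mathbf R^n$, $A\subset\mathbf R^n$, suppose $A$ is pointwise differentiable of order $1$ at $a$, let $S\in\mathbf G(n,m)$, and suppose $P_1\in\operatorname{Hom}(S,S^\perp)$ satisfies $\operatorname{Tan}(A,a)=\{\chi+P_1(\chi):\chi\in S\}$. Then the following two conditions are equivalent. (1) $A$ is pointwise differentiable of order $k$ at $a$. (2) There exist homogeneous polynomial functions $P_i:S\to S^\perp$ of degree $i$ for $i=2,\dots,k$ such that the following holds: if $$A_1=\{x-a:x\in A\},\qquad A_i=\{x-P_{i-1}(S_\natural(x)):x\in A_{i-1}\}\ \text{ for } i=2,\dots,k,$$ then the sets $B_i=\{\chi+P_i(\chi):\chi\in S\}$ satisfy $$\lim_{s\to0+}\operatorname{dist}(x,\beta_{i,s}(A_i))=\operatorname{dist}(x,B_i)\quad\text{for }x\in\mathbf R^n\text{ and }i=2,\dots,k,$$ where $\beta_{i,s}:\mathbf R^n\to\mathbf R^n$, $\beta_{i,s}(x)=s^{-1}S_\natural(x)+s^{-i}S^\perp_\natural(x)$ for $x\in\mathbf R^n$ and $0<s<\infty$. In this case $\operatorname{pt}\mathrm D^iA(a,S)=\mathrm D^i(P_i\circ S_\natural)(0)$ for $i=1,\dots,k$.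
   Context: Notation. $\mathbf B(a,r)$ is the closed ball; $\operatorname{dist}(x,A)=\inf\{|x-b|:b\in A\}$; $\beta(A)$ denotes the image of $A$ under $\beta$. $\mathbf G(n,m)$ is the set of $m$-dimensional linear subspaces of $\mathbf R^n$; $S_\natural$ and $S^\perp_\natural$ are the orthogonal projections of $\mathbf R^n$ onto $S$ and onto its orthogonal complement $S^\perp$. $\operatorname{Tan}(A,a)$ is the set of $v$ such that for every $\varepsilon>0$ there are $x\in A$, $0<r<\infty$ with $|x-a|<\varepsilon$, $|r(x-a)-v|<\varepsilon$. The zero function counts as a homogeneous polynomial function of every degree. A map is of class $k$ if its domain is open and it is $k$ times continuously differentiable; submanifolds of class $k$ of $\mathbf R^n$ are embedded $\mathscr C^k$ submanifolds without boundary (locally closed subsets that are locally straightened to a linear subspace by ambient $\mathscr C^k$ diffeomorphisms), of any dimension $0,\dots,n$. $A$ is pointwise differentiable of order $k$ at $a$ if there is a submanifold $B$ of class $k$ of $\mathbf R^n$ with $a\in B$, $\lim_{r\to0+}r^{-1}\sup\{|\operatorname{dist}(x,A)-\operatorname{dist}(x,B)|:x\in\mathbf B(a,r)\}=0$ and $\lim_{r\to0+}r^{-k}\sup\{\operatorname{dist}(x,B):x\in A\cap\mathbf B(a,r)\}=0$. In this case $a\in\operatorname{Clos}A$ and $\operatorname{Tan}(A,a)=\operatorname{Tan}(B,a)$ is a linear subspace. Pointwise differential: for $i\ge1$, $\operatorname{pt}\mathrm D^iA$ is the function whose domain is the set of all $(a,S)$ such that $a\in\operatorname{Clos}A$, $A$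 is pointwise differentiable of order $i$ at $a$, $S\in\mathbf G(n,\dim\operatorname{Tan}(A,a))$ and $S^\perp\cap\operatorname{Tan}(A,a)=\{0\}$; its value at $(a,S)$ is the unique symmetric $i$-linear map $\phi:(\mathbf R^n)^i\to\mathbf R^n$ such that for some $f:S\to S^\perp$ of class $i$ one has $\phi=\mathrm D^i(f\circ S_\natural)(a)$ and $B=\{\chi+f(\chi):\chi\in S\}$ satisfies the two limit conditions above with $k$ replaced by $i$. *)

(* Defs.v *)
From HB Require Import structures.
From mathcomp Require Import all_boot all_order all_algebra all_fingroup.
From mathcomp Require Import sesquilinear.
From mathcomp Require Import all_classical all_reals all_analysis.

Set Implicit Arguments.
Unset Strict Implicit.
Unset Printing Implicit Defensive.

Import Order.TTheory GRing.Theory Num.Theory.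
Import numFieldNormedType.Exports.

Local Open Scope classical_set_scope.
Local Open Scope ring_scope.

(* The library norm on 'rV[R]_n is the sup norm.  It is used below only through
   the topology and the notion of differentiability, which agree with the
   Euclidean ones, and likewise for its restriction to subspaces; every metric quantity (balls, distances, tangent vectors)
   goes through the Euclidean norm [enorm]. *)

Section Euclidean.
Context {R : realType} {n : nat}.
Implicit Types u v : 'rV[R]_n.

Definition edot u v : R := \sum_(i < n) u 0 i * v 0 i.

Lemma edot_bilinear :
  bilinear_for ( *%R : R -> R -> R) (idfun \; *%R : R -> R -> R) edot.
Proof.
split=> w c u v; rewrite /edot /= mulr_sumr -big_split /=;
  apply: eq_bigr => i _; rewrite !mxE.
- by rewrite mulrDl mulrA.
- by rewrite mulrDr mulrCA.
Qed.

HB.instance Definition _ := bilinear_isBilinear.Build R 'rV[R]_n 'rV[R]_n R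
  ( *%R) (idfun \; *%R) edot edot_bilinear.

Lemma edot_sym u v : edot u v = (-1) ^+ false * idfun (edot v u).
Proof. by rewrite mul1r /edot; apply: eq_bigr => i _; rewrite mulrC. Qed.

HB.instance Definition _ := isHermitianSesquilinear.Build R 'rV[R]_n false
  idfun edot edot_sym.

Lemma edot_gt0 u : u != 0 -> 0 < edot u u.
Proof.
move=> u0; rewrite lt_neqAle sumr_ge0 ?andbT; last first.
  by move=> i _; rewrite -expr2 sqr_ge0.
apply: contra u0; rewrite eq_sym psumr_eq0 => [|i _]; last first.
  by rewrite -expr2 sqr_ge0.
move=> /allP u0; apply/eqP/rowP => i; rewrite !mxE; apply/eqP.
by have := u0 i (mem_index_enum _); rewrite mulf_eq0 orbb.
Qed.

HB.instance Definition _ := isDotProduct.Build R 'rV[R]_n edot edot_gt0.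

Definition enorm u : R := Num.sqrt (edot u u).

Definition ecball (a : 'rV[R]_n) (r : R) : set 'rV[R]_n :=
  [set x | enorm (x - a) <= r].

(* The value is +oo when [A] is empty. *)
Definition edist (x : 'rV[R]_n) (A : set 'rV[R]_n) : \bar R :=
  ereal_inf [set (enorm (x - b))%:E | b in A].

Definition Tan (A : set 'rV[R]_n) (a : 'rV[R]_n) : set 'rV[R]_n :=
  [set v | forall e : R, 0 < e -> exists x r,
    [/\ A x, 0 < r, enorm (x - a) < e & enorm (r *: (x - a) - v) < e]].

Definition perp (S : {vspace 'rV[R]_n}) : {vspace 'rV[R]_n} :=
  orthov edot S.

(* [daddv_pi S (perp S)] is the projection onto [S] along [perp S]; [vsproj]
   only casts its values, which lie in [S], to the type [subvs_of S]. *)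
Definition orthproj (S : {vspace 'rV[R]_n}) (x : 'rV[R]_n) : subvs_of S :=
  vsproj S (daddv_pi S (perp S) x).

End Euclidean.

Section OrthprojFacts.
Context {R : realType} {n : nat}.
Implicit Types (S : {vspace 'rV[R]_n}) (x : 'rV[R]_n).

Lemma cap_perp S : (S :&: perp S = 0)%VS.
Proof.
apply/eqP; rewrite -subv0; apply/subvP => u /memv_capP[uS].
move=> /mem_orthovP /(_ u uS) uu0; rewrite memv0; apply: contraT.
by move=> /edot_gt0; rewrite uu0 ltxx.
Qed.

Lemma add_perp S : (S + perp S)%VS = fullv.
Proof.
pose g (v : 'rV[R]_n) : 'rV[R]_(\dim S) := \row_i edot v (vbasis S)`_i.
have glin : linear g.
  by move=> c u v; apply/rowP => i; rewrite !mxE linearPl.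
pose gL := GRing.isLinear.Build R _ _ _ g glin.
pose G : {linear 'rV[R]_n -> 'rV[R]_(\dim S)} := HB.pack g gL.
have kerG : (lker (linfun G) <= perp S)%VS.
  apply/subvP => u; rewrite memv_ker lfunE /= => /eqP gu.
  apply/mem_orthovP => v /coord_vbasis ->; rewrite linear_sumr big1 // => i _.
  by rewrite linearZr /=; have /rowP/(_ i) := gu; rewrite !mxE => ->; rewrite mulr0.
apply/eqP; rewrite eqEdim subvf /= dimv_disjoint_sum ?cap_perp//.
have := limg_ker_dim (linfun G) fullv; rewrite capfv => <-.
rewrite addnC leq_add ?dimvS//.
by rewrite (leq_trans (dimvS (subvf _)))// dimvf /dim /= mul1n.
Qed.

Lemma orthproj_perp S x : vsval (orthproj (perp S) x) = daddv_pi (perp S) S x.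
Proof.
rewrite vsprojK ?memv_pi//.
have SS : (S <= perp (perp S))%VS by rewrite /perp orthov_sym.
suff -> : perp (perp S) = S by [].
apply/esym/eqP; rewrite eqEdim SS /=.
have := dimv_disjoint_sum (cap_perp S).
have := dimv_disjoint_sum (cap_perp (perp S)).
by rewrite !add_perp => -> /eqP; rewrite addnC eqn_add2r => /eqP ->.
Qed.

Lemma orthproj_add S x :
  vsval (orthproj S x) + vsval (orthproj (perp S) x) = x.
Proof.
rewrite orthproj_perp vsprojK ?memv_pi// daddv_pi_add ?cap_perp//.
by rewrite add_perp memvf.
Qed.

End OrthprojFacts.

Section SubspaceNorm.
Context {R : realType} {n : nat} (S : {vspace 'rV[R]_n}).

Let subvs_norm (u : subvs_of S) : R := `|vsval u|.

Let subvs_normD u v : subvs_norm (u + v) <= subvs_norm u + subvs_norm v.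
Proof. by rewrite /subvs_norm linearD ler_normD. Qed.

Let subvs_normZ (l : R) u : subvs_norm (l *: u) = `|l| * subvs_norm u.
Proof. by rewrite /subvs_norm linearZ normrZ. Qed.

Let subvs_norm0_eq0 u : subvs_norm u = 0 -> u = 0.
Proof. by move=> /normr0_eq0 u0; apply/val_inj; rewrite /= u0. Qed.

HB.instance Definition _ := Lmodule_isNormed.Build R (subvs_of S)
  subvs_normD subvs_normZ subvs_norm0_eq0.

End SubspaceNorm.

Section Differentiation.
Context {R : realType} {V W : normedModType R}.

(* [iter_diff [:: v1; ..; vi] f x] is D^i f(x)(v1, .., vi), under the usual
   identification of iterated linear maps with multilinear ones. *)
Fixpoint iter_diff (vs : seq V) (f : V -> W) : V -> W :=
  if vs is v :: vs' then fun x => 'd (iter_diff vs' f) x v else f.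

Definition Dn (i : nat) (f : V -> W) (x : V) : ('I_i -> V) -> W :=
  fun v => iter_diff (codom v) f x.

(* [V] is finite dimensional in all uses; D^i f is then differentiable
   (continuous) as a map into the multilinear maps if and only if all its
   evaluations at fixed vectors are. *)
Definition of_class (k : nat) (U : set V) (f : V -> W) : Prop :=
  open U /\ forall vs : seq V, (size vs <= k)%N ->
    (forall x, U x -> {for x, continuous (iter_diff vs f)}) /\
    ((size vs < k)%N -> forall x, U x -> differentiable (iter_diff vs f) x).

End Differentiation.

Arguments Dn {R V W} i f x.

Section Multilinear.
Context {R : realType} {V W : lmodType R}.

Definition multilinear (i : nat) (phi : ('I_i -> V) -> W) : Prop :=
  forall (v : 'I_i -> V) (j : 'I_i) (c : R) (x y : V),
    let upd z := fun l : 'I_i => if l == j then z else v l in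
    phi (upd (c *: x + y)) = c *: phi (upd x) + phi (upd y).

Definition symmetric_map (i : nat) (phi : ('I_i -> V) -> W) : Prop :=
  forall (s : 'S_i) (v : 'I_i -> V), phi (v \o s) = phi v.

(* The zero function satisfies this in every degree [i]. *)
Definition homog_poly (i : nat) (p : V -> W) : Prop :=
  exists psi : ('I_i -> V) -> W,
    multilinear psi /\ forall x, p x = psi (fun=> x).

End Multilinear.

Section PointwiseDifferentiability.
Context {R : realType} {n : nat}.
Local Notation Rn := 'rV[R]_n.
Implicit Types (A B U : set Rn) (a : Rn) (S Z : {vspace Rn}).

(* The subspace [Z] may vary with [b], but its dimension may not. *)
Definition submanifold (k : nat) B : Prop :=
  exists2 m : nat, (m <= n)%N & forall b, B b ->
    exists U (sigma tau : Rn -> Rn) Z,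
      [/\ U b, of_class k U sigma, of_class k (sigma @` U) tau,
          forall x, U x -> tau (sigma x) = x &
          \dim Z = m /\ sigma @` (B `&` U) = [set` Z] `&` sigma @` U].

(* With extended real distances and suprema, the first limit fails when [A] is
   empty, and it forces [A] to meet every ball around [a] when [a] lies in [B],
   so that the second supremum is over a nonempty set. *)
Definition approx_by (k : nat) A a B : Prop :=
  ((r^-1)%:E *
     ereal_sup [set `|edist x A - edist x B| | x in ecball a r])%E
    @[r --> 0^'+] --> 0%E /\
  ((r ^- k)%:E * ereal_sup [set edist x B | x in A `&` ecball a r])%E
    @[r --> 0^'+] --> 0%E.

Definition pt_diff (k : nat) A a : Prop :=
  exists B, [/\ submanifold k B, B a & approx_by k A a B].

Definition graph S (f : subvs_of S -> subvs_of (perp S)) : set Rn :=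
  [set vsval chi + vsval (f chi) | chi in setT].

(* The composition of [f] with the orthogonal projection onto [S]. *)
Definition ext S (f : subvs_of S -> subvs_of (perp S)) : Rn -> Rn :=
  fun x => vsval (f (orthproj S x)).

Definition ptD_dom (i : nat) A a S : Prop :=
  [/\ closure A a, pt_diff i A a &
      exists T : {vspace Rn},
        [/\ Tan A a = [set` T], \dim S = \dim T & (perp S :&: T = 0)%VS]].

Definition ptD_spec (i : nat) A a S (phi : ('I_i -> Rn) -> Rn) : Prop :=
  [/\ multilinear phi, symmetric_map phi &
      exists f : subvs_of S -> subvs_of (perp S),
        [/\ of_class i setT f, phi = Dn i (ext f) a & approx_by i A a (graph f)]].

(* [ptD i A a S phi] : the pair (a, S) belongs to the domain of pt D^i A and the
   value of pt D^i A there is [phi]. *)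
Definition ptD (i : nat) A a S (phi : ('I_i -> Rn) -> Rn) : Prop :=
  ptD_dom i A a S /\ unique (@ptD_spec i A a S) phi.

(* [flat A a P i] is the set A_i, for i >= 1 (the value at i = 0 is unused):
   A_1 = A - a and A_(j+1) = { x - P_j (orthproj S x) : x in A_j }. *)
Fixpoint flat A a S (P : nat -> subvs_of S -> subvs_of (perp S)) (i : nat)
    : set Rn :=
  match i with
  | (j'.+1 as j).+1 => [set x - ext (P j) x | x in flat A a P j]
  | _ => [set x - a | x in A]
  end.

Definition beta S (i : nat) (s : R) (x : Rn) : Rn :=
  s^-1 *: vsval (orthproj S x) + s ^- i *: vsval (orthproj (perp S) x).

(* The family [P] is indexed from 1, and its first member is the given [P1]. *)
Definition blowup_condition (k : nat) A a S
    (P1 : 'Hom(subvs_of S, subvs_of (perp S)))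
    (P : nat -> subvs_of S -> subvs_of (perp S)) : Prop :=
  P 1%N =1 P1 /\
  forall i, (2 <= i <= k)%N ->
    homog_poly i (P i) /\
    forall x : Rn,
      edist x (beta S i s @` flat A a P i) @[s --> 0^'+]
        --> edist x (graph (P i)).

End PointwiseDifferentiability.

Arguments ptD_spec {R n} i A a S phi.
Arguments ptD {R n} i A a S phi.

(* Main.v *)
(* Fix h = x - a and write h' for its component in S^perp.  Both conditions are
   equivalent to the expansion

     h' = P_1(h) + ... + P_k(h) + o(|h|^k)   for x in A, x -> a,      (E_k)

   where the first order approximation of A by a + Tan(A, a) is given.

   If A is pointwise differentiable of order k, a chart of B gives Taylor
   expansions of order k, in a common parameter, of both components of points of
   B.  Only the linear part of the S-component has to be inverted: the defect of
   P_1, ..., P_j is o(|h|^j), so its leading term, a polynomial of degree j + 1 in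
   the parameter, is to first order a polynomial of the S-component.  Conversely
   (E_k) lets one take for B the graph of a translate of P_1 + ... + P_k.

   Given (E_i), the blow-ups at scale s have vertical coordinate P_i + o(1) on
   bounded sets, and first order differentiability makes their projections fill S;
   this is the convergence of distances.  Conversely, a point h of A - a with
   vertical defect y is rescaled by s = max(|h|, |y|^(1/i)), which keeps it in a
   fixed compact set, where the convergence is uniform.

   The differential: by (E_i) and Taylor's theorem the polynomials of any
   competing f agree with the P_j, and polarization recovers D^i f(a). *)
From HB Require Import structures.
Require Import Defs.
From mathcomp Require Import all_boot all_order all_algebra all_fingroup.
From mathcomp Require Import sesquilinear ring lra.
From mathcomp Require Import all_classical all_reals all_analysis.

Set Implicit Arguments.
Unset Strict Implicit.
Unset Printing Implicit Defensive.

Import Order.TTheory GRing.Theory Num.Theory.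
Import numFieldNormedType.Exports.

Local Open Scope classical_set_scope.
Local Open Scope ring_scope.

(* Failing unification problems would otherwise unfold the choice operator in
   the definition of ['d]. *)
Local Opaque diff.

(* The library has an [edist] of its own. *)
Local Notation edist := Defs.edist.

(** * Differentials and polynomial maps *)

Section DifferentialEps.
Context {R : realType} {V W : normedModType R}.
Implicit Types (f : V -> W) (df : {linear V -> W}).

(** A map f from S to its complement is handled through [ext f] on the whole space, so that
    polynomials have coordinates and subspaces enter only through projections.

    Little-o statements are restricted to the set of all x - a with x in A ([smallon]). This set may
    be far from a neighbourhood of 0, and a homogeneous polynomial that is small on it need not
    vanish. Uniqueness of the P_i therefore rests on directions in which A has points at every small
    scale ([ray]): all tangent vectors are such directions, they project onto S, and [ext f] depends
    on the S-component only.

    Distance functions are replaced early by approximating points ([close_at]), a relation that can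
    be composed; the approximations of A by B, of B by the tangent space and of the tangent space by
    A are then chained.

    In the passage from blow-ups back to the expansion, taking a maximum for s leaves a multiple of
    the very quantity being estimated on the right-hand side; it is absorbed because its coefficient
    is at most 1/2. *)

Lemma differentiable_eps f x : differentiable f x -> forall e : R, 0 < e ->
  exists2 d : R, 0 < d & forall h, `|h| < d ->
    `|f (x + h) - f x - 'd f x h| <= e * `|h|.
Proof.
move=> dfx e e0; have /eqaddoP/(_ e e0)/nbhs_norm0P[d /= d0 H] := diff_locally dfx.
exists d => // h hd; have := H h hd.
by rewrite /= !fctE opprD addrA (addrC h).
Qed.

Lemma continuous_at_eps f x : (forall e : R, 0 < e ->
    exists2 d : R, 0 < d & forall h, `|h| < d -> `|f (x + h) - f x| <= e) ->
  {for x, continuous f}.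
Proof.
move=> H; apply/cvgrPdist_le => e e0; have [d d0 Hd] := H e e0.
apply/nbhs_normP; exists d => //= t /= xt; have := Hd (t - x).
by rewrite [x + _]addrC subrK !(distrC (f t), distrC t); exact.
Qed.

Lemma continuous_at_epsP f x : {for x, continuous f} -> forall e : R, 0 < e ->
    exists2 d : R, 0 < d & forall h, `|h| < d -> `|f (x + h) - f x| <= e.
Proof.
move=> /cvgrPdist_le H e e0; have /nbhs_normP[d /= d0 Hd] := H e e0.
exists d => // h hd; rewrite distrC; apply: Hd => /=.
by rewrite opprD addrA subrr sub0r normrN.
Qed.

Lemma is_diff_eps f df x : continuous df ->
  (forall e : R, 0 < e -> exists2 d : R, 0 < d & forall h, `|h| < d ->
    `|f (x + h) - f x - df h| <= e * `|h|) ->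
  is_diff x f df.
Proof.
move=> cdf H.
have E : f \o shift x = cst (f x) + df +o_ 0 id.
  apply/eqaddoP => e e0; have [d d0 Hd] := H e e0.
  apply/nbhs_norm0P; exists d => //= h hd.
  by rewrite /= !fctE opprD addrA (addrC h); exact: Hd.
have dE := diff_unique cdf E.
by apply: DiffDef => //; apply/diff_locallyP; rewrite dE.
Qed.

Lemma is_diff_near f g (df : V -> W) x : is_diff x f df ->
  (\forall y \near x, f y = g y) -> is_diff x g df.
Proof.
move=> [dfx fE] /nbhs_normP[d0 /= d00 H].
rewrite -fE; apply: is_diff_eps; first exact: diff_continuous.
move=> e e0; have [d1 d10 Hd] := differentiable_eps dfx e0.
exists (Num.min d0 d1); first by rewrite lt_min d00.
move=> h; rewrite lt_min => /andP[h0 h1]; rewrite -!H ?Hd//=.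
- by rewrite subrr normr0.
- by rewrite opprD addrA subrr sub0r normrN.
Qed.

End DifferentialEps.

Section LinearBound.
Context {R : realType} {n : nat}.
Local Notation V := 'rV[R]_n.
Implicit Types x y : V.

Lemma coord_le_norm x i : `|x 0 i| <= `|x|.
Proof.
rewrite [leRHS]mx_normrE.
exact: (@le_bigmax _ _ _ 0 (fun ij : 'I_1 * 'I_n => `|x ij.1 ij.2|) (0, i)).
Qed.

Lemma norm_le_coord x (e : R) : 0 <= e -> (forall i, `|x 0 i| <= e) -> `|x| <= e.
Proof.
move=> e0 H; rewrite [leLHS]mx_normrE; apply/bigmax_leP; split => // -[i j] _ /=.
by rewrite ord1.
Qed.

Lemma linear_bound (W : normedModType R) (g : {linear V -> W}) :
  exists2 C : R, 0 < C & forall x, `|g x| <= C * `|x|.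
Proof.
exists (1 + \sum_(i < n) `|g (delta_mx 0 i)|).
  by rewrite ltr_pwDl// sumr_ge0.
move=> x; rewrite {1}(row_sum_delta x) linear_sum.
rewrite (le_trans (ler_norm_sum _ _ _))// mulrDl mul1r mulr_suml.
rewrite ler_wpDl//; apply: ler_sum => i _; rewrite linearZ normrZ mulrC ler_wpM2l//.
exact: coord_le_norm.
Qed.

Lemma linear_rV_continuous (W : normedModType R) (g : {linear V -> W}) :
  continuous g.
Proof.
have [C C0 H] := linear_bound g.
move=> x; apply: continuous_at_eps => e e0; exists (e / C); first exact: divr_gt0.
by move=> h hd; rewrite linearD addrC addKr (le_trans (H _))// mulrC -ler_pdivlMr// ltW.
Qed.

End LinearBound.

Section DiffRules.
Context {R : realType} {V W : normedModType R}.

(** Registering the scalar product as a bilinear map turns the product rule [is_diff_scale] into the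
    chain rule for a bilinear map after a pair. *)
Lemma scale_is_bilinear :
  bilinear_for (GRing.Scale.Law.clone _ _ *:%R _)
    (GRing.Scale.Law.clone _ _ *:%R _) (@GRing.scale R W : R^o -> W -> W).
Proof.
by split=> [u'|u] a x y /=; rewrite ?scalerDl ?scalerDr ?scalerA// mulrC.
Qed.
HB.instance Definition _ := bilinear_isBilinear.Build R R^o W W _ _
  (@GRing.scale R W : R^o -> W -> W) scale_is_bilinear.

Lemma is_diff_scale (f df : V -> R) (g dg : V -> W) (x : V) :
  is_diff x (f : V -> R^o) df -> is_diff x g dg ->
  is_diff x (fun y => f y *: g y) (fun v => df v *: g x + f x *: dg v).
Proof.
move=> fx gx.
have sc : continuous (fun p : R^o * W => p.1 *: p.2).
  by move=> p; exact: scale_continuous.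
have sd (p : R^o * W) : is_diff p (fun q : R^o * W => q.1 *: q.2)
    (fun q => p.1 *: q.2 + q.1 *: p.2).
  apply: DiffDef.
    exact: (@differentiable_bilin _ R^o W W (@GRing.scale R W : R^o -> W -> W)).
  exact: (@diff_bilin _ R^o W W (@GRing.scale R W : R^o -> W -> W)).
have -> : (fun y => f y *: g y) =
    (fun q : R^o * W => q.1 *: q.2) \o (fun y => (f y : R^o, g y)) by [].
have pr : is_diff x (fun y => (f y : R^o, g y)) (fun v => (df v : R^o, dg v)).
  exact: is_diff_pair.
have cp := is_diff_comp pr (sd (f x, g x)).
apply: is_diff_eq cp _.
by apply/funext => v; rewrite /= addrC.
Qed.

Lemma is_diff_sum (I : Type) (s : seq I) (F dF : I -> V -> W) (x : V) :
  (forall i, is_diff x (F i) (dF i)) ->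
  is_diff x (fun y => \sum_(i <- s) F i y) (fun v => \sum_(i <- s) dF i v).
Proof.
move=> H; elim: s => [|i s IH].
  have -> : (fun y => \sum_(i <- [::]) F i y) = cst 0.
    by apply/funext => y; rewrite big_nil.
  apply: is_diff_eq (is_diff_cst _ _) _.
  by apply/funext => v; rewrite big_nil.
have -> : (fun y => \sum_(j <- i :: s) F j y) =
    F i + (fun y => \sum_(j <- s) F j y).
  by apply/funext => y; rewrite big_cons.
apply: is_diff_eq (is_diffD (H i) IH) _.
by apply/funext => v; rewrite big_cons.
Qed.

Lemma is_diff_val (f df : V -> W) (x v : V) : is_diff x f df -> 'd f x v = df v.
Proof. by move=> [_ ->]. Qed.

Lemma diff_cst_val (c : W) (x v : V) : 'd (cst c : V -> W) x v = 0.
Proof. exact: (is_diff_val _ (is_diff_cst _ _)). Qed.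

Lemma eq_diff (f g : V -> W) (x v : V) : f = g -> 'd f x v = 'd g x v.
Proof. by move=> ->. Qed.

Lemma is_diff_lin (f : {linear V -> W}) (x : V) : continuous f -> is_diff x f f.
Proof.
by move=> cf; apply: DiffDef; [exact: linear_differentiable|exact: diff_lin].
Qed.

End DiffRules.

Section HomogeneousPolynomials.
Context {R : realType} {n : nat}.
Local Notation V := 'rV[R]_n.
Implicit Types (p q : V -> V) (i j : nat).

(* Splitting off one variable at a time makes products and differentials of
   homogeneous polynomials a matter of induction; [homog_poly_hpoly] and
   [hpoly_homog_poly] relate this form to [homog_poly]. *)
Fixpoint hpoly i p : Prop :=
  if i is i'.+1 then exists q : 'I_n -> V -> V,
    (forall l, hpoly i' (q l)) /\ forall x, p x = \sum_l x 0 l *: q l x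
  else exists c, forall x, p x = c.

Lemma hpoly_ext i p q : p =1 q -> hpoly i p -> hpoly i q.
Proof. by move=> /funext ->. Qed.

Lemma hpoly0 i : hpoly i (fun=> 0).
Proof.
elim: i => [|i IH]; first by exists 0.
exists (fun _ _ => 0); split => // x; rewrite big1// => l _; exact: scaler0.
Qed.

Lemma hpolyD i p q : hpoly i p -> hpoly i q -> hpoly i (fun x => p x + q x).
Proof.
elim: i p q => [p q [c Hc] [d Hd]|i IH p q [r [hr Hr]] [s [hs Hs]]].
  by exists (c + d) => x; rewrite Hc Hd.
exists (fun l x => r l x + s l x); split => [l|x].
  exact: (IH _ _ (hr l) (hs l)).
by rewrite Hr Hs -big_split; apply: eq_bigr => l _; rewrite scalerDr.
Qed.

Lemma hpoly_sum (I : Type) (s : seq I) i (P : I -> V -> V) :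
  (forall k, hpoly i (P k)) -> hpoly i (fun x => \sum_(k <- s) P k x).
Proof.
move=> H; elim: s => [|k s IH].
  by apply: hpoly_ext (hpoly0 i) => x; rewrite big_nil.
by apply: hpoly_ext (hpolyD (H k) IH) => x; rewrite big_cons.
Qed.

Lemma hpoly_lcomp (g : {linear V -> V}) i p :
  hpoly i p -> hpoly i (fun x => g (p x)).
Proof.
elim: i p => [p [c Hc]|i IH p [r [hr Hr]]].
  by exists (g c) => x; rewrite Hc.
exists (fun l x => g (r l x)); split => [l|x]; first exact: (IH _ (hr l)).
by rewrite Hr linear_sum; apply: eq_bigr => l _; rewrite linearZ.
Qed.

Lemma hpolyZ (c : R) i p : hpoly i p -> hpoly i (fun x => c *: p x).
Proof. exact: (hpoly_lcomp ( *:%R c)). Qed.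

Lemma hpolyN i p : hpoly i p -> hpoly i (fun x => - p x).
Proof. by move=> /(hpolyZ (-1)); apply: hpoly_ext => x; rewrite scaleN1r. Qed.

Lemma hpolyX l i p : hpoly i p -> hpoly i.+1 (fun x => x 0 l *: p x).
Proof.
move=> hp; exists (fun k => if k == l then p else fun=> 0); split => [k|x].
  by case: ifP => // _; exact: hpoly0.
rewrite (bigD1 l)//= eqxx big1 ?addr0// => k /negPf ->.
by rewrite scaler0.
Qed.

Lemma hpoly_id : hpoly 1 id.
Proof.
exists (fun l _ => delta_mx 0 l); split => [l|x]; first by exists (delta_mx 0 l).
exact: row_sum_delta.
Qed.

(** The maps are vector-valued, so a product is formed with one coordinate of the first factor. *)
Lemma hpolyM l i j p q : hpoly i p -> hpoly j q ->
  hpoly (i + j) (fun x => p x 0 l *: q x).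
Proof.
move=> hp hq; elim: i p hp => [p [c Hc]|i IH p [r [hr Hr]]].
  by apply: hpoly_ext (hpolyZ (c 0 l) hq) => x; rewrite Hc.
apply: (@hpoly_ext _ (fun x => \sum_k x 0 k *: (r k x 0 l *: q x))) => [x|].
  rewrite Hr summxE scaler_suml; apply: eq_bigr => k _.
  by rewrite mxE scalerA.
by apply: hpoly_sum => k; apply: hpolyX; exact: (IH _ (hr k)).
Qed.

Lemma hpoly_rcomp (h : {linear V -> V}) i p :
  hpoly i p -> hpoly i (fun x => p (h x)).
Proof.
elim: i p => [p [c Hc]|i IH p [r [hr Hr]]].
  by exists c => x; rewrite Hc.
apply: (@hpoly_ext _ (fun x => \sum_l (h x) 0 l *: r l (h x))) => [x|].
  by rewrite Hr.
apply: hpoly_sum => l; apply: (@hpolyM l 1 i h); last exact: (IH _ (hr l)).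
exact: (hpoly_lcomp h hpoly_id).
Qed.

Lemma hpoly_homog i p (t : R) x : hpoly i p -> p (t *: x) = t ^+ i *: p x.
Proof.
elim: i p => [p [c Hc]|i IH p [r [hr Hr]]]; first by rewrite !Hc scale1r.
rewrite !Hr scaler_sumr; apply: eq_bigr => l _.
by rewrite (IH _ (hr l)) mxE !scalerA exprS; congr (_ *: _); ring.
Qed.

Lemma hpolyS_at0 i p : hpoly i.+1 p -> p 0 = 0.
Proof.
by move=> hp; have := hpoly_homog 0 0 hp; rewrite scaler0 exprS mul0r scale0r.
Qed.

Lemma hpoly_lip1 i p : hpoly i p -> exists2 C : R, 0 < C & forall x y,
  `|x| <= 1 -> `|y| <= 1 -> `|p x - p y| <= C * `|x - y|.
Proof.
elim: i p => [p [c Hc]|i IH p [r [hr Hr]]].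
  by exists 1 => // x y _ _; rewrite !Hc subrr normr0 mul1r.
have /choice[C HC] : forall l, exists C : R, 0 < C /\ forall x y,
    `|x| <= 1 -> `|y| <= 1 -> `|r l x - r l y| <= C * `|x - y|.
  by move=> l; have [C C0 H] := IH _ (hr l); exists C.
(* In the product x_l r_l(x), the factor r_l is bounded on the unit ball by its value at 0 plus
   [C l], and its own variation costs another [C l]. *)
exists (1 + \sum_l (`|r l 0| + C l + C l)).
  by rewrite ltr_pwDl// sumr_ge0// => l _; have [/ltW C0 _] := HC l; rewrite !addr_ge0.
move=> x y x1 y1; rewrite !Hr -sumrB (le_trans (ler_norm_sum _ _ _))//.
rewrite mulrDl mul1r ler_wpDl// mulr_suml; apply: ler_sum => l _.
have [C0 Cl] := HC l.
have -> : x 0 l *: r l x - y 0 l *: r l y =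
    (x 0 l - y 0 l) *: r l x + y 0 l *: (r l x - r l y).
  by rewrite scalerBl scalerBr addrA subrK.
rewrite (le_trans (ler_normD _ _))// !normrZ mulrDl lerD//.
- rewrite mulrC ler_pM//.
    rewrite -[r l x](subrK (r l 0)) addrC (le_trans (ler_normD _ _))// lerD2l.
    rewrite (le_trans (Cl _ _ _ _))// ?normr0//.
    by rewrite subr0 -[leRHS]mulr1 ler_wpM2l// ltW.
  by have := coord_le_norm (x - y) l; rewrite !mxE.
- rewrite -[leRHS]mul1r ler_pM ?Cl//.
  exact: le_trans (coord_le_norm _ _) _.
Qed.

(** Rescaling the unit ball to radius r multiplies values by r^(i+1) and divides arguments by r; the
    remaining factor r^i is what later makes first order errors in the argument harmless. *)
Lemma hpoly_lip i p : hpoly i.+1 p -> exists2 C : R, 0 < C & forall (r : R) x y,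
  0 < r -> `|x| <= r -> `|y| <= r -> `|p x - p y| <= C * r ^+ i * `|x - y|.
Proof.
move=> hp; have [C C0 H] := hpoly_lip1 hp.
exists C => // r x y r0 xr yr.
have rn0 : r != 0 by rewrite gt_eqF.
rewrite -{1}(scalerKV rn0 x) -{1}(scalerKV rn0 y).
rewrite (hpoly_homog r (r^-1 *: x) hp) (hpoly_homog r (r^-1 *: y) hp).
rewrite -scalerBr normrZ ger0_norm ?exprn_ge0 ?(ltW r0)//.
have sc (z : V) : `|z| <= r -> `|r^-1 *: z| <= 1.
  by move=> zr; rewrite normrZ ger0_norm ?invr_ge0 ?(ltW r0)// ler_pdivrMl// mulr1.
rewrite (le_trans (ler_wpM2l _ (H _ _ (sc _ xr) (sc _ yr))))//.
  by rewrite exprn_ge0// ltW.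
rewrite -scalerBr normrZ ger0_norm ?invr_ge0 ?(ltW r0)// exprS.
by rewrite le_eqVlt; apply/orP; left; apply/eqP; field.
Qed.

Lemma hpoly_bound i p : hpoly i p -> exists2 C : R, 0 < C & forall x,
  `|p x| <= C * `|x| ^+ i.
Proof.
case: i => [[c Hc]|i hp].
  by exists (1 + `|c|); [rewrite ltr_pwDl|move=> x; rewrite Hc mulr1 lerDr].
have [C C0 H] := hpoly_lip hp; exists C => // x.
have [->|x0] := eqVneq x 0; first by rewrite (hpolyS_at0 hp) !normr0 mulr_ge0// ltW.
have := H `|x| x 0; rewrite normr_gt0 normr0 (hpolyS_at0 hp) !subr0 exprSr mulrA.
exact.
Qed.

Lemma is_diff_coord l (x : V) : is_diff x (fun y : V => y 0 l : R^o) (fun y => y 0 l).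
Proof.
have lin : linear (fun y : V => y 0 l : R^o) by move=> a u v; rewrite !mxE.
pose cM := GRing.isLinear.Build _ _ _ _ _ lin.
pose c : {linear V -> R^o} := HB.pack (fun y : V => y 0 l : R^o) cM.
exact: (@is_diff_lin _ _ _ c _ (@linear_rV_continuous _ _ _ c)).
Qed.

Lemma is_diff_hpolyS (r : 'I_n -> V -> V) x :
  (forall l, differentiable (r l) x) ->
  is_diff x (fun y => \sum_l y 0 l *: r l y)
    (fun v => \sum_l (v 0 l *: r l x + x 0 l *: 'd (r l) x v)).
Proof.
move=> dr; apply: is_diff_sum => l.
exact: is_diff_scale (is_diff_coord l x) (differentiableP (dr l)).
Qed.

Lemma hpoly_is_diff i p : hpoly i p ->
  (forall x, differentiable p x) /\
  forall v, if i is i'.+1 then hpoly i' (fun x => 'd p x v)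
            else forall x, 'd p x v = 0.
Proof.
elim: i p => [p [c Hc]|i IH p [r [hr Hr]]].
  have -> : p = cst c by exact/funext.
  by split=> [x|v x]; [exact: differentiable_cst|rewrite diff_cst_val].
have -> : p = (fun y => \sum_l y 0 l *: r l y) by exact/funext.
have D x := is_diff_hpolyS (fun l => (IH _ (hr l)).1 x).
split => [x|v]; first exact: ex_diff.
apply: (@hpoly_ext _
  (fun x => \sum_l (v 0 l *: r l x + x 0 l *: 'd (r l) x v))) => [x|].
  exact/esym/(is_diff_val _ (D x)).
apply: hpoly_sum => l; apply: hpolyD; first exact: (hpolyZ _ (hr l)).
have := (IH _ (hr l)).2 v; case: i {IH} hr => [|i] hr H.
  by apply: hpoly_ext (hpoly0 0) => x; rewrite H scaler0.
exact: (hpolyX l H).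
Qed.

(** For polynomials the symmetry of second derivatives follows from the product rule: exchanging u
    and v exchanges the two terms with a first derivative, and the remaining term is symmetric by
    induction. *)
Lemma hpoly_schwarz i p u v : hpoly i p ->
  (fun x => 'd (fun y => 'd p y v) x u) = (fun x => 'd (fun y => 'd p y u) x v).
Proof.
elim: i p u v => [p u v hp|i IH p u v hp].
  have E w : (fun y => 'd p y w) = cst 0.
    by apply/funext => y; rewrite ((hpoly_is_diff hp).2 w).
  apply/funext => x; apply: (etrans (eq_diff x u (E v))).
  apply: (etrans (diff_cst_val 0 x u)).
  exact: (esym (etrans (eq_diff x v (E u)) (diff_cst_val 0 x v))).
case: hp => r [hr Hr].
have dr l x : differentiable (r l) x by exact: (hpoly_is_diff (hr l)).1.
have ddr l w x : differentiable (fun y => 'd (r l) y w) x.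
  have := (hpoly_is_diff (hr l)).2 w.
  case: (i) => [H|j /hpoly_is_diff[H _]]; last exact: H.
  have -> : (fun y => 'd (r l) y w) = cst 0 by exact/funext.
  exact: differentiable_cst.
have -> : p = (fun y => \sum_l y 0 l *: r l y) by exact/funext.
have E w : (fun x => 'd (fun y : V => \sum_l y 0 l *: r l y) x w) =
    (fun x => \sum_l (w 0 l *: r l x + x 0 l *: 'd (r l) x w)).
  apply/funext => x; exact: (is_diff_val _ (is_diff_hpolyS (dr^~ x))).
have F (w w' x : V) : 'd (fun x : V => \sum_l (w 0 l *: r l x + x 0 l *: 'd (r l) x w)) x w'
    = \sum_l (w 0 l *: 'd (r l) x w' + (w' 0 l *: 'd (r l) x w +
        x 0 l *: 'd (fun y => 'd (r l) y w) x w')).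
  have D : is_diff x (fun x => \sum_l (w 0 l *: r l x + x 0 l *: 'd (r l) x w))
     (fun w' => \sum_l (w 0 l *: 'd (r l) x w' + (w' 0 l *: 'd (r l) x w +
        x 0 l *: 'd (fun y => 'd (r l) y w) x w'))).
    apply: is_diff_sum => l.
    have D1 := is_diff_scale (is_diff_coord l x) (differentiableP (ddr l w x)).
    have D2 := is_diffZ (w 0 l) (differentiableP (dr l x)).
    exact: is_diffD D2 D1.
  exact: (is_diff_val _ D).
apply/funext => x; apply: (etrans (eq_diff x u (E v))); apply: (etrans (F v u x)).
apply/esym/(etrans (eq_diff x v (E u)))/(etrans (F u v x)); apply: eq_bigr => l _.
rewrite addrCA; congr (_ + (_ + _ *: _)).
exact/esym/(congr1 (@^~ x) (IH _ u v (hr l))).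
Qed.

Lemma hpoly_iter_diff i p vs : hpoly i p ->
  if (size vs <= i)%N then hpoly (i - size vs) (iter_diff vs p)
  else iter_diff vs p = cst 0.
Proof.
move=> hp; elim: vs => [|v vs] /=; first by rewrite subn0.
case: ltngtP => // si IH.
- have := (hpoly_is_diff IH).2 v; rewrite -subSS subSn//.
- by apply/funext => x; rewrite IH diff_cst_val.
- rewrite si subnn in IH.
  by apply/funext => x; rewrite ((hpoly_is_diff IH).2 v).
Qed.

Lemma hpoly_iter_differentiable i p vs x : hpoly i p ->
  differentiable (iter_diff vs p) x.
Proof.
move=> /(hpoly_iter_diff vs); case: ifP => _.
  by move=> /hpoly_is_diff[].
by move=> ->; exact: differentiable_cst.
Qed.

Lemma hpoly_iter_diff_perm i p (vs ws : seq V) : hpoly i p ->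
  perm_eq vs ws -> iter_diff vs p = iter_diff ws p.
Proof.
move=> hp.
have hq us : exists j, hpoly j (iter_diff us p).
  have := hpoly_iter_diff us hp; case: ifP => _; first by eexists; eassumption.
  by move=> ->; exists 0%N; exact: hpoly0.
(* Moving one vector past a list is a chain of adjacent exchanges; general permutations are reduced
   to exchanges of blocks. *)
have mv u us : forall ts, iter_diff (u :: us ++ ts) p = iter_diff (us ++ u :: ts) p.
  elim: us => //= w us IH ts; rewrite -IH.
  have [j hj] := hq (us ++ ts); exact: hpoly_schwarz hj.
apply/catCA_perm_subst: vs ws => s1 s2 s3.
elim: s1 s3 => //= u s1 IH s3.
by rewrite -[RHS]/(iter_diff (s2 ++ u :: (s1 ++ s3)) p) -mv /= IH.
Qed.

End HomogeneousPolynomials.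

Section ListMultilinear.
Context {R : realType} {V W : lmodType R}.

(* Lists carry the same arguments as functions on ['I_i], but match the shape
   of [iter_diff] and allow inserting a vector in the middle. *)
Definition lmult i (F : seq V -> W) : Prop :=
  forall s t c x y, (size s + size t).+1 = i ->
    F (s ++ (c *: x + y) :: t) = c *: F (s ++ x :: t) + F (s ++ y :: t).

Lemma nth_codom i (v : 'I_i -> V) (l : 'I_i) : nth 0 (codom v) l = v l.
Proof. by rewrite codomE (nth_map l) ?size_enum_ord// nth_ord_enum. Qed.

Lemma codom_nth i (s : seq V) : size s = i ->
  codom (fun l : 'I_i => nth 0 s l) = s.
Proof.
move=> si; apply: (@eq_from_nth _ 0) => [|k].
  by rewrite size_codom card_ord si.
rewrite size_codom card_ord => ki.
by rewrite -[k]/(nat_of_ord (Ordinal ki)) nth_codom.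
Qed.

Lemma codom_cst i (x : V) : codom (fun _ : 'I_i => x) = nseq i x.
Proof.
rewrite -[RHS](@codom_nth i) ?size_nseq//; congr codom; apply/funext => l.
by rewrite nth_nseq ltn_ord.
Qed.

Lemma codom_upd i (v : 'I_i -> V) (j : 'I_i) (z : V) :
  codom (fun l => if l == j then z else v l) =
  take j (codom v) ++ z :: drop j.+1 (codom v).
Proof.
have sv : size (codom v) = i by rewrite size_codom card_ord.
have st : size (take j (codom v)) = j by rewrite size_takel// sv ltnW.
rewrite -[RHS](@codom_nth i); last first.
  by rewrite size_cat st /= size_drop sv subnSK// subnKC// ltnW.
congr codom; apply/funext => l; rewrite nth_cat st -val_eqE /=.
case: ltngtP => [lj|jl|->]; last by rewrite subnn.
- by rewrite nth_take// nth_codom.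
- rewrite -[(l - j)%N]prednK ?subn_gt0//= nth_drop -[LHS]nth_codom; congr nth.
  by rewrite -subnS subnKC.
Qed.

Lemma lmult_multilinear i F :
  lmult i F -> multilinear (fun v : 'I_i -> V => F (codom v)).
Proof.
move=> HF v j c x y /=; rewrite !codom_upd HF// size_take size_drop.
by rewrite size_codom card_ord ltn_ord -addnS subnSK// subnKC// ltnW.
Qed.

Lemma multilinear_lmult i (psi : ('I_i -> V) -> W) : multilinear psi ->
  lmult i (fun s => psi (fun l => nth 0 s l)).
Proof.
move=> Hpsi s t c x y sti.
have si : (size s < i)%N by rewrite -sti ltnS leq_addr.
have E z : (fun l : 'I_i => nth 0 (s ++ z :: t) l) =
    (fun l : 'I_i => if l == Ordinal si then z else nth 0 (s ++ 0 :: t) l).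
  apply/funext => l; rewrite -val_eqE /= !nth_cat.
  case: ltngtP => [//|sl|->]; last by rewrite subnn.
  by rewrite -[(l - _)%N]prednK ?subn_gt0.
by rewrite !E; exact: Hpsi.
Qed.

End ListMultilinear.

Section HomogMultilinear.
Context {R : realType} {n : nat}.
Local Notation V := 'rV[R]_n.
Implicit Types (p q : V -> V) (i j : nat).

Lemma lmult_expand i (F : seq V -> V) s t x : lmult i F ->
  (size s + size t).+1 = i ->
  F (s ++ x :: t) = \sum_l x 0 l *: F (s ++ delta_mx 0 l :: t).
Proof.
move=> HF si.
have lin : linear (fun x => F (s ++ x :: t)) by move=> c u v; exact: HF.
pose gM := GRing.isLinear.Build _ _ _ _ _ lin.
pose g : {linear V -> V} := HB.pack (fun x => F (s ++ x :: t)) gM.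
rewrite -[LHS]/(g x) {1}(row_sum_delta x) linear_sum.
by apply: eq_bigr => l _; rewrite linearZ.
Qed.

Lemma lmult_hpoly i (F : seq V -> V) s j : lmult i F -> (size s + j)%N = i ->
  hpoly j (fun x => F (s ++ nseq j x)).
Proof.
move=> HF; elim: j s => [|j IH] s sj; first by exists (F (s ++ [::])).
exists (fun l x => F (s ++ delta_mx 0 l :: nseq j x)); split=> [l|x]; last first.
  by apply: lmult_expand HF _; rewrite size_nseq -addnS.
apply: hpoly_ext (IH (rcons s (delta_mx 0 l)) _) => [x|].
  by rewrite cat_rcons.
by rewrite size_rcons addSnnS.
Qed.

Lemma homog_poly_hpoly i p : homog_poly i p -> hpoly i p.
Proof.
move=> [psi [Hpsi pE]].
apply: hpoly_ext (@lmult_hpoly i _ [::] i (multilinear_lmult Hpsi) _) => // x.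
rewrite pE /=; congr psi; apply/funext => l.
by rewrite nth_nseq ltn_ord.
Qed.

Lemma hpoly_lmult i p : hpoly i p ->
  exists F, lmult i F /\ forall x, p x = F (nseq i x).
Proof.
elim: i p => [p [c Hc]|i IH p [r [hr Hr]]].
  by exists (fun=> c); split.
have /choice[F HF] : forall l, exists F, lmult i F /\ forall x, r l x = F (nseq i x).
  by move=> l; exact: IH (hr l).
exists (fun s : seq V => \sum_l (head 0 s : V) 0 l *: F l (behead s)); split=> [|x]; last first.
  by rewrite Hr; apply: eq_bigr => l _; rewrite (HF l).2.
move=> [|z s] t c x y /= [si]; rewrite scaler_sumr -big_split; apply: eq_bigr => l _ /=.
- by rewrite !mxE scalerDl scalerA.
- by rewrite (HF l).1// scalerDr !scalerA mulrC.
Qed.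

Lemma hpoly_homog_poly i p : hpoly i p -> homog_poly i p.
Proof.
move=> /hpoly_lmult[F [HF pE]]; exists (fun v => F (codom v)); split.
  exact: lmult_multilinear.
by move=> x; rewrite codom_cst.
Qed.

End HomogMultilinear.

Section Polynomials.
Context {R : realType} {n : nat}.
Local Notation V := 'rV[R]_n.
Implicit Types (p q : V -> V) (i j : nat).

Definition poly p := exists N (Q : nat -> V -> V),
  (forall i, hpoly i (Q i)) /\ forall x, p x = \sum_(i < N) Q i x.

Lemma poly_ext p q : p =1 q -> poly p -> poly q.
Proof. by move=> /funext ->. Qed.

Lemma poly_hpoly i p : hpoly i p -> poly p.
Proof.
move=> hp; exists i.+1, (fun j => if j == i then p else fun=> 0); split=> [j|x].
  by case: eqP => [->//|_]; exact: hpoly0.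
rewrite big_ord_recr /= eqxx big1 ?add0r// => j _.
by rewrite ltn_eqF.
Qed.

(** Padding with zero terms allows two polynomials to be written with the same number of terms. *)
Lemma poly_norm p : poly p -> exists N (Q : nat -> V -> V),
  (forall i, hpoly i (Q i)) /\
  forall M, (N <= M)%N -> forall x, p x = \sum_(i < M) Q i x.
Proof.
move=> [N [Q [hQ pE]]].
exists N, (fun i => if (i < N)%N then Q i else fun=> 0); split=> [i|M NM x].
  by case: ifP => _ //; exact: hpoly0.
rewrite pE (big_ord_widen _ (fun i => Q i x) NM) big_mkcond.
by apply: eq_bigr => i _; case: ifP.
Qed.

Lemma poly0 : poly (fun=> 0).
Proof. exact: (@poly_hpoly 0 _ (hpoly0 0)). Qed.

Lemma polyD p q : poly p -> poly q -> poly (fun x => p x + q x).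
Proof.
move=> /poly_norm[N [Q [hQ pE]]] /poly_norm[M [P [hP qE]]].
exists (maxn N M), (fun i x => Q i x + P i x); split=> [i|x].
  exact: hpolyD.
by rewrite big_split (pE (maxn N M)) ?leq_maxl// (qE (maxn N M)) ?leq_maxr.
Qed.

Lemma poly_sum (I : Type) (s : seq I) (P : I -> V -> V) :
  (forall k, poly (P k)) -> poly (fun x => \sum_(k <- s) P k x).
Proof.
move=> H; elim: s => [|k s IH].
  by apply: poly_ext poly0 => x; rewrite big_nil.
by apply: poly_ext (polyD (H k) IH) => x; rewrite big_cons.
Qed.

Lemma poly_lcomp (g : {linear V -> V}) p : poly p -> poly (fun x => g (p x)).
Proof.
move=> [N [Q [hQ pE]]]; exists N, (fun i x => g (Q i x)); split=> [i|x].
  exact: hpoly_lcomp.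
by rewrite pE linear_sum.
Qed.

Lemma polyN p : poly p -> poly (fun x => - p x).
Proof. by move=> /(poly_lcomp ( *:%R (-1))); apply: poly_ext => x /=; rewrite scaleN1r. Qed.

Lemma poly_rcomp (h : {linear V -> V}) p : poly p -> poly (fun x => p (h x)).
Proof.
move=> [N [Q [hQ pE]]]; exists N, (fun i x => Q i (h x)); split=> [i|x].
  exact: hpoly_rcomp.
by rewrite pE.
Qed.

Lemma polyM l p q : poly p -> poly q -> poly (fun x => p x 0 l *: q x).
Proof.
move=> [N [P [hP pE]]] [M [Q [hQ qE]]].
apply: (@poly_ext (fun x => \sum_(i < N) \sum_(j < M) P i x 0 l *: Q j x)) => [x|].
  rewrite pE qE summxE scaler_suml; apply: eq_bigr => i _.
  by rewrite scaler_sumr.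
apply: poly_sum => i; apply: poly_sum => j.
exact: poly_hpoly (hpolyM l (hP i) (hQ j)).
Qed.

Lemma poly_diff p : poly p ->
  (forall x, differentiable p x) /\ forall v, poly (fun x => 'd p x v).
Proof.
move=> [N [Q [hQ pE]]].
have -> : p = (fun x => \sum_(i < N) Q i x) by exact/funext.
have D x : is_diff x (fun x => \sum_(i < N) Q i x)
    (fun v => \sum_(i < N) 'd (Q i) x v).
  apply: is_diff_sum => i.
  exact: differentiableP ((hpoly_is_diff (hQ i)).1 x).
split=> [x|v]; first exact: (@ex_diff _ _ _ _ _ _ _ (D x)).
apply: (@poly_ext (fun x => \sum_(i < N) 'd (Q i) x v)) => [x|].
  exact/esym/(is_diff_val _ (D x)).
apply: poly_sum => i; have := (hpoly_is_diff (hQ i)).2 v.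
case: (nat_of_ord i) => [H|j]; last exact: poly_hpoly.
by apply: poly_ext poly0 => x; rewrite H.
Qed.

Lemma poly_of_class k p : poly p -> of_class k setT p.
Proof.
move=> hp; split; first exact: openT.
have H vs : poly (iter_diff vs p).
  by elim: vs => //= v vs IH; exact: (poly_diff IH).2.
move=> vs _; have D x := (poly_diff (H vs)).1 x.
split=> [x _|_ x _]; last exact: D.
exact: differentiable_continuous.
Qed.

Lemma poly_bounded p : poly p -> exists2 C : R, 0 < C & forall x,
  `|x| <= 1 -> `|p x| <= C.
Proof.
move=> [N [Q [hQ pE]]].
have /choice[C HC] : forall i, exists C : R, 0 < C /\ forall x, `|Q i x| <= C * `|x| ^+ i.
  by move=> i; have [C C0 H] := hpoly_bound (hQ i); exists C.
exists (1 + \sum_(i < N) C i).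
  by rewrite ltr_pwDl// sumr_ge0// => i _; exact/ltW/(HC i).1.
move=> x x1; rewrite pE (le_trans (ler_norm_sum _ _ _))// ler_wpDl//.
apply: ler_sum => i _; rewrite (le_trans ((HC i).2 x))//.
by rewrite -[leRHS]mulr1 ler_wpM2l ?exprn_ile1// ltW// (HC i).1.
Qed.

End Polynomials.

(** * Expansions *)

Section SmallOn.
Context {R : realType} {n : nat}.
Local Notation V := 'rV[R]_n.
Implicit Types (D : set V) (f g h p q : V -> V) (i j k : nat).

(** Little o of [|x| ^+ k] along [D]. The estimate includes x = 0, so it forces [g 0 = 0] as soon as
    0 lies in [D]. *)
Definition smallon D k g : Prop := forall e : R, 0 < e ->
  exists2 d : R, 0 < d & forall x, D x -> `|x| < d -> `|g x| <= e * `|x| ^+ k.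

Lemma smallon_ext D k f g : {in D, f =1 g} -> smallon D k f -> smallon D k g.
Proof.
move=> fg Hf e e0; have [d d0 H] := Hf e e0.
by exists d => // x Dx xd; rewrite -fg ?inE//; exact: H.
Qed.

Lemma smallonS D D' k g : D `<=` D' -> smallon D' k g -> smallon D k g.
Proof.
by move=> DD Hg e e0; have [d d0 H] := Hg e e0; exists d => // x /DD; exact: H.
Qed.

Lemma smallon_le D k k' g : (k' <= k)%N -> smallon D k g -> smallon D k' g.
Proof.
move=> kk Hg e e0; have [d d0 H] := Hg e e0.
exists (Num.min d 1); first by rewrite lt_min d0/=.
move=> x Dx; rewrite lt_min => /andP[xd x1]; rewrite (le_trans (H x Dx xd))//.
by rewrite ler_wpM2l ?(ltW e0)// ler_wiXn2l// ltW.
Qed.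

Lemma smallon0 D k : smallon D k (fun=> 0).
Proof.
by move=> e e0; exists 1 => // x _ _; rewrite normr0 mulr_ge0 ?exprn_ge0// ltW.
Qed.

Lemma smallonD D k f g : smallon D k f -> smallon D k g ->
  smallon D k (fun x => f x + g x).
Proof.
move=> Hf Hg e e0; have e20 : 0 < e / 2 by rewrite divr_gt0.
have [d d0 H] := Hf _ e20; have [d' d'0 H'] := Hg _ e20.
exists (Num.min d d'); first by rewrite lt_min d0.
move=> x Dx; rewrite lt_min => /andP[xd xd'].
rewrite (le_trans (ler_normD _ _))// [e in leRHS]splitr mulrDl.
by rewrite lerD ?H ?H'.
Qed.

Lemma smallon_lcomp D k (L : {linear V -> V}) g :
  smallon D k g -> smallon D k (fun x => L (g x)).
Proof.
move=> Hg e e0; have [C C0 HC] := linear_bound L.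
have [d d0 H] := Hg (e / C) (divr_gt0 e0 C0); exists d => // x Dx xd.
rewrite (le_trans (HC _))// -ler_pdivlMl// mulrA (mulrC C^-1).
exact: H.
Qed.

Lemma smallonN D k g : smallon D k g -> smallon D k (fun x => - g x).
Proof.
by move=> Hg e /Hg[d d0 H]; exists d => // x Dx xd; rewrite normrN H.
Qed.

Lemma smallonB D k f g : smallon D k f -> smallon D k g ->
  smallon D k (fun x => f x - g x).
Proof. by move=> Hf Hg; apply: smallonD => //; exact: smallonN. Qed.

Lemma smallon_sum (I : Type) (s : seq I) D k (F : I -> V -> V) :
  (forall a, smallon D k (F a)) -> smallon D k (fun x => \sum_(a <- s) F a x).
Proof.
move=> H; elim: s => [|a s IH].
  by apply: smallon_ext (smallon0 D k) => x _; rewrite big_nil.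
by apply: smallon_ext (smallonD (H a) IH) => x _; rewrite big_cons.
Qed.

Lemma smallonMl D k f g l (C d0 : R) : 0 < d0 ->
  (forall x, D x -> `|x| < d0 -> `|f x| <= C) -> smallon D k g ->
  smallon D k (fun x => f x 0 l *: g x).
Proof.
move=> d00 HC Hg e e0; have C0 : 0 < `|C| + 1 by rewrite ltr_wpDl.
have [d d'0 H] := Hg (e / (`|C| + 1)) (divr_gt0 e0 C0).
exists (Num.min d0 d); first by rewrite lt_min d00.
move=> x Dx; rewrite lt_min => /andP[xd xd'].
rewrite normrZ (@le_trans _ _ ((`|C| + 1) * `|g x|))//.
  rewrite ler_wpM2r// (le_trans (coord_le_norm _ _))// (le_trans (HC _ Dx xd))//.
  by rewrite (le_trans (ler_norm C))// lerDl.
by rewrite -ler_pdivlMl// mulrA (mulrC _^-1); exact: H.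
Qed.

Lemma smallonMr D k f g l (C d0 : R) : 0 < d0 ->
  (forall x, D x -> `|x| < d0 -> `|f x| <= C) -> smallon D k g ->
  smallon D k (fun x => g x 0 l *: f x).
Proof.
move=> d00 HC Hg e e0; have C0 : 0 < `|C| + 1 by rewrite ltr_wpDl.
have [d d'0 H] := Hg (e / (`|C| + 1)) (divr_gt0 e0 C0).
exists (Num.min d0 d); first by rewrite lt_min d00.
move=> x Dx; rewrite lt_min => /andP[xd xd'].
rewrite normrZ mulrC (@le_trans _ _ ((`|C| + 1) * `|g x|))//.
  rewrite ler_pM ?coord_le_norm// (le_trans (HC _ Dx xd))//.
  by rewrite (le_trans (ler_norm C))// lerDl.
by rewrite -ler_pdivlMl// mulrA (mulrC _^-1); exact: H.
Qed.

Lemma smallon_hpoly D k i p : (k < i)%N -> hpoly i p -> smallon D k p.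
Proof.
move=> ki hp e e0; have [C C0 H] := hpoly_bound hp.
exists (Num.min 1 (e / C)); first by rewrite lt_min ltr01 divr_gt0.
move=> x _; rewrite lt_min => /andP[x1 xe]; rewrite (le_trans (H x))//.
rewrite (@le_trans _ _ (C * `|x| ^+ k.+1))//.
  by rewrite ler_wpM2l ?(ltW C0)// ler_wiXn2l// ltW.
by rewrite exprS mulrA ler_wpM2r// mulrC -ler_pdivlMr// ltW.
Qed.

Lemma smallon_rcomp D D' k g h (C d0 : R) : 0 < d0 ->
  (forall x, D x -> `|x| < d0 -> D' (h x) /\ `|h x| <= C * `|x|) ->
  smallon D' k g -> smallon D k (fun x => g (h x)).
Proof.
move=> d00 Hh Hg e e0; have C0 : 0 < `|C| + 1 by rewrite ltr_wpDl.
have Ck0 : 0 < (`|C| + 1) ^+ k by rewrite exprn_gt0.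
have [d d'0 H] := Hg (e / (`|C| + 1) ^+ k) (divr_gt0 e0 Ck0).
exists (Num.min d0 (d / (`|C| + 1))); first by rewrite lt_min d00 divr_gt0.
move=> x Dx; rewrite lt_min ltr_pdivlMr// => /andP[xd xd'].
have [D'h hC] := Hh _ Dx xd.
have hC' : `|h x| <= `|x| * (`|C| + 1).
  rewrite (le_trans hC)// mulrC ler_wpM2l//.
  by rewrite (le_trans (ler_norm C))// lerDl.
rewrite (le_trans (H _ D'h (le_lt_trans hC' xd')))// -mulrA.
rewrite ler_wpM2l ?(ltW e0)// -ler_pdivlMl ?invr_gt0// invrK mulrC -exprMn.
by rewrite lerXn2r ?nnegrE// mulr_ge0// ltW.
Qed.

(* Unlike for a tangent vector, approximants exist at every small scale. *)
Definition ray D (v : V) : Prop := forall e : R, 0 < e ->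
  exists2 d : R, 0 < d & forall s, 0 < s < d ->
    exists2 x, D x & `|x - s *: v| <= e * s.

(** Points of [D] near s v, divided by s, tend to v, and by homogeneity the values of p at them tend
    to 0; continuity of p at v concludes. *)
Lemma hpoly_smallon_ray D i p v :
  hpoly i p -> smallon D i p -> ray D v -> p v = 0.
Proof.
move=> hp sp rv.
have H (e : R) : 0 < e -> exists2 w, `|w - v| <= e & `|p w| <= e.
  (* [M] bounds the rescaled points, hence |x| by s M; the smallness of p is therefore requested
     with the factor M^-i. *)
  move=> e0; pose M := `|v| + 1; have M0 : 0 < M by rewrite ltr_wpDl.
  have Mi0 : 0 < M ^+ i by rewrite exprn_gt0.
  have [d d0 Hd] := sp (e / M ^+ i) (divr_gt0 e0 Mi0).
  have e10 : 0 < Num.min e 1 by rewrite lt_min e0 ltr01.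
  have [d' d'0 Hd'] := rv _ e10.
  pose s := Num.min d' (d / M) / 2.
  have m0 : 0 < Num.min d' (d / M) by rewrite lt_min d'0 divr_gt0.
  have s0 : 0 < s by rewrite divr_gt0.
  have sm : s < Num.min d' (d / M) by rewrite ltr_pdivrMr// ltr_pMr// ltr1n.
  have := sm; rewrite lt_min => /andP[sd' sd].
  have [|x Dx xs] := Hd' s; first by rewrite s0.
  have sn0 : s != 0 by rewrite gt_eqF.
  have w1 : `|s^-1 *: x - v| <= Num.min e 1.
    rewrite -{1}(scalerK sn0 v) -scalerBr normrZ gtr0_norm ?invr_gt0//.
    by rewrite ler_pdivrMl// mulrC.
  have w2 : `|s^-1 *: x| <= M.
    rewrite -(subrK v (s^-1 *: x)) addrC (le_trans (ler_normD _ _))// lerD2l.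
    by rewrite (le_trans w1)// ge_min lexx orbT.
  have xM : `|x| <= s * M.
    by rewrite -[x](scalerKV sn0) normrZ gtr0_norm// ler_wpM2l// ltW.
  exists (s^-1 *: x); first by rewrite (le_trans w1)// ge_min lexx.
  rewrite (hpoly_homog _ _ hp) normrZ exprVn gtr0_norm ?invr_gt0 ?exprn_gt0//.
  rewrite ler_pdivrMl ?exprn_gt0//.
  have xd : `|x| < d by rewrite (le_lt_trans xM)// -ltr_pdivlMr.
  rewrite (le_trans (Hd _ Dx xd))//.
  rewrite -mulrA mulrC ler_wpM2r ?(ltW e0)//.
  by rewrite ler_pdivrMl// mulrC -exprMn lerXn2r ?nnegrE// mulr_ge0// ltW.
have cp : {for v, continuous p}.
  exact/differentiable_continuous/((hpoly_is_diff hp).1 v).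
apply/normr0_eq0/le_anti; rewrite normr_ge0 andbT.
apply/ler_addgt0Pr => e e0; rewrite add0r.
have e20 : 0 < e / 2 by rewrite divr_gt0.
have [d d0 Hd] := continuous_at_epsP cp e20.
have m0 : 0 < Num.min (e / 2) (d / 2) by rewrite lt_min e20 divr_gt0.
have [w] := H _ m0; rewrite !le_min => /andP[_ wd] /andP[we _].
have := Hd (w - v); rewrite [v + _]addrC subrK => Hw.
rewrite -(subrK (p w) (p v)) (le_trans (ler_normD _ _))// [leRHS]splitr lerD//.
by rewrite distrC Hw// (le_lt_trans wd)// ltr_pdivrMr// ltr_pMr// ltr1n.
Qed.

(** The terms are removed degree by degree: the lower ones vanish by induction and the higher ones
    are small, so the term of degree i is itself o(|x|^i) and vanishes on rays. The second
    hypothesis, that rays detect each term, holds when the rays cover a subspace through which the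
    terms factor. *)
Lemma poly_smallon_unique D j N (Q : nat -> V -> V) :
  (forall i, hpoly i (Q i)) ->
  (forall i, (forall v, ray D v -> Q i v = 0) -> forall x, Q i x = 0) ->
  smallon D j (fun x => \sum_(i < N) Q i x) ->
  forall i, (i <= j)%N -> (i < N)%N -> forall x, Q i x = 0.
Proof.
move=> hQ HQ sm; elim/ltn_ind => i IH ij iN; apply: HQ => v rv.
apply: (hpoly_smallon_ray (hQ i) _ rv).
have sm1 := smallon_le ij sm.
have sm2 : smallon D i (fun x => \sum_(l < N | (i < l)%N) Q l x).
  apply: (@smallon_ext _ _ (fun x => \sum_(l < N) if (i < l)%N then Q l x else 0)).
    by move=> x _; rewrite -big_mkcond.
  apply: smallon_sum => l; case il: (i < l)%N; first exact: (smallon_hpoly D il (hQ l)).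
  exact: smallon0.
apply: smallon_ext (smallonB sm1 sm2) => x _ /=.
rewrite (bigID (fun l : 'I_N => (i < l)%N))/= addrAC subrr add0r.
rewrite (bigD1 (Ordinal iN)) /= -?leqNgt// big1 ?addr0// => l /andP[].
rewrite -val_eqE -leqNgt leq_eqVlt /= => /orP[->//|li] _.
by apply: IH => //; rewrite (leq_trans _ ij)// ltnW.
Qed.

Lemma rayT v : ray setT v.
Proof.
move=> e e0; exists 1 => // s /andP[s0 _]; exists (s *: v) => //.
by rewrite subrr normr0 mulr_ge0// ltW.
Qed.

(** The degree of the polynomial is not bounded by k, so products and compositions need no
    truncation. *)
Definition taylor k g : Prop :=
  exists2 p, poly p & smallon setT k (fun x => g x - p x).

Lemma taylor_ext k f g : f =1 g -> taylor k f -> taylor k g.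
Proof. by move=> /funext ->. Qed.

Lemma taylor_poly k p : poly p -> taylor k p.
Proof.
by move=> hp; exists p => //; apply: smallon_ext (smallon0 setT k) => x _; rewrite subrr.
Qed.

Lemma taylorD k f g : taylor k f -> taylor k g -> taylor k (fun x => f x + g x).
Proof.
move=> [p hp H] [q hq H']; exists (fun x => p x + q x); first exact: polyD.
by apply: smallon_ext (smallonD H H') => x _; rewrite addrACA opprD.
Qed.

Lemma taylor_sum (I : Type) (s : seq I) k (F : I -> V -> V) :
  (forall a, taylor k (F a)) -> taylor k (fun x => \sum_(a <- s) F a x).
Proof.
move=> H; elim: s => [|a s IH].
  by apply: taylor_ext (taylor_poly k poly0) => x; rewrite big_nil.
by apply: taylor_ext (taylorD (H a) IH) => x; rewrite big_cons.
Qed.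

Lemma taylor_lcomp k (L : {linear V -> V}) g :
  taylor k g -> taylor k (fun x => L (g x)).
Proof.
move=> [p hp H]; exists (fun x => L (p x)); first exact: poly_lcomp.
by apply: smallon_ext (smallon_lcomp L H) => x _; rewrite linearB.
Qed.

Lemma taylorN k g : taylor k g -> taylor k (fun x => - g x).
Proof. by move=> /(taylor_lcomp ( *:%R (-1))); apply: taylor_ext => x /=; rewrite scaleN1r. Qed.

Lemma taylor_rcomp k (h : {linear V -> V}) g :
  taylor k g -> taylor k (fun x => g (h x)).
Proof.
move=> [p hp H]; exists (fun x => p (h x)); first exact: poly_rcomp.
have [C _ HC] := linear_bound h.
exact: (smallon_rcomp (D := setT) ltr01 (fun x _ _ => conj I (HC x)) H).
Qed.

Lemma taylor_bounded k g : taylor k g -> exists C, exists2 d : R, 0 < d &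
  forall x, `|x| < d -> `|g x| <= C.
Proof.
move=> [p hp /(_ 1 ltr01)[d d0 H]]; have [C C0 HC] := poly_bounded hp.
exists (1 + C), (Num.min d 1); first by rewrite lt_min d0 ltr01.
move=> x; rewrite lt_min => /andP[xd x1].
rewrite -(subrK (p x) (g x)) (le_trans (ler_normD _ _))// lerD ?HC ?(ltW x1)//.
by rewrite (le_trans (H _ I xd))// mul1r exprn_ile1// ltW.
Qed.

Lemma taylorM k l f g : taylor k f -> taylor k g ->
  taylor k (fun x => f x 0 l *: g x).
Proof.
move=> tf tg; have [Cg [dg dg0 Hg]] := taylor_bounded tg.
case: tf tg => p hp Hf [q hq Hq]; have [C C0 HC] := poly_bounded hp.
exists (fun x => p x 0 l *: q x); first exact: polyM.
have H1 := smallonMr l dg0 (fun x _ => Hg x) Hf.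
have H2 := smallonMl l ltr01 (fun x _ x1 => HC x (ltW x1)) Hq.
apply: smallon_ext (smallonD H1 H2) => x _.
by rewrite !mxE scalerBl scalerBr addrA subrK.
Qed.

Lemma taylor_hpoly_comp k i p g : hpoly i p -> taylor k g ->
  taylor k (fun x => p (g x)).
Proof.
move=> + tg; elim: i p => [p [c Hc]|i IH p [r [hr Hr]]].
  by apply: (taylor_poly k (@poly_hpoly _ _ 0 _ _)); exists c.
apply: (@taylor_ext _ (fun x => \sum_l g x 0 l *: r l (g x))) => [x|].
  by rewrite Hr.
by apply: taylor_sum => l; apply: taylorM tg (IH _ (hr l)).
Qed.

End SmallOn.

(** * Taylor's theorem with remainder controlled by the oscillation of the last derivative *)

Section Taylor1.
Context {R : realType}.

(** The remainder vanishes at 0 and its derivative is the remainder of order k - 1 of [psi 1], so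
    the mean value theorem and induction apply; since t is at most 1 the bound is not enlarged. Only
    the oscillation of the k-th derivative enters, as fits a map that is merely of class k. *)
Lemma taylor_lagrange_bound k (psi : nat -> R -> R) (M : R) :
  (forall j (t : R), (j < k)%N -> 0 <= t <= 1 ->
     is_derive t (1 : R) (psi j) (psi j.+1 t)) ->
  (forall t : R, 0 <= t <= 1 -> `|psi k t - psi k 0| <= M) ->
  forall t : R, 0 <= t <= 1 ->
    `|psi 0%N t - \sum_(j < k.+1) t ^+ j / j`!%:R * psi j 0| <= M.
Proof.
elim: k psi => [|k IH] psi dpsi HM t t01.
  by rewrite big_ord1 expr0 fact0 divr1 mul1r; exact: HM.
have {}IH := IH (fun j => psi j.+1) (fun j t jk => dpsi j.+1 t jk) HM.
pose g t := psi 0%N t - \sum_(j < k.+2) t ^+ j / j`!%:R * psi j 0.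
have dg (s : R) : 0 <= s <= 1 ->
    is_derive s (1 : R) g (psi 1%N s - \sum_(j < k.+1) s ^+ j / j`!%:R * psi j.+1 0).
  move=> s01.
  have D0 := dpsi 0%N s isT s01.
  have DX j : is_derive s (1 : R) (fun s : R => s ^+ j.+1 / j.+1`!%:R * psi j.+1 0)
      (s ^+ j / j`!%:R * psi j.+1 0).
    have -> : (fun s : R => s ^+ j.+1 / j.+1`!%:R * psi j.+1 0) =
        (psi j.+1 0 / j.+1`!%:R) *: (@id R ^+ j.+1).
      apply/funext => u; rewrite -[RHS]/(_ * _) fctE; ring.
    apply: is_derive_eq.
    rewrite -[LHS]/(_ * (_ * _)) mulr1 factS natrM.
    have j0 : j.+1%:R != 0 :> R by rewrite pnatr_eq0.
    have f0 : j`!%:R != 0 :> R by rewrite pnatr_eq0 -lt0n fact_gt0.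
    move: j0 f0; rewrite /=; move: (j.+1%:R) (j`!%:R) => J F j0 f0.
    by field; rewrite f0 j0.
  have -> : g = psi 0%N - (cst (psi 0%N 0) + \sum_(j < k.+1)
      (fun s : R => s ^+ j.+1 / j.+1`!%:R * psi j.+1 0)).
    apply/funext => u; rewrite /g big_ord_recl expr0 fact0 divr1 mul1r.
    by rewrite !fctE fct_sumE.
  apply: is_derive_eq.
  by rewrite add0r.
have g0 : g 0 = 0.
  rewrite /g big_ord_recl expr0 fact0 divr1 mul1r big1 ?addr0 ?subrr// => j _.
  by rewrite exprS !mul0r.
case/andP: (t01) => t0 t1.
have dgc s : s \in `[0, t] -> is_derive s (1 : R) g
    (psi 1%N s - \sum_(j < k.+1) s ^+ j / j`!%:R * psi j.+1 0).
  by rewrite in_itv /= => /andP[s0 st]; apply: dg; rewrite s0 /=; exact: le_trans st t1.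
pose dgf (s : R) : R := psi 1%N s - \sum_(j < k.+1) s ^+ j / j`!%:R * psi j.+1 0.
have gc : {within `[0, t], continuous g}.
  by apply: derivable_within_continuous => s /dgc[].
have dgo s : s \in `]0, t[ -> is_derive s (1 : R) g (dgf s).
  by move=> st; apply: dgc; exact: subset_itv_oo_cc st.
have [c c0t] := MVT_segment t0 dgo gc.
rewrite -/(g t) g0 !subr0 => ->.
move: c0t; rewrite in_itv /= => /andP[c0 ct].
rewrite normrM (ger0_norm t0) -[leRHS]mulr1 ler_pM//.
by apply: IH; rewrite c0 /=; exact: le_trans ct t1.
Qed.

End Taylor1.

Section IterDiff.
Context {R : realType} {V W : normedModType R}.
Implicit Types (f : V -> W) (U : set V).

(** Only the outermost slot is linear by construction. For an inner slot the identity holds on the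
    whole open set [U] and can be differentiated there. *)
Lemma iter_diff_slot k U f us t c x y z : of_class k U f ->
  (size us + size t < k)%N -> U z ->
  iter_diff (us ++ (c *: x + y) :: t) f z =
  c *: iter_diff (us ++ x :: t) f z + iter_diff (us ++ y :: t) f z.
Proof.
move=> [oU kf] + Uz; elim: us z Uz => [|u us IH] z Uz /= sk.
  exact: linearP.
have sk' := ltnW sk.
have D w : differentiable (iter_diff (us ++ w :: t) f) z.
  by apply: (kf (us ++ w :: t) _).2 => //; rewrite size_cat /= addnS// ltnW.
have Dc := is_diffD (is_diffZ c (differentiableP (D x))) (differentiableP (D y)).
have nE : \forall w \near z, (c *: iter_diff (us ++ x :: t) f +
    iter_diff (us ++ y :: t) f) w = iter_diff (us ++ (c *: x + y) :: t) f w.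
  apply: filterS (open_nbhs_nbhs (conj oU Uz)) => w Uw.
  by rewrite IH.
exact: (is_diff_val u (is_diff_near Dc nE)).
Qed.

Lemma iter_diff_lmult k U f i z : of_class k U f -> (i <= k)%N -> U z ->
  lmult i (fun vs => iter_diff vs f z).
Proof.
move=> kf ik Uz s t c x y si; apply: iter_diff_slot kf _ Uz.
by rewrite si.
Qed.

Lemma is_diff_line f (a h : V) (t : R) : differentiable f (a + t *: h) ->
  is_diff t (fun s : R => f (a + s *: h) : W) (fun s => 'd f (a + t *: h) (s *: h)).
Proof.
move=> df.
have D1 : is_diff t (fun s : R => a + s *: h) (fun s => s *: h).
  have D0 := is_diffD (is_diff_cst a t) (is_diff_scalel t h).
  have -> : (fun s : R => a + s *: h) = cst a + *:%R^~ h by [].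
  by apply: is_diff_eq D0 _; apply/funext => s; rewrite !fctE add0r.
exact: (is_diff_comp D1 (differentiableP df)).
Qed.

Lemma is_diff_is_derive1 (g dg : R -> W) (t : R) : is_diff t (g : R^o -> W) dg ->
  is_derive t (1 : R) g (dg 1).
Proof.
move=> D; apply: DeriveDef; first exact/diff_derivable/ex_diff.
by rewrite deriveE; [exact: is_diff_val D|exact: ex_diff].
Qed.

End IterDiff.

Section TaylorTheorem.
Context {R : realType} {n : nat}.
Local Notation V := 'rV[R]_n.
Implicit Types (f : V -> V) (U : set V).

(** Continuity is given for fixed vectors only; the bound uniform in h is obtained by expanding h
    slot by slot in the standard basis. Each of the n coordinates gets the share e / (n + 1), whose
    denominator is positive for every n. *)
Lemma iter_diff_continuity k U f a us j : of_class k U f -> U a ->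
  (size us + j)%N = k -> forall e : R, 0 < e ->
  \forall x \near a, U x /\ forall h,
    `|iter_diff (us ++ nseq j h) f x - iter_diff (us ++ nseq j h) f a|
      <= e * `|h| ^+ j.
Proof.
move=> kf Ua; have [oU cf] := kf.
have nU := open_nbhs_nbhs (conj oU Ua).
elim: j us => [|j IH] us sk e e0.
  have [|+ _] := cf us; first by rewrite -sk leq_addr.
  move=> /(_ a Ua)/cvgrPdist_le/(_ e e0) H; near=> x; split; first by near: x.
  by move=> h; rewrite cats0 mulr1 distrC; near: x.
have n0 : 0 < n.+1%:R :> R by rewrite ltr0n.
pose P (l : 'I_n) : set V := [set x | U x /\ forall h,
    `|iter_diff (rcons us (delta_mx 0 l) ++ nseq j h) f x -
      iter_diff (rcons us (delta_mx 0 l) ++ nseq j h) f a|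
      <= e / n.+1%:R * `|h| ^+ j].
have H : \forall x \near a, forall l, P l x.
  have FF : Filter (nbhs a) by exact: nbhs_filter.
  apply: (@filter_forall _ _ P (nbhs a) FF) => l; apply: IH; last exact: divr_gt0.
  by rewrite size_rcons addSnnS.
near=> x.
have Ux : U x by near: x.
split => // h.
have Hx : forall l, P l x by near: x.
have sk' : (size us + size (nseq j h)).+1 = k by rewrite size_nseq -addnS.
rewrite /= (lmult_expand _ (iter_diff_lmult kf (leqnn k) Ux) sk').
rewrite (lmult_expand _ (iter_diff_lmult kf (leqnn k) Ua) sk') -sumrB.
rewrite (le_trans (ler_norm_sum _ _ _))//.
rewrite (@le_trans _ _ (\sum_(l < n) e / n.+1%:R * `|h| ^+ j.+1))//.
  apply: ler_sum => l _; rewrite -scalerBr normrZ exprS mulrCA.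
  by rewrite ler_pM ?coord_le_norm// -!cat_rcons; exact: (Hx l).2.
rewrite sumr_const card_ord -[leLHS]mulr_natr -mulrA (mulrC (_ ^+ _)) mulrA.
rewrite ler_wpM2r// -mulrA ler_piMr ?(ltW e0)// mulrC ler_pdivrMr// mul1r.
by rewrite ler_nat.
Unshelve. all: by end_near. Qed.

Lemma taylor_of_class k U f a : of_class k U f -> U a ->
  let Q j h := (j`!%:R)^-1 *: iter_diff (nseq j h) f a in
  (forall j, (j <= k)%N -> hpoly j (Q j)) /\
  smallon setT k (fun h => f (a + h) - \sum_(j < k.+1) Q j h).
Proof.
move=> kf Ua Q; split=> [j jk|e e0].
  apply: hpolyZ; exact: (lmult_hpoly (s := [::]) (iter_diff_lmult kf jk Ua)).
have /nbhs_normP[d /= d0 H] := @iter_diff_continuity k U f a [::] k kf Ua erefl e e0.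
exists d => // h _ hd.
have B (t : R) : 0 <= t <= 1 -> `|a - (a + t *: h)| < d.
  move=> /andP[t0 t1]; rewrite opprD addrA subrr sub0r normrN normrZ ger0_norm//.
  by rewrite (le_lt_trans _ hd)// ler_piMl.
apply: norm_le_coord => [|l]; first by rewrite mulr_ge0 ?(ltW e0)// exprn_ge0.
(* The mean value theorem is scalar, so the remainder is estimated in each coordinate along the
   segment from a to a + h; in the sup norm this suffices. *)
pose psi j (t : R) := iter_diff (nseq j h) f (a + t *: h) 0 l.
have := @taylor_lagrange_bound R k psi (e * `|h| ^+ k) _ _ 1 _.
rewrite /psi scale1r scale0r addr0 !mxE summxE => T; apply: le_trans (T _ _ _) => //.
- rewrite le_eqVlt; apply/orP; left; apply/eqP; congr (`|_ - _|).
  by apply: eq_bigr => j _; rewrite mxE expr1n mul1r.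
- move=> j t jk t01.
  have Ut := (H _ (B t t01)).1.
  have dj : differentiable (iter_diff (nseq j h) f) (a + t *: h).
    by apply: (kf.2 _ _).2; rewrite ?size_nseq// ltnW.
  have D := is_diff_comp (is_diff_line dj) (is_diff_coord l _).
  have := is_diff_is_derive1 D.
  by rewrite /= scale1r.
- move=> t t01; have := (H _ (B t t01)).2 h.
  by move=> /(le_trans (coord_le_norm _ l)); rewrite !mxE.
- by rewrite ler01 lexx.
Qed.

End TaylorTheorem.

Section AffineComposition.
Context {R : realType} {V V' W W' : normedModType R}.

(** With [orthproj] and [vsval] as linear maps this carries derivatives between S and the whole
    space, and the constant [c] accounts for translations by the base point. *)
Lemma iter_diff_affine k (F : V -> W) (h : {linear V' -> V}) (c : V)
    (g : {linear W -> W'}) : continuous h -> continuous g ->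
  of_class k setT F -> forall vs, (size vs <= k)%N ->
  iter_diff vs (fun x => g (F (c + h x))) =
  (fun x => g (iter_diff (map h vs) F (c + h x))).
Proof.
move=> ch cg [_ kF]; elim=> //= v vs IH sk.
have {}IH := IH (ltnW sk); apply/funext => x; rewrite (eq_diff x v IH).
have dF : differentiable (iter_diff (map h vs) F) (c + h x).
  by apply: (kF _ _).2; rewrite ?size_map ?(ltnW sk).
have dh : is_diff x (fun x => c + h x) h.
  have D0 := is_diffD (is_diff_cst c x) (is_diff_lin x ch).
  have -> : (fun x => c + h x) = cst c + h by [].
  by apply: is_diff_eq D0 _; apply/funext => s; rewrite !fctE add0r.
have D1 := is_diff_comp dh (differentiableP dF).
have D2 := is_diff_comp D1 (is_diff_lin _ cg).
exact: (is_diff_val v D2).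
Qed.

Lemma of_class_affine k (F : V -> W) (h : {linear V' -> V}) (c : V)
    (g : {linear W -> W'}) : continuous h -> continuous g ->
  of_class k setT F -> of_class k setT (fun x => g (F (c + h x))).
Proof.
move=> ch cg kF; have kF2 := kF.2.
have ah : continuous (fun x => c + h x).
  by move=> x; apply: continuousD; [exact: cst_continuous|exact: ch].
split=> [|vs sk]; first exact: openT.
rewrite (iter_diff_affine c ch cg kF sk).
have sk' : (size (map h vs) <= k)%N by rewrite size_map.
split=> [x _|sk2 x _].
  apply: (@continuous_comp _ _ _ (fun x => iter_diff (map h vs) F (c + h x)) g);
    last exact: cg.
  apply: (@continuous_comp _ _ _ (fun x => c + h x)); first exact: ah.
  exact: (kF2 _ sk').1.
have dF : differentiable (iter_diff (map h vs) F) (c + h x).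
  by apply: (kF2 _ _).2; rewrite ?size_map.
have dh : is_diff x (fun x => c + h x) h.
  have D0 := is_diffD (is_diff_cst c x) (is_diff_lin x ch).
  have -> : (fun x => c + h x) = cst c + h by [].
  by apply: is_diff_eq D0 _; apply/funext => s; rewrite !fctE add0r.
have D1 := is_diff_comp dh (differentiableP dF).
have [D2 _] := is_diff_comp D1 (is_diff_lin _ cg).
exact: D2.
Qed.

End AffineComposition.

(** * Orthogonal projections and Euclidean distances *)

Section Projections.
Context {R : realType} {n : nat}.
Local Notation V := 'rV[R]_n.
Implicit Types (S : {vspace V}) (x : V).

Lemma orthproj_linear S : linear (@orthproj R n S).
Proof. by move=> c x y; rewrite /orthproj !linearP. Qed.
HB.instance Definition _ S :=
  GRing.isLinear.Build _ _ _ _ (@orthproj R n S) (@orthproj_linear S).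

Definition proj S x : V := vsval (orthproj S x).

Lemma proj_linear S : linear (@proj S).
Proof. by move=> c x y; rewrite /proj !linearP. Qed.
HB.instance Definition _ S :=
  GRing.isLinear.Build _ _ _ _ (@proj S) (@proj_linear S).

Lemma vsval_continuous S : continuous (@vsval _ _ S : subvs_of S -> V).
Proof.
move=> x; apply: continuous_at_eps => e e0; exists e => // h he.
by rewrite linearD /= addrC addKr; exact: ltW.
Qed.

Lemma orthproj_continuous S : continuous (@orthproj R n S).
Proof. exact: linear_rV_continuous. Qed.

Lemma proj_mem S x : proj S x \in S.
Proof. exact: subvsP. Qed.

Lemma proj_add S x : proj S x + proj (perp S) x = x.
Proof. exact: orthproj_add. Qed.

Lemma proj_id S x : x \in S -> proj S x = x.
Proof.
move=> xS; rewrite /proj vsprojK ?memv_pi// daddv_pi_id//.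
exact: cap_perp.
Qed.

Lemma proj_perp_eq0 S x : x \in S -> proj (perp S) x = 0.
Proof.
move=> xS; have := proj_add S x; rewrite proj_id// => /(canRL (addKr x)) ->.
exact: addNr.
Qed.

Lemma proj_perp_id S x : x \in perp S -> proj (perp S) x = x.
Proof. exact: proj_id. Qed.

Lemma proj_eq0 S x : x \in perp S -> proj S x = 0.
Proof.
move=> xS; have := proj_add S x; rewrite proj_perp_id// => /(canRL (addrK x)) ->.
exact: subrr.
Qed.

Lemma mem_projE S x : (x \in S) = (proj (perp S) x == 0).
Proof.
apply/idP/eqP => [/proj_perp_eq0//|x0].
by rewrite -[x](proj_add S) x0 addr0 proj_mem.
Qed.

Lemma orthproj_vsval S (u : subvs_of S) : orthproj S (vsval u) = u.
Proof. by apply: val_inj; apply: proj_id; exact: subvsP. Qed.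

Section Ext.
Variables (S : {vspace V}) (f : subvs_of S -> subvs_of (perp S)).

Lemma ext_mem x : ext f x \in perp S.
Proof. exact: subvsP. Qed.

Lemma ext_proj x : ext f (proj S x) = ext f x.
Proof. by rewrite /ext orthproj_vsval. Qed.

Lemma proj_ext x : proj S (ext f x) = 0.
Proof. exact/proj_eq0/ext_mem. Qed.

Lemma proj_perp_ext x : proj (perp S) (ext f x) = ext f x.
Proof. exact/proj_perp_id/ext_mem. Qed.

Lemma graphP x : graph f x <-> proj (perp S) x = ext f x.
Proof.
split=> [[u _ <-]|H].
  rewrite linearD /= [X in X + _]proj_perp_eq0 ?subvsP// add0r.
  rewrite [LHS]proj_perp_id ?subvsP// /ext linearD /= orthproj_vsval.
  rewrite -[orthproj S (vsval (f u))](orthproj_vsval) -/(proj S _) proj_eq0 ?subvsP//.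
  by rewrite linear0 addr0.
exists (orthproj S x) => //.
by rewrite -[LHS]/(proj S x + ext f x) -H proj_add.
Qed.

Lemma graph_ext x : graph f (proj S x + ext f x).
Proof.
apply/graphP; rewrite linearD /= proj_perp_ext proj_perp_eq0 ?proj_mem// add0r.
by rewrite -[RHS]ext_proj linearD /= proj_ext addr0 !ext_proj.
Qed.

Lemma ext_of_class k : of_class k setT f -> of_class k setT (ext f).
Proof.
move=> kf.
have := of_class_affine 0 (@orthproj_continuous S) (@vsval_continuous (perp S)) kf.
by congr of_class; apply/funext => x; rewrite add0r.
Qed.

End Ext.
End Projections.

Section EuclideanNorm.
Context {R : realType} {n : nat}.
Local Notation V := 'rV[R]_n.
Implicit Types (x y u v : V).

Lemma edot_ge0 u : 0 <= edot u u.
Proof. by rewrite /edot sumr_ge0// => i _; rewrite -expr2 sqr_ge0. Qed.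

Lemma edot_lin (c d : R) u v : edot (c *: u + d *: v) (c *: u + d *: v) =
  c ^+ 2 * edot u u + 2 * (c * d) * edot u v + d ^+ 2 * edot v v.
Proof.
rewrite /edot !mulr_sumr -!big_split /=; apply: eq_bigr => i _.
by rewrite !mxE; ring.
Qed.

Lemma edot_CauchySchwarz u v : edot u v ^+ 2 <= edot u u * edot v v.
Proof.
have [v0|v0] := eqVneq (edot v v) 0.
  have ve : v = 0 by apply/eqP; apply: contraTT isT => /edot_gt0; rewrite v0 ltxx.
  suff -> : edot u v = 0 by rewrite v0 expr0n mulr0.
  by rewrite /edot big1// => i _; rewrite ve mxE mulr0.
have vp : 0 < edot v v by rewrite lt_neqAle eq_sym v0 edot_ge0.
(* The square of (v.v) u - (u.v) v equals v.v times the defect of the inequality. *)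
have := edot_ge0 (edot v v *: u + (- edot u v) *: v).
rewrite edot_lin => H.
rewrite -(ler_pM2r vp) -subr_ge0; apply: le_trans H _.
by rewrite le_eqVlt; apply/orP; left; apply/eqP; ring.
Qed.

Lemma enorm_ge0 u : 0 <= enorm u.
Proof. exact: sqrtr_ge0. Qed.

Lemma sqr_enorm u : enorm u ^+ 2 = edot u u.
Proof. by rewrite /enorm sqr_sqrtr// edot_ge0. Qed.

Lemma enorm_triangle u v : enorm (u + v) <= enorm u + enorm v.
Proof.
rewrite -(@ler_pXn2r _ 2)// ?nnegrE ?addr_ge0 ?enorm_ge0//.
rewrite sqrrD !sqr_enorm -[u + v](_ : 1 *: u + 1 *: v = _); last by rewrite !scale1r.
rewrite edot_lin !expr1n !mul1r mulr1 lerD2r lerD2l -[leRHS]mulr_natl ler_pM2l//.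
rewrite (le_trans (ler_norm _))// -(@ler_pXn2r _ 2)// ?nnegrE ?mulr_ge0 ?enorm_ge0//.
by rewrite real_normK ?num_real// exprMn !sqr_enorm edot_CauchySchwarz.
Qed.

Lemma enormN u : enorm (- u) = enorm u.
Proof. by rewrite /enorm /edot; congr Num.sqrt; apply: eq_bigr => i _; rewrite !mxE mulrNN. Qed.

Lemma enormB u v : enorm (u - v) = enorm (v - u).
Proof. by rewrite -enormN opprB. Qed.

Lemma enorm0 : enorm (0 : V) = 0.
Proof. by rewrite /enorm /edot big1 ?sqrtr0// => i _; rewrite mxE mul0r. Qed.

Lemma norm_le_enorm u : `|u| <= enorm u.
Proof.
apply: norm_le_coord => [|i]; first exact: enorm_ge0.
rewrite -sqrtr_sqr /enorm ler_wsqrtr// /edot (bigD1 i)//= expr2 lerDl.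
by rewrite sumr_ge0// => j _; rewrite -expr2 sqr_ge0.
Qed.

(** The constant is crude but positive for every n, so that one can divide by it. *)
Lemma enorm_le_norm u : enorm u <= n.+1%:R * `|u|.
Proof.
rewrite -(@ler_pXn2r _ 2)// ?nnegrE ?mulr_ge0 ?enorm_ge0// sqr_enorm /edot.
rewrite (@le_trans _ _ (\sum_(i < n) `|u| ^+ 2))//.
  apply: ler_sum => i _; rewrite -expr2 -real_normK ?num_real//.
  by rewrite lerXn2r ?nnegrE// coord_le_norm.
rewrite sumr_const card_ord exprMn -[leLHS]mulr_natl ler_wpM2r ?sqr_ge0//.
by rewrite -natrX ler_nat expnS expn1 mulSn leqW// leq_addr.
Qed.

End EuclideanNorm.

Section Distances.
Context {R : realType} {n : nat}.
Local Notation V := 'rV[R]_n.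
Implicit Types (x y a b : V) (A B C : set V).

Lemma edist_le x A b : A b -> (edist x A <= (enorm (x - b))%:E)%E.
Proof. by move=> Ab; apply: ereal_inf_lbound; exists b. Qed.

Lemma edist_lt x A (e : \bar R) : (edist x A < e)%E ->
  exists2 b, A b & ((enorm (x - b))%:E < e)%E.
Proof. by move=> /ereal_inf_lt[_ [b Ab <-] H]; exists b. Qed.

Lemma edist_ge x A (e : \bar R) :
  (forall b, A b -> (e <= (enorm (x - b))%:E)%E) -> (e <= edist x A)%E.
Proof. by move=> H; apply: le_ereal_inf_tmp => _ [b Ab <-]; exact: H. Qed.

Lemma edist_ge0 x A : (0 <= edist x A)%E.
Proof. by apply: edist_ge => b _; rewrite lee_fin enorm_ge0. Qed.

Lemma edist_fin x A b : A b -> edist x A \is a fin_num.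
Proof.
move=> Ab; rewrite ge0_fin_numE ?edist_ge0//.
by rewrite (le_lt_trans (edist_le x Ab))// ltry.
Qed.

Lemma edist_mem x A : A x -> edist x A = 0%E.
Proof.
move=> Ax; apply/eqP; rewrite eq_le edist_ge0 andbT.
by rewrite (le_trans (edist_le x Ax))// subrr enorm0.
Qed.

Lemma edist_triangle x y A : (edist x A <= (enorm (x - y))%:E + edist y A)%E.
Proof.
rewrite -leeBlDl//; apply: edist_ge => b Ab; rewrite leeBlDl// -EFinD.
rewrite (le_trans (edist_le x Ab))// lee_fin.
by rewrite -[x - b](subrKA y) (le_trans (enorm_triangle _ _)).
Qed.

Lemma cvge_epsP (T : Type) (F : set_system T) (FF : Filter F)
    (f : T -> \bar R) (l : R) :
  f @ F --> l%:E <-> forall e : R, 0 < e ->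
    \forall x \near F, ((l - e)%:E <= f x <= (l + e)%:E)%E.
Proof.
split=> [/fine_cvgP[ff fl] e e0|H].
  move/cvgrPdist_le : fl => /(_ e e0) fl; near=> x.
  have fx : f x \is a fin_num by near: x.
  have : `|l - (fine \o f) x| <= e by near: x.
  rewrite /= -(fineK fx) !lee_fin ler_distlC; lra.
apply/fine_cvgP; split.
  apply: filterS (H 1 ltr01) => x /andP[h1 h2]; rewrite fin_numElt.
  by rewrite (lt_le_trans _ h1) ?ltNyr//= (le_lt_trans h2)// ltry.
apply/cvgrPdist_le => e e0; apply: filterS (H e e0) => x /andP[h1 h2].
have fx : f x \is a fin_num.
  rewrite fin_numElt.
  by rewrite (lt_le_trans _ h1) ?ltNyr//= (le_lt_trans h2)// ltry.
by move: h1 h2; rewrite /= -(fineK fx) !lee_fin ler_distlC /= => -> ->.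
Unshelve. all: by end_near. Qed.

Lemma near_right0P (P : R -> Prop) :
  (\forall r \near 0^'+, P r) <-> exists2 d : R, 0 < d & forall r, 0 < r < d -> P r.
Proof.
split=> [|[d d0 H]].
  move=> /nbhs_normP[d /= d0 H]; exists d => // r /andP[r0 rd].
  by apply: H => //=; rewrite sub0r normrN gtr0_norm.
apply/nbhs_normP; exists d => //= r rd r0.
by apply: H; rewrite r0/= -(gtr0_norm r0) -normrN -sub0r.
Qed.

(* The conditions of [approx_by] without distance functions; in this form they
   do not depend on the choice of the norm. *)
Definition close_at k A B a : Prop := forall e : R, 0 < e ->
  exists2 d : R, 0 < d & forall r x, 0 < r < d -> A x -> `|x - a| <= r ->
    exists2 b, B b & `|x - b| <= e * r ^+ k.

Lemma close_at_trans k A B C a : (0 < k)%N ->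
  close_at k A B a -> close_at k B C a -> close_at k A C a.
Proof.
move=> k0 AB BC e e0.
have e20 : 0 < Num.min (e / 2) 1 by rewrite lt_min divr_gt0//= ltr01.
have [d d0 H] := AB _ e20.
(* The intermediate point b lies within 2 r of a, since r^k is at most r for small r; doubling the
   radius costs the factor 2^k. *)
have e30 : 0 < e / 2 / 2 ^+ k by rewrite !divr_gt0// exprn_gt0.
have [d' d'0 H'] := BC _ e30.
exists (Num.min d (Num.min 1 (d' / 2))).
  by rewrite !lt_min d0 ltr01 divr_gt0.
move=> r x /andP[r0]; rewrite !lt_min => /and3P[rd r1 rd'] Ax xr.
have [|b Bb xb] := H r x _ Ax xr; first by rewrite r0.
have rk1 : r ^+ k <= r by rewrite -[leRHS]expr1 ler_wiXn2l// ltW.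
have xb1 : `|x - b| <= r.
  rewrite (le_trans xb)// -[leRHS]mul1r ler_pM ?exprn_ge0 ?(ltW r0) ?(ltW e20)//.
  by rewrite ge_min lexx orbT.
have br : `|b - a| <= r * 2.
  rewrite -[b - a](subrKA x) (le_trans (ler_normD _ _))// mulr_natr mulr2n lerD//.
  by rewrite distrC.
have [|c Cc bc] := H' (r * 2) b _ Bb br.
  by rewrite mulr_gt0//= -ltr_pdivlMr.
exists c => //; rewrite -[x - c](subrKA b) (le_trans (ler_normD _ _))//.
rewrite [e]splitr mulrDl lerD//.
  rewrite (le_trans xb)// ler_wpM2r ?exprn_ge0 ?(ltW r0)//.
  by rewrite ge_min lexx.
by rewrite (le_trans bc)// exprMn (mulrC (r ^+ k)) mulrA divfK// gt_eqF// exprn_gt0.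
Qed.

Lemma close_at_le k k' A B a : (k' <= k)%N -> close_at k A B a -> close_at k' A B a.
Proof.
move=> kk AB e e0; have [d d0 H] := AB e e0; exists (Num.min d 1).
  by rewrite lt_min d0 ltr01.
move=> r x /andP[r0]; rewrite lt_min => /andP[rd r1] Ax xr.
have [|b Bb xb] := H r x _ Ax xr; first by rewrite r0.
exists b => //; rewrite (le_trans xb)// ler_wpM2l ?(ltW e0)//.
by rewrite ler_wiXn2l// ltW.
Qed.

Lemma approx_by_close_at k A a B : approx_by k A a B ->
  [/\ close_at 1 A B a, close_at 1 B A a & close_at k A B a].
Proof.
have N0 : 0 < n.+1%:R :> R by rewrite ltr0n.
(* A Euclidean ball of radius (n + 1) r contains the sup norm ball of radius r. Halving e gives a
   strict inequality for the distance, hence a point that realizes the bound. *)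
have K (j : nat) (G : R -> \bar R) X Y : G @ 0^'+ --> 0%E ->
    (forall r x, 0 < r -> X x -> enorm (x - a) <= r ->
      ((r ^- j)%:E * edist x Y <= G r)%E) -> close_at j X Y a.
  move=> /cvge_epsP H HG e e0.
  have e'0 : 0 < e / 2 / n.+1%:R ^+ j by rewrite !divr_gt0// exprn_gt0.
  have /near_right0P[d d0 Hd] := H _ e'0.
  exists (d / n.+1%:R); first by rewrite divr_gt0.
  move=> r x /andP[r0]; rewrite ltr_pdivlMr// mulrC => rd Xx xr.
  have Nr0 : 0 < n.+1%:R * r by rewrite mulr_gt0.
  have xN : enorm (x - a) <= n.+1%:R * r.
    by rewrite (le_trans (enorm_le_norm _))// ler_wpM2l// ltW.
  have /andP[_] := Hd (n.+1%:R * r) ltac:(by rewrite Nr0).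
  rewrite add0r => /(le_trans (HG _ _ Nr0 Xx xN)).
  rewrite lee_pdivrMl ?exprn_gt0// -EFinM => yr.
  have E : (n.+1%:R * r) ^+ j * (e / 2 / n.+1%:R ^+ j) = e * r ^+ j / 2.
    have : n.+1%:R ^+ j != 0 :> R by rewrite gt_eqF// exprn_gt0.
    by rewrite exprMn; move: (n.+1%:R ^+ j) => M M0; field.
  have [|b Yb xb] := @edist_lt x Y (e * r ^+ j)%:E.
    rewrite (le_lt_trans yr)// lte_fin E ltr_pdivrMr// ltr_pMr ?ltr1n//.
    by rewrite mulr_gt0// exprn_gt0.
  by exists b => //; rewrite (le_trans (norm_le_enorm _))// ltW.
move=> [H1 H2]; split.
- apply: K H1 _ => r x r0 Ax xr; rewrite expr1.
  rewrite lee_pmul2l ?lte_fin ?invr_gt0//.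
  apply: (@le_trans _ _ `|edist x A - edist x B|%E).
    by rewrite (edist_mem Ax) sub0e abseN gee0_abs// edist_ge0.
  by apply: ereal_sup_ubound; exists x.
- apply: K H1 _ => r x r0 Bx xr; rewrite expr1.
  rewrite lee_pmul2l ?lte_fin ?invr_gt0//.
  apply: (@le_trans _ _ `|edist x A - edist x B|%E).
    by rewrite (edist_mem Bx) sube0 gee0_abs// edist_ge0.
  by apply: ereal_sup_ubound; exists x.
- apply: K H2 _ => r x r0 Ax xr.
  rewrite lee_pmul2l ?lte_fin ?invr_gt0 ?exprn_gt0//.
  by apply: ereal_sup_ubound; exists x.
Qed.

Lemma close_at_edist k A B a : close_at k A B a -> forall e : R, 0 < e ->
  exists2 d : R, 0 < d & forall r x, 0 < r < d -> A x -> enorm (x - a) <= r ->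
    (edist x B <= (e * r ^+ k)%:E)%E.
Proof.
move=> AB e e0; have N0 : 0 < n.+1%:R :> R by rewrite ltr0n.
have [d d0 H] := AB (e / n.+1%:R) (divr_gt0 e0 N0).
exists d => // r x rd Ax xr.
have [b Bb xb] := H r x rd Ax (le_trans (norm_le_enorm _) xr).
rewrite (le_trans (edist_le x Bb))// lee_fin (le_trans (enorm_le_norm _))//.
by rewrite mulrC -ler_pdivlMr// mulrAC.
Qed.

(* A point nearly realizing the distance from [x] lies within a multiple of
   the radius from [a], so closeness at [a] applies to it. *)
Lemma close_at_edist_diff A B a : B a -> close_at 1 A B a -> close_at 1 B A a ->
  forall e : R, 0 < e -> exists2 d : R, 0 < d & forall r x, 0 < r < d ->
    enorm (x - a) <= r -> (edist x B <= edist x A + (e * r)%:E)%E /\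
      (edist x A <= edist x B + (e * r)%:E)%E.
Proof.
move=> Ba AB BA e e0.
have e20 : 0 < e / 8 by rewrite divr_gt0.
have [dA dA0 HA] := close_at_edist AB e20.
have [dB dB0 HB] := close_at_edist BA e20.
have [d1 d10 H1] := close_at_edist BA ltr01.
exists (Num.min (dA / 4) (Num.min (dB / 4) (Num.min d1 1))).
  by rewrite !lt_min !divr_gt0//= d10 ltr01.
move=> r x /andP[r0]; rewrite !lt_min !ltr_pdivlMr// => /and4P[rA rB r1 _] xr.
pose e1 := Num.min (e / 2) 1.
have e10 : 0 < e1 by rewrite lt_min ltr01 divr_gt0.
(* As the distance from x to X is at most 2 r, a nearly nearest point y lies within 3 r of x and
   within 4 r of a. The tolerance e / 8 at radius 4 r contributes e r / 2, the choice of y the other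
   half. *)
have K X Y (d : R) : (forall r x, 0 < r < d -> X x -> enorm (x - a) <= r ->
    (edist x Y <= (e / 8 * r ^+ 1)%:E)%E) -> r * 4 < d ->
    (exists x0, X x0) ->
    (edist x X <= (2 * r)%:E)%E ->
    (edist x Y <= edist x X + (e * r)%:E)%E.
  move=> H rd [x0 Xx0] xX.
  have fX := edist_fin x Xx0.
  have [|y Xy xy] := @edist_lt x X (edist x X + (e1 * r)%:E)%E.
    by rewrite lteDl// lte_fin mulr_gt0.
  have xy3 : enorm (x - y) <= 3 * r.
    rewrite -lee_fin (le_trans (ltW xy))//.
    rewrite (_ : 3 * r = 2 * r + 1 * r); last by ring.
    rewrite EFinD leeD// lee_fin ler_wpM2r ?(ltW r0)//.
    by rewrite ge_min lexx orbT.
  have ya : enorm (y - a) <= r * 4.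
    rewrite -[y - a](subrKA x) (le_trans (enorm_triangle _ _))//.
    rewrite enormB (le_trans (lerD xy3 xr))//; lra.
  have yY := H (r * 4) y ltac:(by rewrite mulr_gt0) Xy ya.
  rewrite (le_trans (edist_triangle x y Y))// (le_trans (leeD (ltW xy) yY))//.
  rewrite -addeA leeD2l// -EFinD lee_fin.
  have : e1 * r <= e / 2 * r by rewrite ler_wpM2r ?(ltW r0)// ge_min lexx.
  by rewrite expr1; lra.
have aA : (edist a A <= (1 * r ^+ 1)%:E)%E.
  by apply: H1 Ba _; rewrite ?r0// subrr enorm0 ltW.
split.
- apply: (K A B dA) => //.
    have [|y Ay _] := @edist_lt a A +oo%E; last by exists y.
    by rewrite (le_lt_trans aA)// ltry.
  have xr' : ((enorm (x - a))%:E <= r%:E)%E by rewrite lee_fin.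
  rewrite (le_trans (edist_triangle x a A))// (le_trans (leeD xr' aA))//.
  by rewrite -EFinD lee_fin expr1; lra.
- apply: (K B A dB) => //; first by exists a.
  by rewrite (le_trans (edist_le x Ba))// lee_fin; lra.
Qed.

Lemma close_at_approx_by k A a B : B a ->
  close_at 1 A B a -> close_at 1 B A a -> close_at k A B a -> approx_by k A a B.
Proof.
move=> Ba AB BA kAB; split; apply/cvge_epsP => e e0; apply/near_right0P.
- have [d d0 H] := close_at_edist_diff Ba AB BA e0.
  have [d' d'0 H'] := close_at_edist BA ltr01.
  exists (Num.min d d'); first by rewrite lt_min d0.
  move=> r /andP[r0]; rewrite lt_min => /andP[rd rd'].
  have aA : (edist a A <= (1 * r ^+ 1)%:E)%E.
    by apply: H' Ba _; rewrite ?r0// subrr enorm0 ltW.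
  have [y Ay _] : exists2 y, A y & ((enorm (a - y))%:E < +oo)%E.
    by apply: edist_lt; rewrite (le_lt_trans aA)// ltry.
  rewrite sub0r add0r; apply/andP; split.
    rewrite (@le_trans _ _ 0%E) ?lee_fin ?oppr_le0 ?(ltW e0)//.
    rewrite mule_ge0 ?lee_fin ?invr_ge0 ?(ltW r0)//.
    apply: (@le_trans _ _ `|edist a A - edist a B|%E); first exact: abse_ge0.
    apply: ereal_sup_ubound; exists a => //.
    by rewrite /ecball /= subrr enorm0 ltW.
  rewrite lee_pdivrMl// -EFinM; apply: ge_ereal_sup => _ [x xr <-].
  have [|H1 H2] := H r x _ xr; first by rewrite r0.
  have fA := edist_fin x Ay; have fB := edist_fin x Ba.
  move: H1 H2; rewrite -(fineK fA) -(fineK fB) -!EFinD !lee_fin.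
  by rewrite ler_norml; lra.
- have [d d0 H] := close_at_edist kAB e0.
  (* The tolerance 1/2 produces a point of A within r of a, so the supremum is over a nonempty set
     and is not -oo. *)
  have [d' d'0 H'] := close_at_edist BA (e := 2^-1) ltac:(by rewrite invr_gt0).
  exists (Num.min d d'); first by rewrite lt_min d0.
  move=> r /andP[r0]; rewrite lt_min => /andP[rd rd'].
  have aA : (edist a A <= (2^-1 * r ^+ 1)%:E)%E.
    by apply: H' Ba _; rewrite ?r0// subrr enorm0 ltW.
  have [y Ay ya] : exists2 y, A y & ((enorm (a - y))%:E < r%:E)%E.
    by apply: edist_lt; rewrite (le_lt_trans aA)// lte_fin expr1; lra.
  rewrite sub0r add0r; apply/andP; split.
    rewrite (@le_trans _ _ 0%E) ?lee_fin ?oppr_le0 ?(ltW e0)//.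
    rewrite mule_ge0 ?lee_fin ?invr_ge0 ?exprn_ge0 ?(ltW r0)//.
    apply: (@le_trans _ _ (edist y B)); first exact: edist_ge0.
    apply: ereal_sup_ubound; exists y => //; split => //.
    by rewrite /ecball /= enormB ltW.
  rewrite lee_pdivrMl ?exprn_gt0// -EFinM; apply: ge_ereal_sup => _ [x [Ax xr] <-].
  by rewrite mulrC; apply: H => //; rewrite r0.
Qed.

End Distances.

(** * Charts of submanifolds *)

Section Charts.
Context {R : realType} {n : nat}.
Local Notation V := 'rV[R]_n.
Implicit Types (x y a b w : V) (A B : set V) (Z T : {vspace V}).

(* [w |-> a + G w], for [w] in [Z], is a local parametrization of [B] with
   differential [L] at 0. *)
Definition chart k B a Z (G : V -> V) (L : {linear V -> V}) (d C : R) : Prop :=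
  [/\ taylor k G /\ smallon setT 1 (fun w => G w - L w),
      forall w, w \in Z -> `|w| < d -> B (a + G w),
      forall b, B b -> `|b - a| < d -> exists2 w, w \in Z &
        b = a + G w /\ `|w| <= C * `|b - a| &
      forall w, `|w| <= C * `|L w|].

Lemma differentiable_lip (f : V -> V) x : differentiable f x ->
  exists C : R, 0 < C /\ exists2 d : R, 0 < d & forall h, `|h| < d ->
    `|f (x + h) - f x| <= C * `|h|.
Proof.
move=> /differentiable_eps/(_ 1 ltr01)[d d0 H].
have [C C0 HC] := linear_bound ('d f x).
exists (1 + C); split; first by rewrite addr_gt0.
exists d => // h hd; rewrite -(subrK ('d f x h) (f (x + h) - f x)) mulrDl.
by rewrite (le_trans (ler_normD _ _))// lerD// H.
Qed.

Lemma open_ball (U : set V) x : open U -> U x ->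
  exists2 d : R, 0 < d & forall h, `|h| < d -> U (x + h).
Proof.
move=> oU Ux; have /nbhs_normP[d /= d0 H] := open_nbhs_nbhs (conj oU Ux).
exists d => // h hd; apply: H => /=.
by rewrite opprD addrA subrr sub0r normrN.
Qed.

(** The inverse [tau] of the straightening map, recentred at [z0], is the parametrization; as [z0]
    lies in [Z], so does [z0 + w] exactly when w does. The straightening map is Lipschitz at a and
    inverts [tau], which bounds w by its image; passing to first order bounds it by the
    differential. *)
Lemma submanifold_chart k B a : (0 < k)%N -> submanifold k B -> B a ->
  exists Z G L (d C : R), [/\ 0 < d, 0 < C & chart k B a Z G L d C].
Proof.
move=> k0 [m _ /(_ a)] H Ba; have [U [sg [tau [Z [Ua sgU tauU st [_ sB]]]]]] := H Ba.
pose z0 := sg a.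
have tz0 : tau z0 = a by exact: st.
have sUz0 : (sg @` U) z0 by exists a.
have z0Z : z0 \in Z.
  have : (sg @` (B `&` U)) z0 by exists a.
  by rewrite sB => -[].
have dtau : differentiable tau z0 by exact: (tauU.2 [::] isT).2.
have dsg : differentiable sg a by exact: (sgU.2 [::] isT).2.
have [d1 d10 H1] := open_ball tauU.1 sUz0.
have [d2 d20 H2] := open_ball sgU.1 Ua.
have [C [C0 [d3 d30 H3]]] := differentiable_lip dsg.
have [C' [C'0 [d4 d40 H4]]] := differentiable_lip dtau.
pose G w := tau (z0 + w) - a.
have GE w : a + G w = tau (z0 + w) by rewrite addrC subrK.
have GL : smallon setT 1 (fun w => G w - 'd tau z0 w).
  move=> e e0; have [d d0 Hd] := differentiable_eps dtau e0.
  by exists d => // w _ wd; rewrite /G -{1}tz0 expr1; exact: Hd.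
have small_inj w : `|w| < d1 -> `|w| < d4 -> `|w| < d3 / C' -> `|w| <= C * `|G w|.
  move=> w1 w4 w3; have Gw : `|G w| <= C' * `|w| by rewrite /G -{1}tz0; exact: H4.
  have [x Ux sx] := H1 w w1.
  have xE : x = a + G w by rewrite GE -sx st.
  have := H3 (G w); rewrite -xE sx -/z0 (addrC z0) addrK; apply.
  by rewrite (le_lt_trans Gw)// mulrC -ltr_pdivlMr.
have Linj w : `|w| <= 2 * C * `|'d tau z0 w|.
  have [->|w0] := eqVneq w 0; first by rewrite normr0 mulr_ge0// mulr_ge0// ltW.
  (* By homogeneity w may be shrunk until both estimates for [G] apply; with this tolerance the
     linearization error is half of the left-hand side and is absorbed, which doubles the
     constant. *)
  have e0 : 0 < (2 * C)^-1 by rewrite invr_gt0 mulr_gt0.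
  have [d5 d50 H5] := GL _ e0.
  pose m0 := Num.min d1 (Num.min d4 (Num.min (d3 / C') d5)).
  have m0p : 0 < m0 by rewrite !lt_min d10 d40 d50 divr_gt0.
  have wp : 0 < `|w| by rewrite normr_gt0.
  pose s := m0 / 2 / `|w|.
  have s0 : 0 < s by rewrite !divr_gt0.
  have sw : `|s *: w| < m0.
    rewrite normrZ gtr0_norm// divfK ?gt_eqF// ltr_pdivrMr// ltr_pMr//.
    by rewrite ltr1n.
  move: (sw); rewrite !lt_min => /and4P[sw1 sw4 sw3 sw5].
  have := small_inj _ sw1 sw4 sw3; have := H5 _ I sw5; rewrite expr1 => h5 hi.
  have hG : `|G (s *: w)| <= `|'d tau z0 (s *: w)| + (2 * C)^-1 * `|s *: w|.
    rewrite -{1}(subrK ('d tau z0 (s *: w)) (G _)) addrC.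
    by rewrite (le_trans (ler_normD _ _))// lerD2l.
  have : `|s *: w| <= 2 * C * `|'d tau z0 (s *: w)|.
    have := le_trans hi (ler_wpM2l (ltW C0) hG).
    rewrite mulrDr mulrA (_ : C * (2 * C)^-1 = 2^-1); first by lra.
    by field; rewrite gt_eqF.
  by rewrite linearZ /= !(normrZ s) (gtr0_norm s0) mulrCA ler_pM2l.
exists Z, G, ('d tau z0), (Num.min d1 (Num.min d2 d3)), (2 * C).
split; [by rewrite !lt_min d10 d20|by rewrite mulr_gt0|split => //].
- split => //; have [hQ sQ] := taylor_of_class tauU sUz0.
  apply: taylorD (taylor_poly _ (@poly_hpoly _ _ 0 _ _)); last by exists (- a).
  eexists; last exact: sQ.
  by apply: poly_sum => j; apply: poly_hpoly (hQ j _); rewrite -ltnS.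
- move=> w wZ; rewrite !lt_min => /and3P[w1 _ _]; rewrite GE.
  have : (sg @` (B `&` U)) (z0 + w).
    rewrite sB; split; last exact: H1.
    by rewrite /= rpredD.
  by move=> [b [Bb Ub] <-]; rewrite st.
- move=> b Bb; rewrite !lt_min => /and3P[_ b2 b3].
  have Ub : U b by rewrite -(subrK a b) addrC; exact: H2.
  have sbZ : sg b \in Z.
    have : (sg @` (B `&` U)) (sg b) by exists b.
    by rewrite sB => -[].
  exists (sg b - z0); first by rewrite rpredB.
  rewrite GE [z0 + _]addrC subrK st//; split => //.
  have := H3 _ b3; rewrite [a + _]addrC subrK => /le_trans; apply.
  rewrite ler_wpM2r//; have := ltW C0; lra.
Qed.

Definition affine_space T a : set V := [set x | x - a \in T].

(** Parameter and point have comparable size in both directions, by the third condition of [chart]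
    for points of B and by the last one for tangent vectors, so an error o(|w|) is o(r). *)
Lemma chart_tangent k B a Z G L d C : 0 < d -> 0 < C -> chart k B a Z G L d C ->
  close_at 1 B (affine_space (linfun L @: Z)%VS a) a /\
  close_at 1 (affine_space (linfun L @: Z)%VS a) B a.
Proof.
move=> d0 C0 [[_ GL] ZB BZ LC]; split=> e e0.
- have [d' d'0 H] := GL _ (divr_gt0 e0 C0).
  exists (Num.min d (d' / C)); first by rewrite lt_min d0 divr_gt0.
  move=> r b /andP[r0]; rewrite lt_min => /andP[rd rd'] Bb br.
  have [w wZ [bE wb]] := BZ b Bb (le_lt_trans br rd).
  have wr : `|w| <= C * r by rewrite (le_trans wb)// ler_wpM2l// ltW.
  exists (a + L w).
    by rewrite /affine_space /= addrC addKr -[L w]lfunE memv_img.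
  rewrite bE opprD addrACA subrr add0r (le_trans (H _ I _))//.
    by rewrite (le_lt_trans wr)// mulrC -ltr_pdivlMr.
  by rewrite !expr1 mulrAC ler_pdivrMr// -mulrA ler_wpM2l ?(ltW e0)// mulrC.
- have [d' d'0 H] := GL _ (divr_gt0 e0 C0).
  exists (Num.min (d / C) (d' / C)); first by rewrite lt_min !divr_gt0.
  move=> r x /andP[r0]; rewrite lt_min !ltr_pdivlMr// => /andP[rd rd'].
  rewrite /affine_space /= => /memv_imgP[w wZ]; rewrite lfunE /= => xE xr.
  have wr : `|w| <= r * C by rewrite (le_trans (LC w))// mulrC -xE ler_wpM2r// ltW.
  exists (a + G w); first by apply: ZB => //; exact: le_lt_trans wr rd.
  rewrite opprD addrA xE distrC (le_trans (H _ I (le_lt_trans wr rd')))//.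
  by rewrite !expr1 mulrAC ler_pdivrMr// -mulrA ler_wpM2l ?(ltW e0).
Qed.

Lemma close_at_Tan A a T : close_at 1 A (affine_space T a) a ->
  close_at 1 (affine_space T a) A a -> Tan A a = [set` T].
Proof.
move=> AT TA; have N0 : 0 < n.+1%:R :> R by rewrite ltr0n.
apply/seteqP; split=> v /=.
- move=> Hv; rewrite mem_projE.
  have [C C0 HC] := linear_bound (proj (perp T) : {linear V -> V}).
  apply/eqP/normr0_eq0/le_anti; rewrite normr_ge0 andbT.
  apply/ler_addgt0Pr => e e0; rewrite add0r.
  pose M := `|v| + 1; have M0 : 0 < M by rewrite ltr_wpDl.
  have e10 : 0 < e / 2 / C / M by rewrite !divr_gt0.
  have [d d0 H] := AT _ e10.
  have m0 : 0 < Num.min d (Num.min 1 (e / 2 / C)).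
    by rewrite !lt_min d0 ltr01 !divr_gt0.
  have [x [r [Ax r0 xm xv]]] := Hv _ m0.
  have {}xm := le_lt_trans (norm_le_enorm _) xm.
  have {}xv := le_lt_trans (norm_le_enorm _) xv.
  move: xm xv; rewrite !lt_min => /and3P[xd _ _] /and3P[_ xv1 xve].
  (* At x = a there is no positive radius to use, but then v itself is within the tolerance of 0. *)
  have [x0|x0] := eqVneq (x - a) 0.
    move: xve; rewrite x0 scaler0 sub0r normrN => vC.
    rewrite (le_trans (HC v))// -ler_pdivlMl//; apply: ltW (lt_le_trans vC _).
    by rewrite [leRHS]mulrC ler_pM2r ?invr_gt0//; lra.
  have [|y Ty xy] := H _ x _ Ax (lexx _); first by rewrite normr_gt0 x0.
  have -> : proj (perp T) v = proj (perp T) (v - r *: (x - a)) +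
      r *: proj (perp T) (x - y).
    rewrite -linearZ -linearD /=.
    rewrite (_ : v - _ + _ = v - r *: (y - a)).
      by rewrite linearB /= linearZ /= (proj_perp_eq0 Ty) scaler0 subr0.
    rewrite -addrA -scalerN -scalerDr -[in RHS]scalerN; congr (_ + _ *: _).
    by rewrite !opprB addrA subrK.
  rewrite (le_trans (ler_normD _ _))// [e]splitr lerD//.
    rewrite (le_trans (HC _))// -ler_pdivlMl// mulrC distrC; exact: ltW.
  rewrite normrZ gtr0_norm//.
  (* The factor r is not bounded, but r (x - a) is, being close to v; this is what multiplies the
     relative error of the tangent space. *)
  have rx : r * `|x - a| <= M.
    rewrite -[r]gtr0_norm// -normrZ -(subrK v (r *: _)) (le_trans (ler_normD _ _))//.
    by rewrite addrC lerD2l ltW.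
  rewrite (le_trans (ler_wpM2l (ltW r0) (HC _)))//.
  rewrite (le_trans (ler_wpM2l (ltW r0) (ler_wpM2l (ltW C0) xy)))// expr1.
  have -> : r * (C * (e / 2 / C / M * `|x - a|)) = e / 2 / M * (r * `|x - a|).
    by field; rewrite !gt_eqF.
  by rewrite mulrAC ler_pdivrMr// ler_wpM2l// divr_ge0// ltW.
- move=> vT e e0; pose M := `|v| + 1; have M0 : 0 < M by rewrite ltr_wpDl.
  have e10 : 0 < Num.min (e / 2 / M / n.+1%:R) 1.
    by rewrite lt_min ltr01 !divr_gt0.
  have [d d0 H] := TA _ e10.
  pose s := Num.min d (Num.min 1 (e / 2 / n.+1%:R)) / 2 / M.
  have m0 : 0 < Num.min d (Num.min 1 (e / 2 / n.+1%:R)).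
    by rewrite !lt_min d0 ltr01 !divr_gt0.
  have s0 : 0 < s by rewrite !divr_gt0.
  have sM : s * M < Num.min d (Num.min 1 (e / 2 / n.+1%:R)).
    by rewrite divfK ?gt_eqF// ltr_pdivrMr// ltr_pMr// ltr1n.
  move: (sM); rewrite !lt_min => /and3P[sd _ se].
  have sv : `|s *: v| <= s * M by rewrite normrZ gtr0_norm// ler_wpM2l ?(ltW s0)// lerDl.
  have vT' : affine_space T a (a + s *: v).
    by rewrite /affine_space /= addrC addKr rpredZ.
  have [||x Ax] := H (s * M) (a + s *: v) _ vT'.
  + by rewrite mulr_gt0.
  + by rewrite addrC addKr.
  rewrite expr1 distrC opprD addrA => vx.
  have sM0 : 0 <= s * M by rewrite ltW// mulr_gt0.
  have vx1 : `|x - a - s *: v| <= s * M.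
    rewrite (le_trans vx)// -[leRHS]mul1r ler_wpM2r ?sM0//.
    by rewrite ge_min lexx orbT.
  have vx2 : `|x - a - s *: v| <= e / 2 / n.+1%:R * s.
    have -> : e / 2 / n.+1%:R * s = e / 2 / M / n.+1%:R * (s * M).
      have G (N M' s' : R) : N != 0 -> M' != 0 ->
          e / 2 / N * s' = e / 2 / M' / N * (s' * M').
        by move=> N1 M1; field; rewrite M1 N1.
      by apply: G; rewrite gt_eqF.
    rewrite (le_trans vx)// ler_wpM2r ?sM0//.
    by rewrite ge_min lexx.
  exists x, s^-1; split => //; first by rewrite invr_gt0.
    rewrite (le_lt_trans (enorm_le_norm _))// mulrC -ltr_pdivlMr//.
    rewrite -(subrK (s *: v) (x - a)) (le_lt_trans (ler_normD _ _))//.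
    rewrite (le_lt_trans (lerD vx1 sv))//.
    have half t u : t < u / 2 -> t + t < u :> R by lra.
    by apply: half; rewrite [ltRHS]mulrAC.
  rewrite (le_lt_trans (enorm_le_norm _))// mulrC -ltr_pdivlMr//.
  have -> : s^-1 *: (x - a) - v = s^-1 *: (x - a - s *: v).
    by rewrite [RHS]scalerBr scalerK// gt_eqF.
  rewrite normrZ gtr0_norm ?invr_gt0// ltr_pdivrMl// (le_lt_trans vx2)//.
  rewrite mulrC ltr_pM2l// [ltLHS]mulrAC ltr_pdivrMr// ltr_pMr ?divr_gt0//.
  by rewrite ltr1n.
Qed.

End Charts.

(** * Anisotropic blow-ups *)

Section Roots.
Context {R : realType}.

Lemma exists_root (y : R) i : (0 < i)%N -> 0 <= y -> exists2 t : R, 0 <= t & t ^+ i = y.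
Proof.
move=> i0 y0; exists (y `^ i%:R^-1); first exact: powR_ge0.
by rewrite -powR_mulrn ?powR_ge0// -powRrM mulVf ?powRr1// pnatr_eq0 -lt0n.
Qed.

End Roots.

Section Blowup.
Context {R : realType} {n : nat}.
Local Notation V := 'rV[R]_n.
Variables (S : {vspace V}) (D : set V) (i : nat) (F p : V -> V).
Hypothesis i0 : (0 < i)%N.
Hypothesis FS : forall x, F (proj S x) = F x.
Hypothesis FW : forall x, F x \in perp S.
Variable CF : R.
Hypothesis CF0 : 0 < CF.
Hypothesis FB : forall x, `|x| <= 1 -> `|F x| <= CF * `|x|.
Hypothesis hp : hpoly i p.
Hypothesis pS : forall x, p (proj S x) = p x.
Hypothesis pW : forall x, p x \in perp S.

Let W := perp S.
(** In the application [D] consists of the x - a with x in A, [F] is the sum of the polynomials of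
    degree below i, and [p] is the one of degree i. *)
Let X s : set V := beta S i s @` [set h - F h | h in D].
Let G : set V := [set x | proj W x = p x].

Let betaE s h : beta S i s (h - F h) =
  s^-1 *: proj S h + s ^- i *: (proj W h - F h).
Proof.
rewrite /beta; congr (_ *: _ + _ *: _).
  by rewrite -/(proj S (h - F h)) linearB /= (proj_eq0 (FW h)) subr0.
by rewrite -/(proj (perp S) (h - F h)) linearB /= (proj_perp_id (FW h)).
Qed.

Let proj_bound : exists2 C : R, 0 < C & forall x,
  `|proj S x| <= C * `|x| /\ `|proj W x| <= C * `|x|.
Proof.
have [C C0 H] := linear_bound (proj S : {linear V -> V}).
have [C' C'0 H'] := linear_bound (proj W : {linear V -> V}).
exists (C + C'); first by rewrite addr_gt0.
by move=> x; split; [apply: le_trans (H x) _|apply: le_trans (H' x) _];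
  rewrite ler_wpM2r// ?lerDl ?lerDr ltW.
Qed.

Let projSW x : x \in W -> proj S x = 0. Proof. exact: proj_eq0. Qed.
Let projWS x : proj W (proj S x) = 0. Proof. exact/proj_perp_eq0/proj_mem. Qed.
Let projSS x : proj S (proj S x) = proj S x. Proof. exact/proj_id/proj_mem. Qed.

Let betaS s h : proj S (beta S i s (h - F h)) = s^-1 *: proj S h.
Proof.
have E : proj S (proj W h - F h) = 0 by apply: projSW; rewrite rpredB// proj_mem.
by rewrite betaE linearD !linearZ /= projSS E scaler0 addr0.
Qed.

Let betaW s h : proj W (beta S i s (h - F h)) = s ^- i *: (proj W h - F h).
Proof.
rewrite betaE linearD !linearZ /= projWS scaler0 add0r.
by congr (_ *: _); apply: proj_perp_id; rewrite rpredB// proj_mem.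
Qed.

(** This explains the exponent in [beta]: on [p] the horizontal scaling acts as the vertical one
    does on the complement, so the defect of the image is s^-i times the defect of h. *)
Let betap s h : p (beta S i s (h - F h)) = s ^- i *: p h.
Proof.
by rewrite -[LHS]pS betaS (hpoly_homog _ _ hp) pS exprVn.
Qed.

Let graph_mem x : G (proj S x + p x).
Proof.
rewrite /G /= linearD /= projWS add0r proj_perp_id//.
by rewrite -[RHS]pS linearD /= (projSW (pW x)) addr0 projSS pS.
Qed.

Let dist_graph x : x - (proj S x + p x) = proj W x - p x.
Proof. by rewrite -{1}(proj_add S x) opprD addrACA subrr add0r. Qed.

Let G0 : G 0.
Proof.
have := graph_mem 0; rewrite linear0 add0r; congr G.
case: i i0 hp => // j _ hpj; exact: hpolyS_at0 hpj.
Qed.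

Lemma small_blowup :
  (forall x, x \in S -> exists2 v, ray D v & proj S v = x) ->
  smallon D i (fun h => proj W h - F h - p h) ->
  forall x, edist x (X s) @[s --> 0^'+] --> edist x G.
Proof.
move=> rD sm x; have N0 : 0 < n.+1%:R :> R by rewrite ltr0n.
have [C C0 HC] := proj_bound.
have fG := edist_fin x G0; rewrite -(fineK fG).
set d0 := fine _; have d00 : 0 <= d0 by rewrite fine_ge0// edist_ge0.
apply/cvge_epsP => e e0; apply/near_right0P.
(* Upper bound: an almost nearest point q of the graph is approximated by images of points of [D]
   that follow a ray over the S-component of q. *)
have [du du0 Hu] : exists2 d : R, 0 < d & forall s, 0 < s < d ->
    (edist x (X s) <= (d0 + e)%:E)%E.
  have [|q Gq xq] := @edist_lt _ _ x G (d0 + e / 2)%:E.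
    by rewrite -(fineK fG) lte_fin ltrDl divr_gt0.
  have [v rv vq] := rD (proj S q) (proj_mem S q).
  have e'0 : 0 < e / 2 / n.+1%:R by rewrite !divr_gt0.
  (* Half of e is spent on the choice of q. The other half is shared by the horizontal error, the
     defect of h and the continuity of p at v, after conversion to the sup norm. *)
  pose f := e / 2 / n.+1%:R / 3; have f0 : 0 < f by rewrite divr_gt0.
  have cp : {for v, continuous p}.
    exact/differentiable_continuous/((hpoly_is_diff hp).1 v).
  have [dp dp0 Hp] := continuous_at_epsP cp f0.
  pose M := `|v| + 1; have M0 : 0 < M by rewrite ltr_wpDl.
  have Mi0 : 0 < M ^+ i by rewrite exprn_gt0.
  have [ds ds0 Hs] := sm _ (divr_gt0 f0 Mi0).
  have g0 : 0 < Num.min (f / C) (Num.min (dp / 2) 1).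
    by rewrite !lt_min !divr_gt0// ltr01.
  have [dr dr0 Hr] := rv _ g0.
  exists (Num.min dr (ds / M)); first by rewrite lt_min dr0 divr_gt0.
  move=> s /andP[s0]; rewrite lt_min ltr_pdivlMr// => /andP[sr ss].
  have [|h Dh hs] := Hr s; first by rewrite s0.
  have sn0 : s != 0 by rewrite gt_eqF.
  have w1 : `|s^-1 *: h - v| <= Num.min (f / C) (Num.min (dp / 2) 1).
    rewrite -{1}(scalerK sn0 v) -scalerBr normrZ gtr0_norm ?invr_gt0//.
    by rewrite ler_pdivrMl// mulrC.
  move: (w1); rewrite !le_min => /and3P[wC wp w11].
  have w2 : `|s^-1 *: h| <= M.
    rewrite -(subrK v (s^-1 *: h)) addrC (le_trans (ler_normD _ _))// lerD2l.
    exact: w11.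
  have hM : `|h| <= s * M.
    by rewrite -[h](scalerKV sn0) normrZ gtr0_norm// ler_wpM2l// ltW.
  have Xy : X s (beta S i s (h - F h)) by exists (h - F h) => //; exists h.
  rewrite (le_trans (edist_le x Xy))// lee_fin.
  rewrite -[x - _](subrKA q) (le_trans (enorm_triangle _ _))//.
  rewrite lte_fin in xq; rewrite [e in leRHS]splitr addrA lerD ?(ltW xq)//.
  rewrite (le_trans (enorm_le_norm _))// mulrC -ler_pdivlMr// -/f.
  have -> : q - beta S i s (h - F h) =
      - (proj S (s^-1 *: h - v) + (s ^- i *: (proj W h - F h - p h)
        + (p (v + (s^-1 *: h - v)) - p v))).
    rewrite betaE [v + _]addrC subrK (hpoly_homog _ _ hp) exprVn.
    have -> : p v = p q by rewrite -[LHS]pS vq pS.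
    have -> : proj S (s^-1 *: h - v) = s^-1 *: proj S h - proj S q.
      by rewrite linearB linearZ /= vq.
    rewrite -Gq -{1}(proj_add S q) -/W.
    move: (proj S q) (proj W q) (proj S h) (proj W h) (F h) (p h) => a b c d f' g.
    by apply/rowP => l; rewrite !mxE; ring.
  have third t : t = t / 3 + (t / 3 + t / 3) :> R by lra.
  rewrite normrN (third (e / 2 / n.+1%:R)) -/f.
  rewrite (le_trans (ler_normD _ _))// lerD//.
    by rewrite (le_trans (HC _).1)// mulrC -ler_pdivlMr.
  rewrite (le_trans (ler_normD _ _))// lerD//; last first.
    by rewrite Hp// (le_lt_trans wp)// ltr_pdivrMr// ltr_pMr// ltr1n.
  rewrite normrZ gtr0_norm ?invr_gt0 ?exprn_gt0// ler_pdivrMl ?exprn_gt0//.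
  rewrite (le_trans (Hs _ Dh _))//; first exact: le_lt_trans hM ss.
  rewrite (@le_trans _ _ (f / M ^+ i * (s * M) ^+ i))//.
    rewrite ler_wpM2l ?(ltW (divr_gt0 f0 Mi0))//.
    by rewrite lerXn2r ?nnegrE// mulr_ge0// ltW.
  by rewrite exprMn mulrCA divfK ?gt_eqF.
(* Lower bound: only image points y closer to x than d0 matter. They are bounded, so h is O(s), and
   the defect estimate puts y within e of the graph point over it. *)
have [dl dl0 Hl] : exists2 d : R, 0 < d & forall s, 0 < s < d ->
    ((d0 - e)%:E <= edist x (X s))%E.
  pose M := `|x| + d0 + 1; have M0 : 0 < M by rewrite ltr_wpDl// addr_ge0.
  (* The three summands bound the S-component of h, [F h] and the vertical remainder, each divided
     by s. *)
  pose K := C * M + CF * (C * M) + C * M.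
  have CM0 : 0 < C * M by rewrite mulr_gt0.
  have K0 : 0 < K by rewrite !addr_gt0// mulr_gt0.
  have Ki0 : 0 < K ^+ i by rewrite exprn_gt0.
  have f0 : 0 < e / n.+1%:R / K ^+ i by rewrite !divr_gt0.
  have [ds ds0 Hs] := sm _ f0.
  exists (Num.min 1 (Num.min (C * M)^-1 (ds / K))).
    by rewrite !lt_min ltr01 invr_gt0 CM0 divr_gt0.
  move=> s /andP[s0]; rewrite !lt_min => /and3P[s1 sC].
  rewrite ltr_pdivlMr// => sK.
  apply: edist_ge => _ [_ [h Dh <-] <-]; rewrite lee_fin.
  have [xy|xy] := leP d0 (enorm (x - beta S i s (h - F h))).
    by rewrite (le_trans _ xy)// gerBl ltW.
  have sn0 : s != 0 by rewrite gt_eqF.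
  set y := beta S i s (h - F h) in xy *.
  have yM : `|y| <= M.
    have xyn : `|x - y| <= d0 by rewrite (le_trans (norm_le_enorm _))// ltW.
    rewrite (_ : y = x - (x - y)); last by rewrite opprB addrC subrK.
    rewrite (le_trans (ler_normB _ _))// (le_trans (lerD (lexx _) xyn))//.
    by rewrite lerDl.
  have hS : `|proj S h| <= s * (C * M).
    rewrite -ler_pdivrMl// -[s^-1]gtr0_norm ?invr_gt0// -normrZ -betaS.
    by rewrite (le_trans (HC _).1)// ler_wpM2l// ltW.
  have hW : `|proj W h - F h| <= s ^+ i * (C * M).
    rewrite -ler_pdivrMl ?exprn_gt0// -[(s ^+ i)^-1]gtr0_norm ?invr_gt0 ?exprn_gt0//.
    by rewrite -normrZ -betaW (le_trans (HC _).2)// ler_wpM2l// ltW.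
  have sC1 : s * (C * M) <= 1 by rewrite -ler_pdivlMr// mul1r ltW.
  have hF : `|F h| <= CF * (s * (C * M)).
    by rewrite -FS (le_trans (FB (le_trans hS sC1)))// ler_wpM2l// ltW.
  have hK : `|h| <= s * K.
    rewrite (_ : h = proj S h + F h + (proj W h - F h)); last first.
      by rewrite addrACA subrr addr0 proj_add.
    rewrite (_ : s * K = s * (C * M) + CF * (s * (C * M)) + s * (C * M)); last first.
      by rewrite /K; ring.
    have hW' : `|proj W h - F h| <= s * (C * M).
      rewrite (le_trans hW)// ler_wpM2r ?(ltW CM0)// -[leRHS]expr1.
      by rewrite ler_wiXn2l// ltW.
    rewrite (le_trans (ler_normD _ _))// lerD//.
    by rewrite (le_trans (ler_normD _ _))// lerD.
  have := Hs _ Dh (le_lt_trans hK sK) => hsm.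
  have yG : edist x G = d0%:E by rewrite fineK.
  have := edist_le x (graph_mem y); rewrite yG lee_fin => dG.
  rewrite lerBlDr (le_trans dG)// -[x - _](subrKA y).
  rewrite (le_trans (enorm_triangle _ _))// lerD2l dist_graph betaW betap -scalerBr.
  rewrite (le_trans (enorm_le_norm _))// normrZ gtr0_norm ?invr_gt0 ?exprn_gt0//.
  rewrite mulrC -ler_pdivlMr// ler_pdivrMl ?exprn_gt0// (le_trans hsm)//.
  rewrite (@le_trans _ _ (e / n.+1%:R / K ^+ i * (s * K) ^+ i))//.
    rewrite ler_wpM2l ?(ltW f0)//.
    by rewrite lerXn2r ?nnegrE// mulr_ge0// ltW.
  by rewrite exprMn mulrCA divfK ?gt_eqF.
exists (Num.min du dl); first by rewrite lt_min du0.
move=> s /andP[s0]; rewrite lt_min => /andP[su sl].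
by rewrite Hu ?Hl ?s0.
Qed.

(* Distances to sets are 1-Lipschitz, so their pointwise convergence is
   uniform on compact sets. *)
Let blowup_unif (K : set V) (e : R) : compact K -> 0 < e ->
  (forall x, edist x (X s) @[s --> 0^'+] --> edist x G) ->
  exists2 d : R, 0 < d & forall s y, 0 < s < d -> K y -> X s y ->
    (edist y G <= e%:E)%E.
Proof.
move=> /compact_near_coveringP cK e0 H.
pose P s y := X s y -> (edist y G <= e%:E)%E.
have /near_right0P[d d0 Hd] : \forall s \near 0^'+, K `<=` P s.
  apply: cK => x Kx.
  have fG := edist_fin x G0.
  have e40 : 0 < e / 4 by rewrite divr_gt0.
  have := H x; rewrite -(fineK fG) => /cvge_epsP/(_ _ e40) Hx.
  have e4N : 0 < e / 4 / n.+1%:R by rewrite divr_gt0.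
  exists ([set y | `|x - y| < e / 4 / n.+1%:R],
    [set s | ((fine (edist x G) - e / 4)%:E <= edist x (X s))%E]).
    split.
      have : \forall y \near x, `|x - y| < e / 4 / n.+1%:R.
        by apply/nbhs_normP; exists (e / 4 / n.+1%:R).
      by [].
    by apply: filterS Hx => s /andP[].
  move=> [y s] /= [xy xs] Xy.
  have xyn : enorm (x - y) <= e / 4.
    by rewrite (le_trans (enorm_le_norm _))// mulrC -ler_pdivlMr// ltW.
  have xG : (edist x G <= (e / 2)%:E)%E.
    have := le_trans xs (edist_le x Xy); rewrite -(fineK fG) !lee_fin; lra.
  rewrite (le_trans (edist_triangle y x G))//.
  have yx : ((enorm (y - x))%:E <= (e / 4)%:E)%E by rewrite enormB lee_fin.
  rewrite (le_trans (leeD yx xG))// -EFinD lee_fin; lra.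
by exists d => // s y sd Ky; exact: Hd.
Qed.

Lemma blowup_small :
  (forall x, edist x (X s) @[s --> 0^'+] --> edist x G) ->
  smallon D i (fun h => proj W h - F h - p h).
Proof.
move=> H e e0.
have F0 : F 0 = 0.
  by apply/eqP; rewrite -normr_le0 (le_trans (FB _))// normr0// mulr0.
have [C C0 HC] := proj_bound.
have [CP CP0 HP] := hpoly_bound hp.
pose M := C + 1 + 1; have M0 : 0 < M by rewrite !addr_gt0.
have [L L0 HL] : exists2 L : R, 0 < L & forall x y : V,
    `|x| <= M -> `|y| <= M -> `|p x - p y| <= L * `|x - y|.
  case: i i0 hp => // j _ hpj; have [L L0 HL] := hpoly_lip hpj.
  exists (L * M ^+ j) => [|x y xM yM]; first by rewrite mulr_gt0// exprn_gt0.
  exact: HL.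
(* The bound 1/2 allows absorption at the end; the other bound makes what remains at most e |h|^i
   after doubling. *)
pose e1 := Num.min 2^-1 (e / (2 * (1 + CP))).
have CP1 : 0 < 1 + CP by rewrite addr_gt0.
have e10 : 0 < e1 by rewrite lt_min invr_gt0 ltr0n divr_gt0// mulr_gt0.
(* The image q of h has a graph point within 2 eta. Comparing the defects of the two costs [C + L],
   and 2 eta at most 1 keeps the graph point in the ball of radius [M], where [p] has Lipschitz
   constant [L]. *)
pose eta := Num.min (e1 / (C + L) / 2) (2^-1).
have CL0 : 0 < C + L by rewrite addr_gt0.
have eta0 : 0 < eta by rewrite lt_min invr_gt0 ltr0n !divr_gt0.
pose K := [set x : V | `|x| <= C + 1].
have cK : compact K.
  apply: bounded_closed_compact.
    exists (C + 1); split; first exact: num_real.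
    by move=> r Cr x /= xC; rewrite (le_trans xC)// ltW.
  apply: (@closed_comp V R (fun x => `|x|) [set r | r <= C + 1]).
    by move=> x _; exact: norm_continuous.
  exact: closed_le.
have [s0 s00 Hs] := blowup_unif cK eta0 H.
pose B := C + CF.
have B0 : 0 < B by rewrite addr_gt0.
have si0 : 0 < s0 ^+ i by rewrite exprn_gt0.
(* This ensures s < s0: s^i is at most |h|^i + |y|, which is at most (1 + B) |h| once |h| is below
   1. *)
exists (Num.min (Num.min 1 s0) (s0 ^+ i / (1 + B))).
  by rewrite !lt_min ltr01 s00 divr_gt0// addr_gt0.
move=> h Dh; rewrite !lt_min => /andP[/andP[h1 hs0]].
rewrite ltr_pdivlMr ?addr_gt0// => hB.
have p0 : p 0 = 0 by case: i i0 hp => // j _ hpj; exact: hpolyS_at0 hpj.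
have [->|hn0] := eqVneq h 0.
  rewrite F0 p0 linear0 !subr0 normr0.
  by apply: mulr_ge0; [exact: ltW|exact: exprn_ge0].
have hp0 : 0 < `|h| by rewrite normr_gt0.
set y := proj W h - F h.
have yB : `|y| <= B * `|h|.
  rewrite /y /B mulrDl (le_trans (ler_normB _ _))// lerD ?FB ?(ltW h1)//.
  exact: (HC h).2.
have [t t0 tE] := exists_root i0 (normr_ge0 y).
(* At this scale [s] the image of [h] lies in a fixed compact set, while
   [s ^+ i] is not much larger than [`|h| ^+ i + `|y|]. *)
pose s := Num.max `|h| t.
have sp : 0 < s by rewrite lt_max hp0.
have hs : `|h| <= s by rewrite le_max lexx.
have ys : `|y| <= s ^+ i.
  by rewrite -tE lerXn2r ?nnegrE ?(ltW sp)// le_max lexx orbT.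
have sle : s ^+ i <= `|h| ^+ i + `|y|.
  rewrite /s; have [ht|/ltW th] := leP `|h| t.
    by rewrite tE lerDr exprn_ge0.
  by rewrite lerDl.
have ss0 : s < s0.
  rewrite -(@ltr_pXn2r _ i)// ?nnegrE ?(ltW sp) ?(ltW s00)//.
  rewrite (le_lt_trans sle)//; apply: le_lt_trans hB.
  rewrite mulrDr mulr1 lerD//; last by rewrite mulrC.
  by rewrite -[leRHS]expr1 ler_wiXn2l// ltW.
have sin0 : 0 < s ^+ i by rewrite exprn_gt0.
pose q := beta S i s (h - F h).
have Xq : X s q by exists (h - F h) => //; exists h.
have qS : `|proj S q| <= C.
  rewrite /q betaS normrZ gtr0_norm ?invr_gt0// ler_pdivrMl// mulrC.
  by rewrite (le_trans (HC h).1)// ler_wpM2l// ltW.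
have yW : y \in W by rewrite rpredB// proj_mem.
have qW : `|proj W q| <= 1.
  rewrite /q betaW -/y normrZ gtr0_norm ?invr_gt0//.
  by rewrite ler_pdivrMl// mulr1.
have qK : `|q| <= C + 1.
  by rewrite -(proj_add S q) (le_trans (ler_normD _ _))// lerD.
have := Hs s q; rewrite sp ss0 => /(_ isT qK Xq) qG.
have [|g Gg qg] := @edist_lt _ _ q G (eta *+ 2)%:E.
  by rewrite (le_lt_trans qG)// lte_fin mulr2n ltrDl.
rewrite lte_fin in qg; have {}qg := le_lt_trans (norm_le_enorm _) qg.
have eta1 : eta *+ 2 <= 1.
  have two (u : R) : u <= 2^-1 -> u *+ 2 <= 1.
    by move=> u2; rewrite mulr2n [leRHS]splitr div1r lerD.
  by apply: two; rewrite ge_min lexx orbT.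
have eta2 : (C + L) * (eta *+ 2) <= e1.
  have : eta <= e1 / (C + L) / 2 by rewrite ge_min lexx.
  by rewrite ler_pdivlMr// ler_pdivlMr// mulr_natr mulrC.
have gM : `|g| <= M.
  rewrite -(subrK q g) (le_trans (ler_normD _ _))// addrC lerD//.
  by rewrite distrC (le_trans (ltW qg)).
have qM : `|q| <= M by rewrite (le_trans qK)// lerDl.
have fin : `|y - p h| <= e1 * s ^+ i.
  rewrite mulrC -ler_pdivrMl// -[(s ^+ i)^-1]gtr0_norm ?invr_gt0// -normrZ.
  rewrite scalerBr -betap -betaW -/q.
  have -> : proj W q - p q = proj W (q - g) + (p g - p q).
    by rewrite linearB /= -Gg addrA subrK.
  rewrite (le_trans (ler_normD _ _))// (le_trans _ eta2)// mulrDl lerD//.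
    by rewrite (le_trans (HC _).2)// ler_wpM2l ?ltW// ltW.
  by rewrite (le_trans (HL _ _ gM qM))// distrC ler_wpM2l ?ltW// ltW.
have yle : `|y| <= CP * `|h| ^+ i + `|y - p h|.
  rewrite -{1}(subrK (p h) y) addrC (le_trans (ler_normD _ _))// lerD2r.
  exact: HP.
have e1h : e1 <= 2^-1 by rewrite ge_min lexx.
have e1e : e1 * (2 * (1 + CP)) <= e.
  by rewrite -ler_pdivlMr ?mulr_gt0// ge_min lexx orbT.
have Hi : 0 <= `|h| ^+ i by rewrite exprn_ge0.
move: (`|y - p h|) (normr_ge0 (y - p h)) fin yle => Dl Dl0 fin yle.
(* The defect occurs on both sides; its coefficient e1 on the right is at most 1/2. *)
have f1 : Dl <= e1 * (`|h| ^+ i * (1 + CP) + Dl).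
  rewrite (le_trans fin)// ler_wpM2l ?(ltW e10)//.
  by rewrite (le_trans sle)// mulrDr mulr1 -addrA lerD2l mulrC.
have f2 : e1 * Dl <= 2^-1 * Dl by rewrite ler_wpM2r.
have f3 : e1 * (2 * (1 + CP)) * `|h| ^+ i <= e * `|h| ^+ i by rewrite ler_wpM2r.
move: f1; rewrite mulrDr => f1; apply: le_trans f3.
have -> : e1 * (2 * (1 + CP)) * `|h| ^+ i = 2 * (e1 * (`|h| ^+ i * (1 + CP))) by ring.
lra.
Qed.

End Blowup.

(** * Polarization *)

Section Polarization.
Context {R : realType} {n : nat}.
Local Notation V := 'rV[R]_n.
Implicit Types (p q : V -> V) (i j : nat).

Definition lsym i (F : seq V -> V) : Prop :=
  forall s t, size s = i -> perm_eq s t -> F s = F t.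

Lemma lmult_sym_diff i (F : seq V -> V) j : lmult i F -> lsym i F ->
  forall s x y, (size s + j.+1)%N = i ->
  'd (fun x => F (s ++ nseq j.+1 x)) x y = j.+1%:R *: F (s ++ y :: nseq j x).
Proof.
move=> HF SF; elim: j => [|j IH] s x y si.
  have E : (fun x => F (s ++ nseq 1 x)) =
      (fun x => \sum_l x 0 l *: F (s ++ [:: delta_mx 0 l])).
    by apply/funext => z; apply: lmult_expand HF _; rewrite addn0 -si addn1.
  rewrite (eq_diff x y E).
  have D := is_diff_hpolyS
    (fun l => differentiable_cst (F (s ++ [:: delta_mx 0 l])) x).
  rewrite (is_diff_val y D) scale1r.
  rewrite (lmult_expand (t := [::]) y HF); last by rewrite addn0 -si addn1.
  by apply: eq_bigr => l _; rewrite diff_cst_val scaler0 addr0.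
have E : (fun x => F (s ++ nseq j.+2 x)) =
    (fun x => \sum_l x 0 l *: F (rcons s (delta_mx 0 l) ++ nseq j.+1 x)).
  apply/funext => z; rewrite (lmult_expand (t := nseq j.+1 z) z HF).
    by apply: eq_bigr => l _; rewrite cat_rcons.
  by rewrite size_nseq -si !addnS.
rewrite (eq_diff x y E).
have sj (l : 'I_n) : (size (rcons s (delta_mx 0%R l : V)) + j.+1)%N = i.
  by rewrite size_rcons addSnnS.
have dl (l : 'I_n) : differentiable (fun x => F (rcons s (delta_mx 0 l) ++ nseq j.+1 x)) x.
  exact: (hpoly_is_diff (lmult_hpoly HF (sj l))).1.
rewrite (is_diff_val y (is_diff_hpolyS dl)) big_split /=.
have -> : \sum_l y 0 l *: F (rcons s (delta_mx 0 l) ++ nseq j.+1 x) =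
    F (s ++ y :: nseq j.+1 x).
  rewrite (lmult_expand (t := nseq j.+1 x) y HF); last by rewrite size_nseq -si !addnS.
  by apply: eq_bigr => l _; rewrite cat_rcons.
have -> : \sum_l x 0 l *: 'd (fun x => F (rcons s (delta_mx 0 l) ++ nseq j.+1 x)) x y
    = j.+1%:R *: F (s ++ y :: nseq j.+1 x).
  have -> : F (s ++ y :: nseq j.+1 x) = F (rcons s y ++ x :: nseq j x).
    by rewrite cat_rcons.
  rewrite (lmult_expand (t := nseq j x) x HF); last first.
    by rewrite size_nseq size_rcons -si !addnS.
  rewrite scaler_sumr; apply: eq_bigr => l _; rewrite (IH _ _ _ (sj l)).
  rewrite scalerA mulrC -scalerA; congr (_ *: (_ *: _)).
  apply: SF; first by rewrite size_cat size_rcons /= size_nseq -si !addnS.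
  rewrite !cat_rcons perm_cat2l; apply/seq.permP => P /=.
  by rewrite addnCA.
by rewrite -{1}[F _]scale1r -scalerDl [1 + _]addrC natr1.
Qed.

(** Polarization by differentiation: a form that vanishes with j + 1 equal last arguments has zero
    derivative there, which frees one argument up to the factor j + 1. *)
Lemma lmult_polarization i (F : seq V -> V) : lmult i F -> lsym i F ->
  (forall x, F (nseq i x) = 0) -> forall s, size s = i -> F s = 0.
Proof.
move=> HF SF F0.
suff H s j : (size s + j)%N = i -> forall x, F (s ++ nseq j x) = 0.
  move=> s si; rewrite -[s]cats0.
  by apply: (H s 0%N _ 0); rewrite addn0.
elim/last_ind: s j => [|s y IH] j sj x; first by move: sj; rewrite add0n => ->; exact: F0.
have sj' : (size s + j.+1)%N = i by rewrite -sj size_rcons addSnnS.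
have E : (fun x => F (s ++ nseq j.+1 x)) = cst 0.
  by apply/funext => z; exact: IH.
have := lmult_sym_diff HF SF x y sj'; rewrite (eq_diff x y E) diff_cst_val.
move=> /esym/eqP; rewrite scaler_eq0 pnatr_eq0 /= => /eqP.
by rewrite cat_rcons.
Qed.

Lemma symmetric_lsym i (phi : ('I_i -> V) -> V) : symmetric_map phi ->
  lsym i (fun s => phi (fun l => nth 0 s l)).
Proof.
move=> Hphi s t si st; have ti : size t == i by rewrite -(perm_size st) si.
have /tuple_permP[p sE] : perm_eq s (Tuple ti) by [].
rewrite -[RHS](Hphi p); congr phi; apply/funext => l /=.
by rewrite sE -tnth_nth tnth_mktuple (tnth_nth 0).
Qed.

Lemma multilinear_polarization i (phi psi : ('I_i -> V) -> V) :
  multilinear phi -> symmetric_map phi -> multilinear psi -> symmetric_map psi ->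
  (forall x, phi (fun=> x) = psi (fun=> x)) -> phi = psi.
Proof.
move=> mphi sphi mpsi spsi E; apply/funext => v.
pose F s := phi (fun l => nth 0 s l) - psi (fun l => nth 0 s l).
have HF : lmult i F.
  move=> s t c x y st; rewrite /F.
  rewrite (multilinear_lmult mphi c x y st) (multilinear_lmult mpsi c x y st).
  by rewrite scalerBr opprD addrACA.
have SF : lsym i F.
  by move=> s t si st; rewrite /F (symmetric_lsym sphi si st) (symmetric_lsym spsi si st).
have nE (x : V) : (fun l : 'I_i => nth 0 (nseq i x) l) = (fun=> x).
  by apply/funext => l; rewrite nth_nseq ltn_ord.
have F0 x : F (nseq i x) = 0 by rewrite /F nE E subrr.
have vE : (fun l : 'I_i => nth 0 (codom v) l) = v.
  by apply/funext => l; rewrite nth_codom.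
have := lmult_polarization HF SF F0 (s := codom v).
by rewrite size_codom card_ord /F vE => /(_ erefl)/subr0_eq.
Qed.

Lemma hpoly_Dn_symmetric i j p x : hpoly i p -> symmetric_map (Dn j p x).
Proof.
move=> hpi s v; rewrite /Dn; congr (_ x); apply: hpoly_iter_diff_perm hpi _.
rewrite !codomE map_comp perm_map// uniq_perm ?enum_uniq//.
  by rewrite map_inj_uniq ?enum_uniq//; exact: perm_inj.
move=> l; rewrite mem_enum; apply/mapP; exists ((s^-1)%g l); first by rewrite mem_enum.
by rewrite permKV.
Qed.

Lemma hpoly_of_class i p k : hpoly i p -> of_class k setT p.
Proof. by move=> /poly_hpoly/(poly_of_class k). Qed.

Lemma Dn_multilinear i f x : of_class i setT f -> multilinear (Dn i (f : V -> V) x).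
Proof. by move=> fi; exact: (lmult_multilinear (iter_diff_lmult fi (leqnn i) I)). Qed.

Lemma hpoly_iter_diff_sum N (Q : nat -> V -> V) (deg : nat -> nat) vs :
  (forall j, hpoly (deg j) (Q j)) ->
  iter_diff vs (fun x => \sum_(j < N) Q j x) =
  (fun x => \sum_(j < N) iter_diff vs (Q j) x).
Proof.
move=> hQ; elim: vs => [//|v vs IH]; apply/funext => x.
apply: (etrans (eq_diff x v IH)).
have D : is_diff x (fun x => \sum_(j < N) iter_diff vs (Q j) x)
    (fun v => \sum_(j < N) 'd (iter_diff vs (Q j)) x v).
  apply: is_diff_sum => j.
  exact: differentiableP (hpoly_iter_differentiable vs x (hQ j)).
exact: (is_diff_val v D).
Qed.

End Polarization.

(** * Polynomial expansions of sets *)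

Section HomogExt.
Context {R : realType} {n : nat} (S : {vspace 'rV[R]_n}).
Local Notation V := 'rV[R]_n.
Local Notation polymap := (subvs_of S -> subvs_of (perp S)).
Implicit Types (f : polymap) (P : nat -> polymap).

Lemma hpoly_ext_of i f : homog_poly i f -> hpoly i (ext f).
Proof.
move=> [psi [Hpsi fE]]; apply: homog_poly_hpoly.
exists (fun v => vsval (psi (fun l => orthproj S (v l)))); split.
  move=> v j c x y /=.
  have E z : (fun l : 'I_i => orthproj S (if l == j then z else v l)) =
      (fun l => if l == j then orthproj S z else orthproj S (v l)).
    by apply/funext => l; case: eqP.
  by rewrite !E !linearP Hpsi linearP.
by move=> x; rewrite /ext fE.
Qed.

Lemma homog_poly_of_hpoly i (q : V -> V) : hpoly i q ->
  homog_poly i (fun u : subvs_of S => orthproj (perp S) (q (vsval u))).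
Proof.
move=> /hpoly_homog_poly[psi [Hpsi qE]].
exists (fun v => orthproj (perp S) (psi (fun l => vsval (v l)))); split.
  move=> v j c x y /=.
  have E z : (fun l : 'I_i => vsval (if l == j then z else v l)) =
      (fun l => if l == j then vsval z else vsval (v l)).
    by apply/funext => l; case: eqP.
  by rewrite !E !linearP Hpsi linearP.
by move=> u; rewrite qE.
Qed.

Lemma ext_of_hpoly (q : V -> V) x :
  ext (fun u : subvs_of S => orthproj (perp S) (q (vsval u))) x =
  proj (perp S) (q (proj S x)).
Proof. by []. Qed.

Lemma homog_poly_linear (L : 'Hom(subvs_of S, subvs_of (perp S))) :
  homog_poly 1 L.
Proof.
exists (fun v => L (v ord0)); split => // v j c x y /=.
by rewrite (ord1 j) eqxx linearP.
Qed.

Definition psum P i (x : V) : V := \sum_(j < i) ext (P j.+1) x.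

Definition polyfam k P := forall j, (1 <= j <= k)%N -> hpoly j (ext (P j)).

Lemma polyfam_le k k' P : (k' <= k)%N -> polyfam k P -> polyfam k' P.
Proof. by move=> kk H j /andP[j1 jk]; apply: H; rewrite j1 (leq_trans jk). Qed.

Lemma psumS P i x : psum P i.+1 x = psum P i x + ext (P i.+1) x.
Proof. by rewrite /psum big_ord_recr. Qed.

Lemma psum_proj P i x : psum P i (proj S x) = psum P i x.
Proof. by apply: eq_bigr => j _; exact: ext_proj. Qed.

Lemma psum_mem P i x : psum P i x \in perp S.
Proof. by apply: rpred_sum => j _; exact: ext_mem. Qed.

Lemma polyfam_poly P k i : polyfam k P -> (i <= k)%N ->
  poly (psum P i).
Proof.
move=> HP; elim: i => [|i IH] ik.
  by apply: poly_ext poly0 => x; rewrite /psum big_ord0.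
apply: (@poly_ext _ _ (fun x => psum P i x + ext (P i.+1) x)) => [x|].
  by rewrite psumS.
by apply: polyD; [apply: IH; exact: ltnW|apply: poly_hpoly (HP i.+1 _)].
Qed.

Lemma psum_bound P i : polyfam i P -> exists2 C : R, 0 < C & forall x,
  `|x| <= 1 -> `|psum P i x| <= C * `|x|.
Proof.
elim: i => [|i IH] HP.
  by exists 1 => // x _; rewrite /psum big_ord0 normr0 mul1r.
have [C C0 HC] := IH (polyfam_le (leqnSn i) HP).
have [C' C'0 HC'] := hpoly_bound (HP i.+1 (leqnn _)).
exists (C + C') => [|x x1]; first exact: addr_gt0.
rewrite psumS mulrDl (le_trans (ler_normD _ _))// lerD ?HC//.
rewrite (le_trans (HC' _))// ler_wpM2l ?(ltW C'0)//.
by rewrite exprS ler_piMr// exprn_ile1.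
Qed.

Lemma poly_lip (q : V -> V) : poly q -> exists2 C : R, 0 < C & forall x y,
  `|x| <= 1 -> `|y| <= 1 -> `|q x - q y| <= C * `|x - y|.
Proof.
move=> [N [Q [hQ qE]]].
have /choice[C HC] : forall j, exists C : R, 0 < C /\ forall x y : V,
    `|x| <= 1 -> `|y| <= 1 -> `|Q j x - Q j y| <= C * `|x - y|.
  by move=> j; have [C C0 H] := hpoly_lip1 (hQ j); exists C.
exists (1 + \sum_(j < N) C j).
  by rewrite ltr_pwDl// sumr_ge0// => j _; exact/ltW/(HC j).1.
move=> x y x1 y1; rewrite !qE -sumrB (le_trans (ler_norm_sum _ _ _))//.
rewrite mulrDl mul1r ler_wpDl// mulr_suml; apply: ler_sum => j _.
exact: (HC j).2.
Qed.

(* The order [k] condition: with [h = x - a], it bounds the vertical distance of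
   [x] to the graph of the polynomial [P 1 + .. + P k] through [a]. *)
Definition vert D k P := smallon D k (fun h => proj (perp S) h - psum P k h).

(** Dropping the term of top degree changes the defect by something of smaller order than is now
    required. *)
Lemma vert_trunc D k i P : polyfam k P -> (i <= k)%N -> vert D k P -> vert D i P.
Proof.
elim: k => [|k IH] HP; first by rewrite leqn0 => /eqP ->.
rewrite leq_eqVlt => /predU1P[->//|ik] H.
apply: (IH (polyfam_le (leqnSn k) HP) ik).
have H1 := smallon_le (leqnSn k) H.
have H2 := smallon_hpoly D (ltnSn k) (HP k.+1 (leqnn _)).
apply: smallon_ext (smallonD H1 H2) => x _ /=.
by rewrite psumS opprD addrA subrK.
Qed.

(** The successive subtractions leave the S-component unchanged, so each polynomial may be evaluated
    at the original point. *)
Lemma flatE (A : set V) a P i :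
  flat A a P i.+1 = [set h - psum P i h | h in [set x - a | x in A]].
Proof.
elim: i => [|i IH].
  rewrite /=; apply/seteqP; split=> [_ [x Ax <-]|_ [_ [x Ax <-] <-]].
    by exists (x - a); [exists x|rewrite /psum big_ord0 subr0].
  by exists x => //; rewrite /psum big_ord0 subr0.
rewrite -[LHS]/[set x - ext (P i.+1) x | x in flat A a P i.+1] IH.
have E h : h - psum P i h - ext (P i.+1) (h - psum P i h) = h - psum P i.+1 h.
  have -> : ext (P i.+1) (h - psum P i h) = ext (P i.+1) h.
    rewrite -[LHS]ext_proj linearB /= (proj_eq0 (psum_mem P i h)) subr0.
    exact: ext_proj.
  by rewrite psumS opprD addrA.
apply/seteqP; split=> [_ [_ [h Dh <-] <-]|_ [h Dh <-]].
  by exists h => //; rewrite E.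
by exists (h - psum P i h); [exists h|rewrite E].
Qed.

Lemma graphE f : graph f = [set x | proj (perp S) x = ext f x].
Proof. by apply/seteqP; split=> x /graphP. Qed.

Lemma vert_blowup (A : set V) a P i : polyfam i.+1 P ->
  (forall x, x \in S -> exists2 v, ray [set x - a | x in A] v & proj S v = x) ->
  vert [set x - a | x in A] i.+1 P ->
  forall x, edist x (beta S i.+1 s @` flat A a P i.+1) @[s --> 0^'+]
    --> edist x (graph (P i.+1)).
Proof.
move=> HP HD Hv x; have [C C0 HC] := psum_bound (polyfam_le (leqnSn i) HP).
rewrite flatE graphE.
apply: (small_blowup (ltn0Sn i) (psum_proj P i) (psum_mem P i) C0 HC
  (HP i.+1 (leqnn _)) (ext_proj _) (ext_mem _) HD).
by apply: smallon_ext Hv => h _; rewrite psumS opprD addrA.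
Qed.

Lemma blowup_vert (A : set V) a P i : polyfam i.+1 P ->
  (forall x, edist x (beta S i.+1 s @` flat A a P i.+1) @[s --> 0^'+]
    --> edist x (graph (P i.+1))) ->
  vert [set x - a | x in A] i.+1 P.
Proof.
move=> HP Hb; have [C C0 HC] := psum_bound (polyfam_le (leqnSn i) HP).
rewrite flatE graphE in Hb.
have := blowup_small (ltn0Sn i) (psum_mem P i) C0 HC
  (HP i.+1 (leqnn _)) (ext_proj _) (ext_mem _) Hb.
by apply: smallon_ext => h _; rewrite psumS opprD addrA.
Qed.

End HomogExt.

(** * Passing expansions and directions between sets that are close to each other *)

Section Transfer.
Context {R : realType} {n : nat}.
Local Notation V := 'rV[R]_n.
Implicit Types (A B : set V) (a : V) (T : {vspace V}).

Lemma smallon_close_at k A B a (g : V -> V) :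
  smallon [set x - a | x in A] k g ->
  (forall x, A x -> exists2 b, B b & x - b = g (x - a)) -> close_at k A B a.
Proof.
move=> sg H e e0; have [d d0 Hd] := sg e e0.
exists d => // r x /andP[r0 rd] Ax xr; have [b Bb xb] := H x Ax.
exists b => //; rewrite xb (le_trans (Hd _ _ (le_lt_trans xr rd)))//.
  by exists x.
by rewrite ler_wpM2l ?(ltW e0)// lerXn2r ?nnegrE// ltW.
Qed.

(** A point x of A has a point b of B at distance o(r^k) within 2 r of a, and the Lipschitz
    condition compares the values of [psi] at the two. *)
Lemma close_at_smallon k A B a (psi : V -> V) (L : R) : (0 < k)%N -> 0 < L ->
  (forall x y, `|x| <= 1 -> `|y| <= 1 -> `|psi x - psi y| <= L * `|x - y|) ->
  close_at k A B a -> smallon [set b - a | b in B] k psi ->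
  smallon [set x - a | x in A] k psi.
Proof.
move=> k0 L0 HL AB sB.
have H (e : R) : 0 < e -> exists2 d : R, 0 < d & forall r x, 0 < r < d -> A x ->
    `|x - a| <= r -> `|psi (x - a)| <= e * r ^+ k.
  move=> e0; have K0 : 0 < (2 : R) ^+ k by rewrite exprn_gt0.
  have [d d0 Hd] := sB _ (divr_gt0 (divr_gt0 e0 (ltr0n _ 2)) K0).
  have f0 : 0 < Num.min 1 (e / 2 / L) by rewrite lt_min ltr01 !divr_gt0.
  have [d' d'0 Hd'] := AB _ f0.
  exists (Num.min (Num.min d' (d / 2)) 2^-1).
    by rewrite !lt_min d'0 invr_gt0 ltr0n divr_gt0.
  move=> r x /andP[r0]; rewrite !lt_min => /andP[/andP[rd' rd] r2] Ax xr.
  have [|b Bb xb] := Hd' r x _ Ax xr; first by rewrite r0.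
  have r1 : r <= 1 by rewrite (le_trans (ltW r2))// invf_le1// ler1n.
  have rk : r ^+ k <= r by rewrite -[leRHS]expr1 ler_wiXn2l// ltW.
  have rk0 : 0 <= r ^+ k by rewrite exprn_ge0// ltW.
  have xbr : `|x - b| <= r.
    rewrite (le_trans xb)// -[leRHS]mul1r ler_pM ?(ltW f0)//.
    by rewrite ge_min lexx.
  have br : `|b - a| <= r * 2.
    rewrite -[b - a](subrKA x) (le_trans (ler_normD _ _))// mulr_natr mulr2n lerD//.
    by rewrite distrC.
  have b1 : `|b - a| <= 1.
    by rewrite (le_trans br)// -ler_pdivlMr// mul1r ltW.
  have bd : `|b - a| < d by rewrite (le_lt_trans br)// -ltr_pdivlMr.
  rewrite -(subrK (psi (b - a)) (psi (x - a))) (le_trans (ler_normD _ _))//.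
  rewrite [e]splitr mulrDl lerD//.
    rewrite (le_trans (HL _ _ (le_trans xr r1) b1))// opprB addrA subrK.
    rewrite (le_trans (ler_wpM2l (ltW L0) xb))// mulrA ler_wpM2r//.
    by rewrite -ler_pdivlMl// mulrC ge_min lexx orbT.
  rewrite (le_trans (Hd _ _ bd))//; first by exists b.
  rewrite (@le_trans _ _ (e / 2 / 2 ^+ k * (r * 2) ^+ k))//.
    have q0 : 0 <= e / 2 / 2 ^+ k by rewrite ltW// !divr_gt0.
    apply: ler_wpM2l q0 _ _ _; rewrite lerXn2r ?nnegrE//.
    by rewrite mulr_ge0// ltW.
  by rewrite exprMn mulrCA divfK ?gt_eqF// mulrC.
move=> e e0; have [d d0 Hd] := H e e0.
exists d => // _ [x Ax <-] xd.
(* For x = a the radius |x - a| is not allowed; instead [psi 0] is estimated with an auxiliary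
   positive radius and an arbitrary tolerance. *)
have [xa|xa] := eqVneq (x - a) 0; last first.
  by apply: Hd => //; rewrite normr_gt0 xa.
rewrite xa; suff -> : psi 0 = 0.
  by rewrite normr0 mulr_ge0 ?(ltW e0)// exprn_ge0.
apply/normr0_eq0/le_anti; rewrite normr_ge0 andbT.
apply/ler_addgt0Pr => e' e'0; rewrite add0r.
have [d' d'0 Hd'] := H _ e'0.
pose r := Num.min 1 d' / 2.
have m0 : 0 < Num.min 1 d' by rewrite lt_min ltr01.
have r0 : 0 < r by rewrite divr_gt0.
have rm : r < Num.min 1 d' by rewrite ltr_pdivrMr// ltr_pMr// ltr1n.
move: (rm); rewrite lt_min => /andP[r1 rd'].
have := Hd' r x; rewrite r0 rd' xa normr0 => /(_ isT Ax (ltW r0))/le_trans; apply.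
by rewrite ler_piMr ?(ltW e'0)// exprn_ile1 ?(ltW r0)// ltW.
Qed.

Lemma close_at_ray A a T v : close_at 1 (affine_space T a) A a -> v \in T ->
  ray [set x - a | x in A] v.
Proof.
move=> TA vT e e0; pose M := `|v| + 1; have M0 : 0 < M by rewrite ltr_wpDl.
have [d d0 H] := TA _ (divr_gt0 e0 M0).
exists (d / M) => [|s /andP[s0]]; first by rewrite divr_gt0.
rewrite ltr_pdivlMr// => sd.
have Tv : affine_space T a (a + s *: v).
  by rewrite /affine_space /= addrC addKr rpredZ.
have [||x Ax vx] := H (s * M) (a + s *: v) _ Tv.
- by rewrite mulr_gt0.
- by rewrite addrC addKr normrZ gtr0_norm// ler_wpM2l ?(ltW s0)// lerDl.
exists (x - a); first by exists x.
rewrite -addrA -opprD distrC (le_trans vx)// expr1 mulrCA divfK ?gt_eqF//.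
by rewrite mulrC.
Qed.

End Transfer.

(** * Expansion of a submanifold over S *)

Section ChartPolynomials.
Context {R : realType} {n : nat} (S : {vspace 'rV[R]_n}).
Local Notation V := 'rV[R]_n.
Local Notation polymap := (subvs_of S -> subvs_of (perp S)).
Variable P1 : 'Hom(subvs_of S, subvs_of (perp S)).
Implicit Types (P : nat -> polymap).

(** The Lipschitz constant of [q] on the ball of radius C |x| is of order |x|^j, which supplies the
    missing powers. This is why a reparametrization correct to first order is enough. *)
Lemma smallon_hpoly_comp j (q u v : V -> V) (C d : R) : hpoly j.+1 q ->
  0 < d -> 0 < C ->
  (forall x, `|x| < d -> `|u x| <= C * `|x|) ->
  (forall x, `|x| < d -> `|v x| <= C * `|x|) ->
  smallon setT 1 (fun x => u x - v x) ->
  smallon setT j.+1 (fun x => q (u x) - q (v x)).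
Proof.
move=> hq d0 C0 Hu Hv Huv e e0; have [K K0 HK] := hpoly_lip hq.
have f0 : 0 < e / (K * C ^+ j) by rewrite divr_gt0// mulr_gt0// exprn_gt0.
have [d' d'0 H] := Huv _ f0.
exists (Num.min d d') => [|x _]; first by rewrite lt_min d0.
rewrite lt_min => /andP[xd xd'].
have [->|x0] := eqVneq x 0.
  have uv0 (w : V -> V) : (forall x, `|x| < d -> `|w x| <= C * `|x|) -> w 0 = 0.
    move=> Hw; apply/eqP; rewrite -normr_le0 (le_trans (Hw 0 _)) ?normr0//.
    by rewrite mulr0.
  by rewrite (uv0 u Hu) (uv0 v Hv) subrr normr0 mulr_ge0 ?(ltW e0)// exprn_ge0.
have xp : 0 < `|x| by rewrite normr_gt0.
have r0 : 0 < C * `|x| by rewrite mulr_gt0.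
rewrite (le_trans (HK _ _ _ r0 (Hu _ xd) (Hv _ xd)))//.
have KC : 0 < K * (C * `|x|) ^+ j by rewrite mulr_gt0// exprn_gt0.
rewrite (le_trans (ler_wpM2l (ltW KC) (H _ I xd')))// expr1 exprMn exprS.
have Cj : C ^+ j != 0 by rewrite gt_eqF// exprn_gt0.
rewrite le_eqVlt; apply/orP; left; apply/eqP.
move: (C ^+ j) Cj (`|x| ^+ j) => c c0 y; field.
by rewrite c0 gt_eqF.
Qed.

Lemma ext_Hom_linear : linear (ext P1).
Proof. by move=> c x y; rewrite /ext !linearP. Qed.
HB.instance Definition _ := GRing.isLinear.Build _ _ _ _ (ext P1) ext_Hom_linear.

Variables (k : nat) (B : set V) (a : V) (Z : {vspace V}) (G : V -> V)
  (L : {linear V -> V}) (d C : R).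
Hypothesis d0 : 0 < d.
Hypothesis C0 : 0 < C.
Hypothesis HG : chart k B a Z G L d C.
Hypothesis HT : [set` (linfun L @: Z)%VS] = graph P1.

(* [proj S \o L] maps [Z] bijectively onto [S], so [M \o proj S] reparametrizes
   the chart over [S] up to first order. *)
Let chart_inv : exists M : {linear V -> V}, [/\ forall x, M x \in Z,
  forall x, x \in S -> proj S (L (M x)) = x &
  forall w, w \in Z -> M (proj S (L w)) = w].
Proof.
have LT w : w \in Z -> graph P1 (L w).
  by move=> wZ; rewrite -HT /= -[L w]lfunE memv_img.
pose f : 'Hom(subvs_of Z, V) := linfun (fun u : subvs_of Z => proj S (L (vsval u))).
have flin : linear (fun u : subvs_of Z => proj S (L (vsval u))).
  by move=> c u v; rewrite !linearP.
pose gM := GRing.isLinear.Build _ _ _ _ _ flin.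
pose g : {linear subvs_of Z -> V} := HB.pack (fun u : subvs_of Z => proj S (L (vsval u))) gM.
have fE u : linfun g u = proj S (L (vsval u)) by rewrite lfunE.
have f0 : lker (linfun g) == 0%VS.
  apply/lker0P => u v; rewrite !fE => uv; apply: val_inj => /=.
  apply/subr0_eq; set w := _ - _.
  have wZ : w \in Z by rewrite rpredB// subvsP.
  have Lw0 : proj S (L w) = 0 by rewrite /w !linearB /= uv subrr.
  have LwE := (graphP P1 (L w)).1 (LT w wZ).
  have Lw : L w = 0.
    by rewrite -(proj_add S (L w)) LwE Lw0 -[ext _ _]ext_proj Lw0 linear0 addr0.
  have [_ _ _ /(_ w)] := HG; rewrite Lw normr0 mulr0 normr_le0.
  by move=> /eqP.
have Mlin : linear (fun x => vsval ((linfun g)^-1%VF x)) by move=> c x y; rewrite !linearP.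
pose mM := GRing.isLinear.Build _ _ _ _ _ Mlin.
pose M : {linear V -> V} := HB.pack (fun x => vsval ((linfun g)^-1%VF x)) mM.
have MK w : w \in Z -> M (proj S (L w)) = w.
  move=> wZ; have := lker0_lfunK f0 (vsproj Z w); rewrite fE vsprojK//.
  by move=> /(congr1 vsval); rewrite vsprojK.
exists M; split => [x|x xS|]; [exact: subvsP| |exact: MK].
have : graph P1 (proj S x + ext P1 x) by exact: graph_ext.
rewrite -HT /= => /memv_imgP[w wZ]; rewrite lfunE /= => E.
have Ew : proj S (L w) = x by rewrite -E linearD /= proj_ext addr0 !proj_id// proj_mem.
have Mx : M x = w by rewrite -(MK w wZ) Ew.
exact: (etrans (congr1 (fun y => proj S (L y)) Mx) Ew).
Qed.

Lemma chart_polys j : (1 <= j <= k)%N -> exists P,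
  [/\ P 1%N =1 P1, polyfam j P &
    smallon [set b - a | b in B] j (fun h => proj (perp S) h - psum P j h)].
Proof.
have [M [MZ MS MK]] := chart_inv.
have [[tG GL] ZB BZ LC] := HG.
pose H x := G (M (proj S x)).
pose MS' : {linear V -> V} := M \o @proj R n S.
have tH : taylor k H by exact: (taylor_rcomp MS' tG).
have [CM CM0 HCM] := linear_bound MS'.
have HL : smallon setT 1 (fun x => H x - L (MS' x)).
  exact: (smallon_rcomp (D := setT) ltr01 (fun x _ _ => conj I (HCM x)) GL).
have [CL CL0 HCL] := linear_bound L.
have [dH dH0 HdH] := HL 1 ltr01.
pose CH := 1 + CL * CM.
have CH0 : 0 < CH by rewrite addr_gt0// mulr_gt0.
have HB x : `|x| < dH -> `|H x| <= CH * `|x|.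
  move=> xd; rewrite -(subrK (L (MS' x)) (H x)) mulrDl (le_trans (ler_normD _ _))//.
  rewrite lerD//; first by rewrite (le_trans (HdH _ I xd)).
  by rewrite (le_trans (HCL _))// -mulrA ler_wpM2l// ltW.
have H0 : H 0 = 0.
  by apply/eqP; rewrite -normr_le0 (le_trans (HB 0 _)) ?normr0// mulr0.
have HS x : H (proj S x) = H x by rewrite /H proj_id// proj_mem.
have [CS CS0 HCS] := linear_bound (@proj R n S : {linear V -> V}).
have SH : smallon setT 1 (fun x => proj S (H x) - proj S x).
  apply: smallon_ext (smallon_lcomp (@proj R n S : {linear V -> V}) HL) => x _.
  by rewrite linearB /= MS ?proj_mem.
(* Every point of B near a is a + H x with |x| at most a constant times its distance to a, so it
   suffices to expand in the parameter x. *)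
suff K : (1 <= j <= k)%N -> exists P, [/\ P 1%N =1 P1, polyfam j P &
    smallon setT j (fun x => proj (perp S) (H x) - psum P j (H x))].
  move=> /K[P [P11 HP sP]]; exists P; split => // e e0.
  have [c c0 cE] : exists2 c : R, 0 < c & CS * CL * C = c.
    by exists (CS * CL * C) => //; rewrite !mulr_gt0.
  have cj0 : 0 < c ^+ j by rewrite exprn_gt0.
  have [d' d'0 Hd'] := sP _ (divr_gt0 e0 cj0).
  exists (Num.min d (d' / c)); first by rewrite lt_min d0 divr_gt0.
  move=> _ [b Bb <-]; rewrite lt_min ltr_pdivlMr// => /andP[bd bd'].
  have [w wZ [bE wb]] := BZ b Bb bd.
  pose x := proj S (L w).
  have xE : H x = b - a by rewrite /H /x (proj_id (proj_mem S _)) MK// bE addrC addKr.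
  have xc : `|x| <= `|b - a| * c.
    rewrite (le_trans (HCS _))// [leRHS]mulrC -cE -!mulrA ler_pM2l//.
    by rewrite (le_trans (HCL _))// ler_pM2l.
  have := Hd' x I (le_lt_trans xc bd'); rewrite xE => /le_trans; apply.
  rewrite (@le_trans _ _ (e / c ^+ j * (`|b - a| * c) ^+ j))//.
    by rewrite ler_wpM2l ?divr_ge0 ?(ltW e0) ?(ltW cj0)// lerXn2r ?nnegrE// mulr_ge0// ltW.
  by rewrite exprMn mulrCA divfK ?gt_eqF// mulrC.
(* The defect of the first [j] polynomials has an expansion of order [k] and is
   [o(j)], so its leading term is the next polynomial. *)
case: j => // j; elim: j => [|j IH] /andP[_ jk].
  exists (fun=> P1); split => //.
    move=> i; rewrite -eqn_leq => /eqP <-.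
    exact/hpoly_ext_of/homog_poly_linear.
  pose D : {linear V -> V} := @proj R n (perp S) \- ext P1.
  apply: smallon_ext (smallon_lcomp D HL) => x _.
  have DL : D (L (MS' x)) = 0.
    apply/eqP; rewrite -[D _]/(_ - _) subr_eq0.
    by apply/eqP/(graphP P1); rewrite -HT /= -[L _]lfunE memv_img// MZ.
  by rewrite [LHS](linearB D) DL subr0 /psum big_ord1.
have [P [P11 HP sP]] := IH (ltnW jk).
have tg : taylor k (fun x => proj (perp S) (H x) - psum P j.+1 (H x)).
  apply: taylorD; first exact: (taylor_lcomp (@proj R n (perp S) : {linear V -> V}) tH).
  apply: taylorN; apply: taylor_sum => l.
  by apply: taylor_hpoly_comp tH; apply: HP; rewrite /= ltn_ord.
have [p /poly_norm[N [Q [hQ pE]]] sp] := tg.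
(* Enough terms for the index j + 2 to occur in the sum. *)
pose N' := maxn N j.+3.
have jN : (j.+2 < N')%N by rewrite leq_max leqnn orbT.
have sQ : smallon setT j.+1 (fun x => \sum_(i < N') Q i x).
  apply: smallon_ext (smallonB sP (smallon_le (ltnW jk) sp)) => x _.
  by rewrite -(pE N') ?leq_maxl// opprB addrCA subrr addr0.
have Q0 i : (i <= j.+1)%N -> forall x, Q i x = 0.
  move=> ij; apply: (poly_smallon_unique hQ _ sQ ij).
    by move=> l Hl x; apply: Hl; exact: rayT.
  exact: leq_ltn_trans ij (ltnW jN).
have sQ2 : smallon setT j.+2 (fun x => p x - Q j.+2 x).
  apply: (@smallon_ext _ _ _ _
    (fun x => \sum_(i < N') if (j.+2 < i)%N then Q i x else 0)) => [x _|].
    rewrite (pE N') ?leq_maxl// [in RHS](bigD1 (Ordinal jN))//= [RHS]addrAC subrr add0r.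
    rewrite [RHS]big_mkcond; apply: eq_bigr => i _; rewrite -val_eqE /=.
    case: ltngtP => // ij.
    by rewrite Q0// -ltnS.
  apply: smallon_sum => i; case ij: (j.+2 < i)%N.
    exact: (smallon_hpoly _ ij (hQ i)).
  exact: smallon0.
have sg : smallon setT j.+2 (fun x => proj (perp S) (H x) - psum P j.+1 (H x)
    - Q j.+2 x).
  apply: smallon_ext (smallonD (smallon_le jk sp) sQ2) => x _ /=.
  by rewrite addrA subrK.
pose q (u : subvs_of S) := orthproj (perp S) (Q j.+2 (vsval u)).
have hq : hpoly j.+2 (ext q) by exact/hpoly_ext_of/homog_poly_of_hpoly.
pose P' i := if i == j.+2 then q else P i.
have P'E i x : (i <= j.+1)%N -> psum P' i x = psum P i x.
  move=> ij; apply: eq_bigr => l _; rewrite /P' ltn_eqF//.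
  by rewrite ltnS (leq_trans (ltn_ord l)).
exists P'; split => //.
  move=> i /andP[i1 ij]; rewrite /P'; case: eqP => [->//|/eqP ij'].
  by apply: HP; rewrite i1 -ltnS ltn_neqAle ij'.
have s1 : smallon setT j.+2 (fun x => proj (perp S) (H x) - psum P j.+1 (H x)
    - ext q x).
  have := smallon_lcomp (@proj R n (perp S) : {linear V -> V}) sg.
  move=> /(smallon_rcomp (D := setT) ltr01 (fun x _ _ => conj I (HCS x))).
  apply: smallon_ext => x _ /=.
  rewrite !linearB /= HS (proj_perp_id (psum_mem _ _ _)).
  by rewrite (proj_perp_id (proj_mem _ _)) ext_of_hpoly.
(* The new polynomial was found in the parameter x but is wanted at [H x], whose S-component agrees
   with that of x to first order. *)
have s2 : smallon setT j.+2 (fun x => ext q (proj S (H x)) - ext q (proj S x)).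
  apply: (@smallon_hpoly_comp _ _ _ _ (CS * (CH + 1)) dH) => //.
  - by rewrite mulr_gt0// addr_gt0.
  - move=> x xd; rewrite (le_trans (HCS _))// -mulrA ler_pM2l//.
    by rewrite (le_trans (HB _ xd))// ler_wpM2r// lerDl.
  - move=> x xd; rewrite (le_trans (HCS _))// -mulrA ler_pM2l//.
    by rewrite ler_peMl// lerDr ltW.
apply: smallon_ext (smallonB s1 s2) => x _ /=.
have -> : psum P' j.+2 (H x) = psum P j.+1 (H x) + ext q (H x).
  rewrite (psumS P') (P'E _ _ (leqnn _)); congr (_ + ext _ _).
  by rewrite /P' eqxx.
by rewrite !ext_proj opprB opprD !addrA subrK.
Qed.

End ChartPolynomials.

(** * The polynomial graph through the base point, and the pointwise differential *)

Section PolynomialModel.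
Context {R : realType} {n : nat} (S : {vspace 'rV[R]_n}).
Local Notation V := 'rV[R]_n.
Local Notation polymap := (subvs_of S -> subvs_of (perp S)).
Variables (A : set V) (a : V) (T : {vspace V}).
Variable P1 : 'Hom(subvs_of S, subvs_of (perp S)).
Implicit Types (P : nat -> polymap).
Hypothesis TA : close_at 1 (affine_space T a) A a.
Hypothesis TP1 : [set` T] = graph P1.

Let D : set V := [set x - a | x in A].

Lemma ray_over x : x \in S -> exists2 v, ray D v & proj S v = x.
Proof.
move=> xS; have : graph P1 (proj S x + ext P1 x) by exact: graph_ext.
rewrite -TP1 /= => vT; exists (proj S x + ext P1 x).
  exact: close_at_ray TA vT.
by rewrite linearD /= proj_ext addr0 !proj_id// proj_mem.
Qed.

(** The translation puts a on the graph, where the differential in [ptD_spec] is taken. *)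
Let shift P k : polymap :=
  fun u => orthproj (perp S) (proj (perp S) a + psum P k (- a + vsval u)).

Let ext_shift P k x : ext (shift P k) x = proj (perp S) a + psum P k (- a + x).
Proof.
rewrite -[LHS]/(proj (perp S) (proj (perp S) a + psum P k (- a + proj S x))).
rewrite proj_perp_id; last by rewrite rpredD ?psum_mem ?proj_mem.
congr (_ + _); rewrite -[LHS]psum_proj -[RHS]psum_proj; congr psum.
by rewrite !linearD /= (proj_id (proj_mem S x)).
Qed.

Let shift_poly P k : polyfam k P ->
  poly (fun x => proj (perp S) a + psum P k x).
Proof.
move=> HP; apply: polyD; last exact: polyfam_poly HP (leqnn k).
by apply: (@poly_hpoly _ _ 0); exists (proj (perp S) a).
Qed.

Let shift_of_class P k i : polyfam k P -> of_class i setT (shift P k).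
Proof.
move=> HP.
exact: (of_class_affine (- a) (@vsval_continuous _ _ S)
  (@orthproj_continuous _ _ (perp S)) (poly_of_class i (shift_poly HP))).
Qed.

Let psum0 P k : polyfam k P -> psum P k 0 = 0.
Proof.
move=> /psum_bound[C C0 HC]; apply/eqP.
by rewrite -normr_le0 (le_trans (HC 0 _)) ?normr0// mulr0.
Qed.

Let graph_shift P k x :
  graph (shift P k) x <-> proj (perp S) (x - a) = psum P k (x - a).
Proof.
rewrite graphE /= ext_shift [- a + x]addrC linearB /=.
by split=> [->|<-]; [rewrite addrAC subrr add0r|rewrite [RHS]addrC subrK].
Qed.

(** Subtracting f is a global shear that straightens its graph to S; adding f inverts it, because f
    depends on the S-component only and takes values in the complement. *)
Lemma shift_submanifold P k : polyfam k P -> submanifold k (graph (shift P k)).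
Proof.
move=> HP; pose f := ext (shift P k).
have fS x : f (x - f x) = f x /\ f (x + f x) = f x.
  rewrite /f -(ext_proj (shift P k) (_ - _)) -(ext_proj (shift P k) (_ + _)).
  by rewrite linearB linearD /= !proj_ext subr0 addr0 ext_proj.
have tauK x : x - f x + f (x - f x) = x by rewrite (fS x).1 subrK.
have sgK x : x + f x - f (x + f x) = x by rewrite (fS x).2 addrK.
have sgT : (fun x => x - f x) @` setT = setT.
  by apply/seteqP; split=> // x _; exists (x + f x).
have fc (g : V -> V) : poly g -> of_class k setT (fun x => g (- a + x)).
  move=> pg; have idc : continuous (idfun : V -> V) by move=> x; exact: cvg_id.
  exact: (of_class_affine (- a) (h := idfun) (g := idfun) idc idc (poly_of_class k pg)).
have pid : poly (fun x : V => a + x).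
  apply: polyD (poly_hpoly (@hpoly_id R n)).
  by apply: (@poly_hpoly _ _ 0); exists a.
exists (\dim S).
  by rewrite (leq_trans (dimvS (subvf S)))// dimvf /dim /= mul1n.
move=> b gb; exists setT, (fun x => x - f x), (fun x => x + f x), S; split => //.
- have := fc _ (polyD pid (polyN (shift_poly HP))); congr of_class.
  by apply/funext => x; rewrite addNKr /f ext_shift.
- rewrite sgT; have := fc _ (polyD pid (shift_poly HP)); congr of_class.
  by apply/funext => x; rewrite addNKr /f ext_shift.
- split => //; rewrite sgT setIT setIT; apply/seteqP; split=> [_ [x gx <-]|x xS] /=.
    move: gx; rewrite graphE /= -/(f x) => <-.
    by rewrite -{1}(proj_add S x) addrK proj_mem.
  exists (x + f x) => //.
  by rewrite -{1}(proj_id xS); exact: graph_ext.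
Qed.

(** The expansion shows that points of A are close to the graph. The converse closeness passes
    through the tangent space: the graph is tangent to it by its linear part, and A approximates it
    by hypothesis. *)
Lemma shift_approx P k : (0 < k)%N -> P 1%N =1 P1 -> polyfam k P -> vert D k P ->
  graph (shift P k) a /\ approx_by k A a (graph (shift P k)).
Proof.
move=> k0 P11 HP HV; set B := graph _.
have Ba : B a by apply/graph_shift; rewrite subrr linear0 psum0.
have AB : close_at k A B a.
  apply: smallon_close_at HV _ => x Ax.
  exists (a + (proj S (x - a) + psum P k (x - a))).
    apply/graph_shift; rewrite [a + _]addrC addrK linearD /= proj_perp_eq0 ?proj_mem//.
    rewrite add0r (proj_perp_id (psum_mem P k _)) -[RHS]psum_proj linearD /=.
    by rewrite (proj_eq0 (psum_mem P k _)) addr0 proj_id ?proj_mem// psum_proj.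
  rewrite !opprD !addrA; congr (_ - _); apply/eqP.
  by rewrite subr_eq [X in _ == X]addrC proj_add.
have BT : close_at 1 B (affine_space T a) a.
  have sm : smallon [set x - a | x in B] 1 (fun h => psum P k h - ext (P 1%N) h).
    case: k k0 HP {HV AB Ba} @B => // k _ HP B.
    apply: (@smallon_ext _ _ _ _ (fun h => \sum_(j < k) ext (P j.+2) h)) => [h _|].
      by rewrite /psum big_ord_recl addrAC subrr add0r.
    apply: smallon_sum => j; apply: (smallon_hpoly _ (i := j.+2)) => //.
    by apply: HP; rewrite /= ltnS ltn_ord.
  apply: smallon_close_at sm _ => x /graph_shift gx.
  exists (a + (proj S (x - a) + ext P1 (x - a))).
    by rewrite /affine_space /= addrC addKr; have := graph_ext P1 (x - a); rewrite -TP1.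
  have -> : ext (P 1%N) (x - a) = ext P1 (x - a) by rewrite /ext P11.
  rewrite -gx !opprD !addrA; congr (_ - _); apply/eqP.
  by rewrite subr_eq [X in _ == X]addrC proj_add.
split => //; apply: close_at_approx_by => //.
- exact: close_at_le AB.
- exact: close_at_trans BT TA.
Qed.

Lemma vert_pt_diff P k : (0 < k)%N -> P 1%N =1 P1 -> polyfam k P -> vert D k P ->
  pt_diff k A a.
Proof.
move=> k0 P11 HP HV; have [Ba AB] := shift_approx k0 P11 HP HV.
by exists (graph (shift P k)); split => //; exact: shift_submanifold.
Qed.

(** Differentiating k times kills the constant and all terms of degree below k, and the translation
    moves the evaluation point from a to 0. *)
Let Dn_shift P k : (0 < k)%N -> polyfam k P ->
  Dn k (ext (shift P k)) a = Dn k (ext (P k)) 0.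
Proof.
move=> k0 HP; apply/funext => v; rewrite /Dn.
have sv : size (codom v) = k by rewrite size_codom card_ord.
have idc : continuous (idfun : V -> V) by move=> x; exact: cvg_id.
have := iter_diff_affine (- a) (h := idfun) (g := idfun) idc idc
  (poly_of_class k (shift_poly HP)) (vs := codom v).
rewrite sv leqnn map_id => /(_ isT).
have -> : (fun x => idfun (proj (perp S) a + psum P k (- a + idfun x))) =
    ext (shift P k) by apply/funext => x; rewrite ext_shift.
move=> ->; rewrite /= addNr.
pose Q j : V -> V := if j == 0%N then fun=> proj (perp S) a else
  if (j <= k)%N then ext (P j) else fun=> 0.
have hQ j : hpoly j (Q j).
  case: j => [|j]; first by exists (proj (perp S) a).
  have -> : Q j.+1 = if (j.+1 <= k)%N then ext (P j.+1) else fun=> 0 by [].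
  case jk: (j.+1 <= k)%N; last exact: hpoly0.
  by apply: HP; rewrite jk.
have -> : (fun x => proj (perp S) a + psum P k x) = (fun x => \sum_(j < k.+1) Q j x).
  apply/funext => x; rewrite big_ord_recl; congr (_ + _).
  by apply: eq_bigr => j _; rewrite /Q /= ltn_ord.
rewrite (hpoly_iter_diff_sum _ _ hQ) big_ord_recr /= big1 ?add0r.
  by rewrite /Q leqnn gtn_eqF.
move=> j _; have := hpoly_iter_diff (codom v) (hQ j).
by rewrite sv leqNgt ltn_ord /= => ->.
Qed.

Lemma ptD_spec_exists P k : (0 < k)%N -> P 1%N =1 P1 -> polyfam k P ->
  vert D k P -> ptD_spec k A a S (Dn k (ext (P k)) 0).
Proof.
move=> k0 P11 HP HV; have hPk : hpoly k (ext (P k)) by apply: HP; rewrite k0 leqnn.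
split.
- exact: (Dn_multilinear 0 (hpoly_of_class k hPk)).
- by move=> s v; apply: hpoly_Dn_symmetric hPk _ _.
- exists (shift P k); split; first exact: shift_of_class.
    by rewrite Dn_shift.
  exact: (shift_approx k0 P11 HP HV).2.
Qed.

Lemma ptD_spec_diag P k phi : (0 < k)%N -> polyfam k P -> vert D k P ->
  ptD_spec k A a S phi -> forall x, phi (fun=> x) = k`!%:R *: ext (P k) x.
Proof.
move=> k0 HP HV [_ _ [f [fk -> /approx_by_close_at[_ _ AB]]]].
have Fk := ext_of_class fk.
pose Q j h := (j`!%:R : R)^-1 *: iter_diff (nseq j h) (ext f) a.
have [hQ sQ] : (forall j, (j <= k)%N -> hpoly j (Q j)) /\
    smallon setT k (fun h => ext f (a + h) - \sum_(j < k.+1) Q j h).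
  exact: (taylor_of_class Fk (I : setT a)).
have QS j x : (j <= k)%N -> Q j (proj S x) = Q j x.
  move=> jk; rewrite /Q; congr (_ *: _).
  have E h : iter_diff (nseq j h) (ext f) a =
      vsval (iter_diff (nseq j (orthproj S h)) f (0 + orthproj S a)).
    have := iter_diff_affine 0 (@orthproj_continuous _ _ S)
      (@vsval_continuous _ _ (perp S)) fk (vs := nseq j h).
    rewrite size_nseq map_nseq => /(_ jk) /(congr1 (@^~ a)); apply: etrans.
    by congr (iter_diff _ _ _); apply/funext => z; rewrite add0r.
  by rewrite !E orthproj_vsval.
(* By Taylor's theorem this polynomial is o(|h|^k) on the graph of f. Being locally Lipschitz, it is
   so on A too, where it can be compared with the expansion by the P_j. *)
pose psi h := proj (perp S) (a + h) - \sum_(j < k.+1) Q j h.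
have ppsi : poly psi.
  apply: polyD.
    apply: (@poly_ext _ _ (fun h => proj (perp S) a + proj (perp S) h)) => [h|].
      by rewrite linearD.
    apply: polyD.
      by apply: (@poly_hpoly _ _ 0); exists (proj (perp S) a).
    exact: (poly_lcomp (@proj R n (perp S)) (poly_hpoly (@hpoly_id R n))).
  apply: polyN; apply: poly_sum => j; apply: poly_hpoly (hQ j _).
  by rewrite -ltnS.
have [L L0 HL] := poly_lip ppsi.
have sB : smallon [set b - a | b in graph f] k psi.
  apply: smallon_ext (smallonS (@subsetT _ _) sQ) => h; rewrite inE => -[b gb <-].
  by move: gb; rewrite graphE /psi /= [a + _]addrC subrK => ->.
have sA := close_at_smallon k0 L0 HL AB sB.
(* The difference of the two expansions in degree j; in degree 0 the constant term of f is compared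
   with the vertical component of a. *)
pose E j : V -> V := if (j <= k)%N then fun x =>
    Q j x - (if j is j'.+1 then ext (P j) x else proj (perp S) a) else fun=> 0.
have hE j : hpoly j (E j).
  rewrite /E; case: ifP => jk; last exact: hpoly0.
  apply: hpolyD; first exact: hQ.
  apply: hpolyN; case: j jk => [_|j jk]; first by exists (proj (perp S) a).
  exact: HP.
have sE : smallon D k (fun x => \sum_(j < k.+1) E j x).
  apply: smallon_ext (smallonB HV sA) => h _; rewrite /psi /=.
  rewrite [proj (perp S) (a + h)](linearD (@proj R n (perp S))).
  rewrite [RHS](eq_bigr (fun j : 'I_k.+1 => Q j h -
     (if nat_of_ord j is j'.+1 then ext (P j) h else proj (perp S) a))); last first.
    by move=> j _; rewrite /E -ltnS ltn_ord.
  rewrite sumrB [X in _ = _ - X]big_ord_recl /= -/(psum P k h).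
  move: (proj _ h) (proj _ a) (psum P k h) (\sum_(j < k.+1) Q j h) => x1 x2 x3 x4.
  by apply/rowP => l; rewrite !mxE; ring.
have ES j x : E j (proj S x) = E j x.
  rewrite /E; case: ifP => // jk; rewrite QS//; congr (_ - _).
  by case: j {jk} => // j; exact: ext_proj.
have Ek := poly_smallon_unique hE _ sE (leqnn k) (ltnSn k).
move=> x; rewrite /Dn codom_cst.
have {}Ek : E k x = 0.
  (* The differences depend on the S-component only, and over each point of S there is a ray. *)
  apply: Ek => j Hj y; have [v rv vy] := ray_over (proj_mem S y).
  by rewrite -ES -vy ES; exact: Hj.
move: Ek; rewrite /E leqnn /Q; case: (k) k0 => // k' _ /subr0_eq <-.
by rewrite scalerA mulfV ?scale1r// pnatr_eq0 -lt0n fact_gt0.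
Qed.

Lemma tangent_dim : \dim S = \dim T /\ (perp S :&: T = 0)%VS.
Proof.
have TE x : x \in T -> proj (perp S) x = ext P1 x.
  by move=> xT; apply/(graphP P1); rewrite -TP1.
have PT : (perp S :&: T = 0)%VS.
  apply/eqP; rewrite -subv0; apply/subvP => x /memv_capP[xS xT].
  rewrite memv0 -(proj_add S x) TE// -[ext _ _]ext_proj (proj_eq0 xS) add0r.
  by rewrite /ext !linear0.
split => //.
have -> : S = (linfun (@proj R n S) @: T)%VS.
  apply/vspaceP => x; apply/idP/memv_imgP => [xS|[y yT ->]].
    exists (x + ext P1 x).
      have := graph_ext P1 x; rewrite -TP1 (proj_id xS); exact.
    by rewrite lfunE linearD /= proj_ext addr0 proj_id.
  by rewrite lfunE proj_mem.
apply: limg_dim_eq; apply/eqP; rewrite -subv0; apply/subvP => x.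
move=> /memv_capP[xT]; rewrite memv_ker lfunE /= => /eqP x0.
by rewrite -PT memv_cap xT andbT -(proj_add S x) x0 add0r proj_mem.
Qed.

Lemma tangent_closure : closure A a.
Proof.
move=> U /nbhs_normP[e /= e0 HU].
have [d d0 H] := TA ltr01.
pose r := Num.min d e / 2.
have m0 : 0 < Num.min d e by rewrite lt_min d0.
have r0 : 0 < r by rewrite divr_gt0.
have : r < Num.min d e by rewrite ltr_pdivrMr// ltr_pMr// ltr1n.
rewrite lt_min => /andP[rd re].
have [|||x Ax ax] := H r a.
- by rewrite r0.
- by rewrite /affine_space /= subrr mem0v.
- by rewrite subrr normr0 ltW.
exists x; split => //; apply: HU => /=.
by rewrite (le_lt_trans ax)// mul1r expr1.
Qed.

End PolynomialModel.

(** * From pointwise differentiability to the expansion, and the equivalence *)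

Section PointwiseDifferentiabilityFacts.
Context {R : realType} {n : nat}.
Local Notation V := 'rV[R]_n.
Implicit Types (A : set V) (a : V) (S T : {vspace V}).

Lemma pt_diff_chart k A a : (0 < k)%N -> pt_diff k A a ->
  exists B Z G L (d C : R),
    let T := (linfun (L : {linear V -> V}) @: Z)%VS in
    [/\ 0 < d /\ 0 < C, chart k B a Z G L d C, close_at k A B a,
        close_at 1 A (affine_space T a) a & close_at 1 (affine_space T a) A a].
Proof.
move=> k0 [B [sB Ba /approx_by_close_at[AB1 BA1 AB]]].
have [Z [G [L [d [C [d0 C0 ch]]]]]] := submanifold_chart k0 sB Ba.
have [BT TB] := chart_tangent d0 C0 ch.
exists B, Z, G, L, d, C; split => //; first exact: close_at_trans AB1 BT.
exact: close_at_trans TB BA1.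
Qed.

(** The expansion is first found along B; its defect is a polynomial, hence locally Lipschitz, and A
    is close to B to order k. *)
Lemma pt_diff_vert k A a S (P1 : 'Hom(subvs_of S, subvs_of (perp S))) :
  (0 < k)%N -> pt_diff k A a -> Tan A a = graph P1 ->
  exists P, [/\ P 1%N =1 P1, polyfam k P & vert [set x - a | x in A] k P].
Proof.
move=> k0 Ak AP1.
have [B [Z [G [L [d [C [[d0 C0] ch AB AT TA]]]]]]] := pt_diff_chart k0 Ak.
have TP1 : [set` (linfun L @: Z)%VS] = graph P1 by rewrite -AP1 (close_at_Tan AT TA).
have kk : (1 <= k <= k)%N by rewrite k0 leqnn.
have [P [P11 HP sP]] := chart_polys d0 C0 ch TP1 kk.
exists P; split => //.
have ppsi : poly (fun h => proj (perp S) h - psum P k h).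
  apply: polyD.
    exact: (poly_lcomp (@proj R n (perp S)) (poly_hpoly (@hpoly_id R n))).
  exact: polyN (polyfam_poly HP (leqnn k)).
have [M M0 HM] := poly_lip ppsi.
exact: close_at_smallon k0 M0 HM AB sP.
Qed.

Lemma homog_poly_ext S i (f : subvs_of S -> subvs_of (perp S)) :
  hpoly i (ext f) -> homog_poly i f.
Proof.
move=> /(@homog_poly_of_hpoly _ _ S) [psi [Hpsi E]]; exists psi; split => // u.
by rewrite -E /ext !orthproj_vsval.
Qed.

End PointwiseDifferentiabilityFacts.

Theorem theorem3p22 (R : realType) (k n m : nat)
    (hk : (0 < k)%N) (hn : (0 < n)%N) (hm : (m <= n)%N)
    (a : 'rV[R]_n) (A : set 'rV[R]_n) (hA : pt_diff 1 A a)
    (S : {vspace 'rV[R]_n}) (hS : \dim S = m)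
    (P1 : 'Hom(subvs_of S, subvs_of (perp S)))
    (hP1 : Tan A a = graph P1) :
  (pt_diff k A a <-> exists P, blowup_condition k A a P1 P) /\
  (forall P, blowup_condition k A a P1 P ->
     forall i, (1 <= i <= k)%N -> ptD i A a S (Dn i (ext (P i)) 0)).
Proof.
have [B [Z [G [L [d [C [_ _ _ AT TA]]]]]]] := pt_diff_chart (ltn0Sn 0) hA.
set T := (linfun L @: Z)%VS in AT TA.
have TP1 : [set` T] = graph P1 by rewrite -hP1 (close_at_Tan AT TA).
have rays := ray_over TA TP1.
have fam P : blowup_condition k A a P1 P -> P 1%N =1 P1 /\ polyfam k P.
  move=> [P11 HP]; split => // j /andP[j1 jk]; apply: hpoly_ext_of.
  case: j j1 jk => [//|[_ _|j _ jk]]; last by have [] := HP j.+2 jk.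
  by rewrite (funext P11); exact: homog_poly_linear.
have blow P : blowup_condition k A a P1 P -> vert [set x - a | x in A] k P.
  move=> HP; have [P11 HPk] := fam P HP.
  (* For k = 1 the condition contains no limit and the expansion comes from the assumed
     differentiability of order 1; for larger k it is read off the blow-ups with i = k. *)
  case: (k) hk HP HPk => // -[|k'] _ HP HPk.
    have [P' [P'1 _ HV]] := pt_diff_vert (ltn0Sn 0) hA hP1.
    by apply: smallon_ext HV => x _; rewrite /psum !big_ord1 /ext P'1 P11.
  by apply: blowup_vert => //; exact: (HP.2 k'.+2 (leqnn _)).2.
have model P i : blowup_condition k A a P1 P -> (1 <= i <= k)%N ->
    [/\ P 1%N =1 P1, polyfam i P & vert [set x - a | x in A] i P].
  move=> HP /andP[i1 ik]; have [P11 HPk] := fam P HP.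
  by split => //; [exact: polyfam_le HPk|exact: vert_trunc HPk ik (blow P HP)].
split; first split.
- move=> Ak; have [P [P11 HP HV]] := pt_diff_vert hk Ak hP1.
  exists P; split => // i /andP[i2 ik].
  have i1 : (0 < i)%N by exact: ltnW.
  split; first by apply/homog_poly_ext/HP; rewrite i1.
  have HPi := polyfam_le ik HP; have HVi := vert_trunc HP ik HV.
  by case: i i2 ik i1 HPi HVi => [//|i] _ _ _ HPi HVi; exact: vert_blowup.
- move=> [P HP]; have [|P11 HPk HV] := model P k HP; first by rewrite hk leqnn.
  exact: (vert_pt_diff TA TP1 hk P11 HPk HV).
move=> P HP i i1k; have [P11 HPi HV] := model P i HP i1k.
have i0 : (0 < i)%N by case/andP: i1k.
have sp := ptD_spec_exists TA TP1 i0 P11 HPi HV.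
split.
  split; first exact: (tangent_closure TA).
    exact: (vert_pt_diff TA TP1 i0 P11 HPi HV).
  have [ST PT] := tangent_dim TP1.
  by exists T; rewrite TP1 -hP1.
split => // phi sphi.
have [m1 s1 _] := sp; have [m2 s2 _] := sphi.
apply: multilinear_polarization m1 s1 m2 s2 _ => x.
(* Every admissible value has the same diagonal, so polarization identifies it with the one given by
   the model. *)
have diag psi := ptD_spec_diag TA TP1 (phi := psi) i0 HPi HV.
by rewrite (diag _ sp) (diag _ sphi).
Qed.
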